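(* Let $R$ be an artin algebra, $\mathcal{A}=\mathrm{mod}(R)$, and let $\mathcal{C}\subseteq\mathcal{A}$ be a full additive, strictly full, Karoubi closed subcategory which is $\mathcal{A}$-approximating. Let $\mathbb{S}_{\mathcal{C}}:=\pi_{\mathcal{C}}\circ\mathbb{S}_{\mathcal{A}}|_{\mathrm{Proj}(\mathcal{H}_{\mathcal{C}})}:\mathrm{Proj}(\mathcal{H}_{\mathcal{C}})\to\mathcal{H}_{\mathcal{C}}$. (i) There is a functorial isomorphism $\mathbb{D}\,\mathrm{Hom}_{\mathcal{H}_{\mathcal{C}}}(\mathsf{P}_M,-)\cong\mathrm{Hom}_{\mathcal{H}_{\mathcal{C}}}(-,\mathbb{S}_{\mathcal{C}}\mathsf{P}_M)$ for $M\in\mathcal{C}$, and $\mathbb{S}_{\mathcal{C}}$ takes values in $\mathrm{Inj}(\mathcal{H}_{\mathcal{C}})$. (ii) $\mathbb{S}_{\mathcal{C}}$ is fully faithful. (iii) For $M\in\mathcal{C}$ indecomposable, $\mathbb{S}_{\mathcal{C}}\mathsf{P}_M$ is an injective hull of $\mathsf{L}_M$. (iv) $\mathbb{S}_{\mathcal{C}}$ extends to a triangulated functor $\mathbb{S}_{\mathcal{C}}:\mathcal{T}_{\mathcal{C}}\to\mathcal{T}_{\mathcal{C}}$.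
   Context: $R$ is finite over its center $k$, a commutative artinian ring; $\mathrm{mod}(R)$ is the category of finitely generated left $R$-modules; $\mathbb{D}=\mathrm{Hom}_k(-,E)$ with $E$ the injective hull of $k/\mathrm{rad}(k)$ as $k$-module, so $\mathbb{D}$ is a duality on finitely generated modules. $\mathrm{Proj}$ and $\mathrm{Inj}$ denote the full subcategories of projective and injective objects. Strictly full means closed under isomorphisms; Karoubi closed means closed under direct summands in $\mathcal{A}$. $\mathcal{T}_{\mathcal{C}}=K^-(\mathcal{C})$ (bounded above cochain complexes modulo homotopy) is a full triangulated subcategory of $\mathcal{T}_{\mathcal{A}}=K^-(\mathcal{A})$. A $\mathcal{C}$-approximation of $X\in\mathcal{T}_{\mathcal{A}}$ is a quasi-isomorphism $X_{\mathcal{C}}\to X$ with $X_{\mathcal{C}}\in\mathcal{T}_{\mathcal{C}}$ inducing an isomorphism $\mathrm{Hom}_{\mathcal{T}_{\mathcal{C}}}(-,X_{\mathcal{C}})\to\mathrm{Hom}_{\mathcal{T}_{\mathcal{A}}}(-,X)|_{\mathcal{T}_{\mathcal{C}}}$. $\mathcal{C}$ is $\mathcal{A}$-approximating if every $X\in\mathcal{T}_{\mathcal{A}}$ has a $\mathcal{C}$-approximation; then $\pi_{\mathcal{C}}X=X_{\mathcal{C}}$ defines a functor $\pi_{\mathcal{C}}:\mathcal{T}_{\mathcal{A}}\to\mathcal{T}_{\mathcal{C}}$ right adjoint to the inclusion. $\mathcal{H}_{\mathcal{A}}$ is the abelian category of complexes $[X^{-2}\to X^{-1}\to X^0]$ in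 $\mathcal{A}$ with no cohomology in negative degrees, morphisms modulo homotopy; it is the heart of the $t$-structure on $\mathcal{T}_{\mathcal{A}}$ whose $\leq 0$ part is generated by complexes with $X^i=0$ for $i>0$. $\mathcal{T}^{\leq 0}_{\mathcal{C}}$ is the strictly full subcategory of $\mathcal{T}_{\mathcal{C}}$ generated by complexes with $X^i=0$ for $i>0$; it is the $\leq 0$ part of a $t$-structure with $\mathcal{T}^{\geq 0}_{\mathcal{C}}=\{X\mid\mathrm{Hom}_{\mathcal{T}_{\mathcal{C}}}(\mathcal{T}^{\leq 0}_{\mathcal{C}}[1],X)=0\}$, and $\mathcal{H}_{\mathcal{C}}$ is its heart, an abelian category; $\pi_{\mathcal{C}}(\mathcal{H}_{\mathcal{A}})=\mathcal{H}_{\mathcal{C}}$. $\mathsf{P}_M$ is the complex with $M$ in degree $0$; $M\mapsto\mathsf{P}_M$ gives equivalences $\mathcal{A}\cong\mathrm{Proj}(\mathcal{H}_{\mathcal{A}})$ and $\mathcal{C}\cong\mathrm{Proj}(\mathcal{H}_{\mathcal{C}})$, so $\mathrm{Proj}(\mathcal{H}_{\mathcal{C}})\subseteq\mathrm{Proj}(\mathcal{H}_{\mathcal{A}})$. For $M\in\mathcal{C}$ indecomposable, $\mathsf{L}_M$ is the unique (up to isomorphism) simple quotient of $\mathsf{P}_M$ in $\mathcal{H}_{\mathcal{C}}$. Known fact defining $\mathbb{S}_{\mathcal{A}}$: for $M\in\mathcal{A}$ there is a unique $\mathbb{S}_{\mathcal{A}}\mathsf{P}_M\in\mathrm{Inj}(\mathcal{H}_{\mathcal{A}})$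 with $\mathbb{D}\,\mathrm{Hom}_{\mathcal{H}_{\mathcal{A}}}(\mathsf{P}_M,-)\cong\mathrm{Hom}_{\mathcal{H}_{\mathcal{A}}}(-,\mathbb{S}_{\mathcal{A}}\mathsf{P}_M)$, and this gives an equivalence $\mathbb{S}_{\mathcal{A}}:\mathrm{Proj}(\mathcal{H}_{\mathcal{A}})\to\mathrm{Inj}(\mathcal{H}_{\mathcal{A}})$. Explicitly, if $M$ has no projective summand then $\mathbb{S}_{\mathcal{A}}\mathsf{P}_M=[\mathbb{D}\mathrm{Tr}M\to I\to J]$ with $0\to\mathbb{D}\mathrm{Tr}M\to I\to J$ a minimal injective copresentation, and if $M$ is projective then $\mathbb{S}_{\mathcal{A}}\mathsf{P}_M=\mathsf{P}_{\mathbb{D}(\mathrm{Hom}_R(M,R))}$. *)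

(* Defs.v *)
From HB Require Import structures.
From mathcomp Require Import all_boot all_order all_algebra.
From mathcomp Require Import generic_quotient ring_quotient boolp.

Set Implicit Arguments.
Unset Strict Implicit.
Unset Printing Implicit Defensive.

Import Order.TTheory GRing.Theory Num.Theory.
Local Open Scope ring_scope.
Local Open Scope quotient_scope.
#[local] Obligation Tactic := idtac.

Definition fin_gen (R : pzRingType) (M : lmodType R) : Prop :=
  exists (n : nat) (s : 'I_n -> M),
    forall x : M, exists c : 'I_n -> R, x = \sum_i c i *: s i.

Definition zero_module (R : pzRingType) (M : lmodType R) : Prop :=
  forall x : M, x = 0.

Section CommutativeRing.
Variable k : comNzRingType.

Definition is_ideal (I : k -> Prop) : Prop :=
  [/\ I 0, forall x y, I x -> I y -> I (x + y) & forall c x, I x -> I (c * x)].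

Definition artinian : Prop :=
  forall I : nat -> k -> Prop, (forall n, is_ideal (I n)) ->
    (forall n x, I n.+1 x -> I n x) ->
    exists n, forall m, (n <= m)%N -> forall x, I n x -> I m x.

Definition maximal_ideal (I : k -> Prop) : Prop :=
  [/\ is_ideal I, ~ I 1 &
      forall J : k -> Prop, is_ideal J -> ~ J 1 ->
        (forall x, I x -> J x) -> forall x, J x -> I x].

Definition jacobson_rad (x : k) : Prop := forall I, maximal_ideal I -> I x.

Definition injective_module (E : lmodType k) : Prop :=
  forall (U V : lmodType k) (f : {linear U -> V}) (g : {linear U -> E}),
    injective f -> exists h : {linear V -> E}, forall u, h (f u) = g u.

(* The embedding k/rad(k) -> E is given as a map k -> E with kernel rad(k);
   essentiality is tested on the cyclic submodules k x of E. *)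
Definition hull_of_top (E : lmodType k) : Prop :=
  injective_module E /\
  exists e : {linear k^o -> E},
    (forall c, e c = 0 <-> jacobson_rad c) /\
    (forall x : E, x <> 0 -> exists a c : k, a *: x = e c /\ a *: x <> 0).

Definition Edual (E V : lmodType k) : Type := {linear V -> E}.

(* k is identified with the center of R by c |-> c%:A. *)
Definition artin_algebra (R : algType k) : Prop :=
  [/\ injective (fun c : k => c%:A : R),
      forall r : R, (forall s : R, r * s = s * r) -> exists c : k, r = c%:A,
      artinian & fin_gen R].

End CommutativeRing.

Record fgmod (R : pzRingType) := FgMod {
  fgmod_car :> lmodType R;
  fgmodP : fin_gen fgmod_car }.

Section Modules.
Variable R : pzRingType.

Lemma fin_gen0 : fin_gen ('rV[R]_0).
Proof.
exists 0%N, (fun _ => 0) => x; exists (fun _ => 0).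
by rewrite big_ord0; apply/matrixP => i [].
Qed.

Lemma fin_gen_prod (M N : fgmod R) : fin_gen (M * N)%type.
Proof.
case: (fgmodP M) => m [s hs]; case: (fgmodP N) => n [t ht].
exists (m + n)%N, (fun i => match split i with
  | inl j => (s j, 0) | inr j => (0, t j) end) => -[x y].
have [c ->] := hs x; have [e ->] := ht y.
exists (fun i => match split i with inl j => c j | inr j => e j end).
rewrite big_split_ord.
have El (i : 'I_m) : split (lshift n i) = inl i := unsplitK (inl i).
have Er (i : 'I_n) : split (rshift m i) = inr i := unsplitK (inr i).
under eq_bigr do rewrite El.
under [X in _ = _ + X]eq_bigr do rewrite Er.
have -> : \sum_(i < m) c i *: (s i, 0 : N) = (\sum_(i < m) c i *: s i, 0).
  apply: (big_ind2 (fun a b => a = (b, 0))) => // [a b a' b' -> ->|i _].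
    by congr pair; rewrite /= addr0.
  by congr pair; rewrite /= scaler0.
have -> : \sum_(i < n) e i *: (0 : M, t i) = (0, \sum_(i < n) e i *: t i).
  apply: (big_ind2 (fun a b => a = (0, b))) => // [a b a' b' -> ->|i _].
    by congr pair; rewrite /= addr0.
  by congr pair; rewrite /= scaler0.
by congr pair; rewrite /= ?addr0 ?add0r.
Qed.

Definition mod0 : fgmod R := FgMod fin_gen0.
Definition modprod (M N : fgmod R) : fgmod R := FgMod (fin_gen_prod M N).

Definition mod_iso (M N : fgmod R) : Prop :=
  exists f : {linear M -> N}, bijective f.

Definition indecomposable (M : fgmod R) : Prop :=
  ~ zero_module M /\
  forall N N', mod_iso M (modprod N N') -> zero_module N \/ zero_module N'.

Definition additive_sub (C : fgmod R -> Prop) : Prop :=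
  C mod0 /\ forall M N, C M -> C N -> C (modprod M N).

Definition strictly_full (C : fgmod R -> Prop) : Prop :=
  forall M N, mod_iso M N -> C M -> C N.

Definition karoubi_closed (C : fgmod R -> Prop) : Prop :=
  forall M N N', mod_iso M (modprod N N') -> C M -> C N.

Definition whole (M : fgmod R) : Prop := True.

End Modules.

Record cpx (R : pzRingType) := Cpx {
  cterm :> int -> fgmod R;
  cdiff : forall i, {linear cterm i -> cterm (i + 1)};
  cdiffK : forall i (x : cterm i), cdiff (i + 1) (cdiff i x) = 0;
  cbounded : exists n : int, forall i, n < i -> zero_module (cterm i) }.

Arguments cdiff {R} X i : rename.
Notation "d_[ X , i ]" := (cdiff X i) (at level 0, format "d_[ X ,  i ]").

Record chmap (R : pzRingType) (X Y : cpx R) := Chmap {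
  chfun :> forall i, {linear X i -> Y i};
  chfunD : forall i (x : X i),
    chfun (i + 1) (d_[X, i] x) = d_[Y, i] (chfun i x) }.

Section Complexes.
Variable R : pzRingType.
Implicit Types (X Y Z : cpx R) (M : fgmod R).

Lemma linear_ext (U V : lmodType R) (f g : {linear U -> V}) : f =1 g -> f = g.
Proof.
case: f g => [f [[f1] [f2]]] [g [[g1] [g2]]] /= /funext efg.
move: g1 g2; rewrite -efg => g1 g2.
by rewrite (Prop_irrelevance f1 g1) (Prop_irrelevance f2 g2).
Qed.

Lemma chmapP X Y (f g : chmap X Y) : (forall i, f i =1 g i) -> f = g.
Proof.
case: f g => [f hf] [g hg] /= e.
have E : f = g by apply: functional_extensionality_dep => i;
  apply: linear_ext; exact: e.
by move: hf hg; rewrite E => hf hg; rewrite (Prop_irrelevance hf hg).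
Qed.

HB.instance Definition _ X Y := gen_eqMixin (chmap X Y).
HB.instance Definition _ X Y := gen_choiceMixin (chmap X Y).

Program Definition chid X : chmap X X :=
  @Chmap R X X (fun i => [the {linear X i -> X i} of idfun]) _.
Next Obligation. by []. Qed.

Program Definition chcomp X Y Z (g : chmap Y Z) (f : chmap X Y) : chmap X Z :=
  @Chmap R X Z (fun i => [the {linear X i -> Z i} of g i \o f i]) _.
Next Obligation. by move=> X Y Z g f i x /=; rewrite !chfunD. Qed.

Definition stalk_term M (i : int) : fgmod R :=
  if i is Posz 0 then M else mod0 R.

Program Definition stalk M : cpx R :=
  @Cpx R (stalk_term M)
    (fun i => [the {linear stalk_term M i -> stalk_term M (i + 1)} of \0]) _ _.
Next Obligation. by []. Qed.
Next Obligation.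
move=> M; exists 0 => -[[|n]|n] //= _ x.
by apply/matrixP => i [].
Qed.

Program Definition cshift X : cpx R :=
  @Cpx R (fun i => X (i + 1))
    (fun i => [the {linear X (i + 1) -> X (i + 1 + 1)} of \- d_[X, i + 1]]) _ _.
Next Obligation. by move=> X i x /=; rewrite raddfN /= cdiffK !oppr0. Qed.
Next Obligation.
move=> X; case: (cbounded X) => n hn; exists n => i hi; apply: hn.
by rewrite (lt_trans hi) // ltrDl.
Qed.

Program Definition chshift X Y (f : chmap X Y) : chmap (cshift X) (cshift Y) :=
  @Chmap R (cshift X) (cshift Y) (fun i => f (i + 1)) _.
Next Obligation. by move=> X Y f i x /=; rewrite raddfN /= chfunD. Qed.

Definition cone_diff X Y (f : chmap X Y) i
    (z : modprod (X (i + 1)) (Y i)) : modprod (X (i + 1 + 1)) (Y (i + 1)) :=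
  (- d_[X, i + 1] z.1, f (i + 1) z.1 + d_[Y, i] z.2).

Lemma cone_diff_linear X Y (f : chmap X Y) i : linear (@cone_diff X Y f i).
Proof.
move=> a [x y] [x' y']; rewrite /cone_diff /=; congr pair => /=.
  by rewrite linearP opprD scalerN.
by rewrite !linearP /= scalerDr addrACA.
Qed.

HB.instance Definition _ X Y (f : chmap X Y) i :=
  GRing.isLinear.Build R _ _ _ (@cone_diff X Y f i) (@cone_diff_linear X Y f i).

Program Definition cone X Y (f : chmap X Y) : cpx R :=
  @Cpx R (fun i => modprod (X (i + 1)) (Y i))
    (fun i => [the {linear modprod (X (i + 1)) (Y i) ->
                           modprod (X (i + 1 + 1)) (Y (i + 1))}
               of @cone_diff X Y f i]) _ _.
Next Obligation.
move=> X Y f i [x y]; rewrite /= /cone_diff /=; congr pair => /=.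
  by rewrite raddfN /= cdiffK !oppr0.
by rewrite raddfD raddfN /= cdiffK chfunD addr0 addNr.
Qed.
Next Obligation.
move=> X Y f; case: (cbounded X) => n hn; case: (cbounded Y) => m hm.
exists (Num.max n m) => i; rewrite gt_max => /andP[hni hmi] [x y].
congr pair; last exact: hm.
by apply: (hn (i + 1)); rewrite (lt_trans hni) // ltrDl.
Qed.

Definition cone_in_fun X Y i (y : Y i) : modprod (X (i + 1)) (Y i) := (0, y).

Lemma cone_in_linear X Y i : linear (@cone_in_fun X Y i).
Proof. by move=> a y y'; congr pair; rewrite /= scaler0 addr0. Qed.

HB.instance Definition _ X Y i :=
  GRing.isLinear.Build R _ _ _ (@cone_in_fun X Y i) (@cone_in_linear X Y i).

Program Definition cone_in X Y (f : chmap X Y) : chmap Y (cone f) :=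
  @Chmap R Y (cone f) (fun i =>
    [the {linear Y i -> modprod (X (i + 1)) (Y i)} of @cone_in_fun X Y i]) _.
Next Obligation.
move=> X Y f i y; rewrite /= /cone_diff /cone_in_fun /=.
by congr pair; rewrite !raddf0 ?oppr0 ?add0r.
Qed.

Program Definition cone_out X Y (f : chmap X Y) : chmap (cone f) (cshift X) :=
  @Chmap R (cone f) (cshift X) (fun i =>
    [the {linear modprod (X (i + 1)) (Y i) -> X (i + 1)} of fst]) _.
Next Obligation. by []. Qed.

(* Every integer has the form i + 1, so both conditions concern all degrees. *)
Definition null_homotopic X Y (f : chmap X Y) : Prop :=
  exists h : forall i, {linear X (i + 1) -> Y i},
    forall i (x : X (i + 1)),
      f (i + 1) x = d_[Y, i] (h i x) + h (i + 1) (d_[X, i + 1] x).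

(* Injectivity and surjectivity of f on the cohomology in degree i + 1. *)
Definition chain_quasi_iso X Y (f : chmap X Y) : Prop := forall i,
  (forall x : X (i + 1), d_[X, i + 1] x = 0 ->
     (exists y, f (i + 1) x = d_[Y, i] y) -> exists x', x = d_[X, i] x') /\
  (forall y : Y (i + 1), d_[Y, i + 1] y = 0 ->
     exists x y', d_[X, i + 1] x = 0 /\ y = f (i + 1) x + d_[Y, i] y').

End Complexes.

Section HomotopyCategory.
Variables (k : comNzRingType) (R : algType k).
Implicit Types (X Y Z : cpx R) (M : fgmod R).

(* Chain maps form a k-module, c acting as the central scalar c%:A of R. *)
Definition central_scale (M : lmodType R) (c : k) (x : M) : M := c%:A *: x.

Lemma central_scale_linear (M : lmodType R) c : linear (@central_scale M c).
Proof.
move=> a x y; rewrite /central_scale scalerDr !scalerA.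
by rewrite mulr_algl mulr_algr.
Qed.

HB.instance Definition _ (M : lmodType R) c :=
  GRing.isLinear.Build R M M _ (@central_scale M c) (@central_scale_linear M c).

Program Definition chzero X Y : chmap X Y :=
  @Chmap R X Y (fun i => [the {linear X i -> Y i} of \0]) _.
Next Obligation. by move=> X Y i x /=; rewrite raddf0. Qed.

Program Definition chadd X Y (f g : chmap X Y) : chmap X Y :=
  @Chmap R X Y (fun i => [the {linear X i -> Y i} of f i \+ g i]) _.
Next Obligation. by move=> X Y f g i x /=; rewrite !chfunD raddfD. Qed.

Program Definition chopp X Y (f : chmap X Y) : chmap X Y :=
  @Chmap R X Y (fun i => [the {linear X i -> Y i} of \- f i]) _.
Next Obligation. by move=> X Y f i x /=; rewrite chfunD raddfN. Qed.

Program Definition chscale X Y (c : k) (f : chmap X Y) : chmap X Y :=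
  @Chmap R X Y
    (fun i => [the {linear X i -> Y i} of @central_scale (Y i) c \o f i]) _.
Next Obligation.
by move=> X Y c f i x /=; rewrite chfunD /central_scale linearZ_LR.
Qed.

Section ChainMapModule.
Variables X Y : cpx R.

Lemma chaddA : associative (@chadd X Y).
Proof. by move=> f g h; apply: chmapP => i x /=; rewrite addrA. Qed.
Lemma chaddC : commutative (@chadd X Y).
Proof. by move=> f g; apply: chmapP => i x /=; rewrite addrC. Qed.
Lemma chadd0 : left_id (chzero X Y) (@chadd X Y).
Proof. by move=> f; apply: chmapP => i x /=; rewrite add0r. Qed.
Lemma chaddN : left_inverse (chzero X Y) (@chopp X Y) (@chadd X Y).
Proof. by move=> f; apply: chmapP => i x /=; rewrite addNr. Qed.

HB.instance Definition _ :=
  GRing.isZmodule.Build (chmap X Y) chaddA chaddC chadd0 chaddN.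

Lemma chscaleA a b (f : chmap X Y) :
  chscale a (chscale b f) = chscale (a * b) f.
Proof.
by apply: chmapP => i x /=; rewrite /central_scale scalerA mulr_algl scalerA.
Qed.
Lemma chscale1 : left_id 1 (@chscale X Y).
Proof.
by move=> f; apply: chmapP => i x /=; rewrite /central_scale !scale1r.
Qed.
Lemma chscaleDr : right_distributive (@chscale X Y) +%R.
Proof.
by move=> a f g; apply: chmapP => i x /=; rewrite /central_scale scalerDr.
Qed.
Lemma chscaleDl (f : chmap X Y) : {morph (@chscale X Y)^~ f : a b / a + b}.
Proof.
by move=> a b; apply: chmapP => i x /=; rewrite /central_scale !scalerDl.
Qed.

HB.instance Definition _ := GRing.Zmodule_isLmodule.Build k (chmap X Y)
  chscaleA chscale1 chscaleDr chscaleDl.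

Definition null_homotopies : {pred chmap X Y} :=
  [pred f | `[< null_homotopic f >]].

Lemma null_homotopies_closed : submod_closed null_homotopies.
Proof.
split.
  apply/asboolP; exists (fun i => [the {linear X (i + 1) -> Y i} of \0]).
  by move=> i x /=; rewrite raddf0 addr0.
move=> c f g /asboolP[h hf] /asboolP[h' hg]; apply/asboolP.
exists (fun i => [the {linear X (i + 1) -> Y i}
                  of (@central_scale (Y i) c \o h i) \+ h' i]) => i x /=.
transitivity (c%:A *: f (i + 1) x + g (i + 1) x); first by [].
rewrite hf hg scalerDr addrACA /= /central_scale (linearD d_[Y, i]).
by rewrite linearZ_LR.
Qed.

HB.instance Definition _ := GRing.isSubmodClosed.Build k (chmap X Y)
  null_homotopies null_homotopies_closed.
HB.instance Definition _ := GRing.isZmodClosed.Build (chmap X Y)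
  null_homotopies (GRing.submod_closedB null_homotopies_closed).

(* The k-module of morphisms X -> Y in K^-(mod R); cpx R is the type of its
   objects. *)
Definition KHom : Type := Quotient.quot null_homotopies.
HB.instance Definition _ := GRing.Zmodule.on KHom.

Definition hclass (f : chmap X Y) : KHom :=
  \pi_(Quotient.quot null_homotopies) f.
Definition hrepr (f : KHom) : chmap X Y :=
  repr (f : Quotient.quot null_homotopies).

Lemma hreprK f : hclass (hrepr f) = f.
Proof. exact: reprK. Qed.

Lemma hclassE f g : hclass f = hclass g <-> null_homotopic (f - g).
Proof.
have E := Quotient.idealrBE null_homotopies f g.
by split => [/eqP|/asboolP] e; [apply/asboolP|apply/eqP]; move: e; rewrite -E.
Qed.

Lemma hclassD : {morph hclass : f g / f + g}.
Proof. exact: (Quotient.pi_add null_homotopies). Qed.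

Definition hscale (c : k) (f : KHom) : KHom := hclass (c *: hrepr f).

Lemma hclassZ c f : hclass (c *: f) = hscale c (hclass f).
Proof.
apply/hclassE/asboolP; rewrite -scalerBr.
apply: (rpredZ (s := null_homotopies)); apply/asboolP/hclassE.
by rewrite hreprK.
Qed.

Lemma hscaleA a b f : hscale a (hscale b f) = hscale (a * b) f.
Proof. by rewrite -(hreprK f) -!hclassZ scalerA. Qed.
Lemma hscale1 : left_id 1 hscale.
Proof. by move=> f; rewrite -(hreprK f) -hclassZ scale1r. Qed.
Lemma hscaleDr : right_distributive hscale +%R.
Proof.
move=> a f g; rewrite -(hreprK f) -(hreprK g) -hclassD -!hclassZ.
by rewrite scalerDr hclassD.
Qed.
Lemma hscaleDl f : {morph hscale^~ f : a b / a + b}.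
Proof.
by move=> a b; rewrite -(hreprK f) -!hclassZ scalerDl hclassD.
Qed.

HB.instance Definition _ := GRing.Zmodule_isLmodule.Build k KHom
  hscaleA hscale1 hscaleDr hscaleDl.

End ChainMapModule.

Definition hid X : KHom X X := hclass (chid X).
Definition hcomp X Y Z (g : KHom Y Z) (f : KHom X Y) : KHom X Z :=
  hclass (chcomp (hrepr g) (hrepr f)).
Definition hshift X Y (f : KHom X Y) : KHom (cshift X) (cshift Y) :=
  hclass (chshift (hrepr f)).

Local Notation "g ∘ f" := (hcomp g f) (at level 40, left associativity).

(* Composition and shift do not depend on the chosen representatives. *)
Lemma hcomp_class X Y Z (g : chmap Y Z) (f : chmap X Y) :
  hclass g ∘ hclass f = hclass (chcomp g f).
Proof.
have /hclassE[h hf] : hclass (hrepr (hclass f)) = hclass f by exact: hreprK.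
have /hclassE[s hg] : hclass (hrepr (hclass g)) = hclass g by exact: hreprK.
set f' := hrepr _ in hf; set g' := hrepr _ in hg.
apply/hclassE; rewrite -/f' -/g'.
exists (fun i => [the {linear X (i + 1) -> Z i}
                  of (g' i \o h i) \+ (s i \o f (i + 1))]) => i x /=.
have -> : g' (i + 1) (f' (i + 1) x) - g (i + 1) (f (i + 1) x) =
  g' (i + 1) ((f' - f) (i + 1) x) + (g' - g) (i + 1) (f (i + 1) x).
  by rewrite /= raddfB /= addrA subrK.
rewrite hf hg !raddfD /= -!chfunD; apply/eqP.
by rewrite addrACA.
Qed.

Lemma hshift_class X Y (f : chmap X Y) :
  hshift (hclass f) = hclass (chshift f).
Proof.
have /hclassE[h hf] : hclass (hrepr (hclass f)) = hclass f by exact: hreprK.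
apply/hclassE; exists (fun i => [the {linear X (i + 1 + 1) -> Y (i + 1)}
                                 of \- h (i + 1)]) => i x /=.
by rewrite [LHS]hf !raddfN /= !opprK.
Qed.

Lemma hcompA X Y Z W (h : KHom Z W) (g : KHom Y Z) (f : KHom X Y) :
  h ∘ (g ∘ f) = h ∘ g ∘ f.
Proof.
rewrite -(hreprK h) -(hreprK g) -(hreprK f) !hcomp_class.
by congr hclass; apply: chmapP.
Qed.

Lemma hcomp1l X Y (f : KHom X Y) : hid Y ∘ f = f.
Proof.
by rewrite -[RHS]hreprK -{1}(hreprK f) hcomp_class; congr hclass; apply: chmapP.
Qed.

Lemma hcomp1r X Y (f : KHom X Y) : f ∘ hid X = f.
Proof.
by rewrite -[RHS]hreprK -{1}(hreprK f) hcomp_class; congr hclass; apply: chmapP.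
Qed.

Definition is_iso X Y (f : KHom X Y) : Prop :=
  exists g : KHom Y X, g ∘ f = hid X /\ f ∘ g = hid Y.

Section Subcategory.
(* The full subcategory of K^-(mod R) with objects satisfying P. *)
Variable P : cpx R -> Prop.

Definition mono X Y (f : KHom X Y) : Prop :=
  forall Z, P Z -> forall g : KHom Z X, f ∘ g = 0 -> g = 0.

Definition epi X Y (f : KHom X Y) : Prop :=
  forall Z, P Z -> forall g : KHom Y Z, g ∘ f = 0 -> g = 0.

Definition Proj X : Prop :=
  P X /\ forall Y Z (f : KHom Y Z), P Y -> P Z -> epi f ->
    forall g : KHom X Z, exists h : KHom X Y, f ∘ h = g.

Definition Inj X : Prop :=
  P X /\ forall Y Z (f : KHom Y Z), P Y -> P Z -> mono f ->
    forall g : KHom Y X, exists h : KHom Z X, h ∘ f = g.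

Definition simple_object L : Prop :=
  [/\ P L, hid L <> 0 &
      forall X (f : KHom X L), P X -> mono f -> f = 0 \/ is_iso f].

Definition simple_quotient X L : Prop :=
  simple_object L /\ exists f : KHom X L, epi f.

Definition injective_hull L I : Prop :=
  Inj I /\ exists j : KHom L I, mono j /\
    forall X (g : KHom I X), P X -> mono (g ∘ j) -> mono g.

End Subcategory.

(* Functors between full subcategories are represented by total maps; their
   values outside of the source subcategory are irrelevant. *)
Record functor_data := FunctorData {
  fobj :> cpx R -> cpx R;
  fmap : forall X Y, KHom X Y -> KHom (fobj X) (fobj Y) }.

Definition is_functor (P Q : cpx R -> Prop) (F : functor_data) : Prop :=
  [/\ forall X, P X -> Q (F X),
      forall X Y (f g : KHom X Y), P X -> P Y ->
        fmap F (f + g) = fmap F f + fmap F g,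
      forall X, P X -> fmap F (hid X) = hid (F X) &
      forall X Y Z (g : KHom Y Z) (f : KHom X Y), P X -> P Y -> P Z ->
        fmap F (g ∘ f) = fmap F g ∘ fmap F f].

Definition functor_comp (G F : functor_data) : functor_data :=
  FunctorData (fun X Y (f : KHom X Y) => fmap G (fmap F f)).

Definition fully_faithful (P : cpx R -> Prop) (F : functor_data) : Prop :=
  forall X Y, P X -> P Y -> bijective (@fmap F X Y).

Definition naturally_isomorphic (P : cpx R -> Prop)
    (F G : functor_data) : Prop :=
  exists alpha : forall X, KHom (F X) (G X),
    (forall X, P X -> is_iso (alpha X)) /\
    (forall X Y (f : KHom X Y), P X -> P Y ->
       fmap G f ∘ alpha X = alpha Y ∘ fmap F f).

Section Heart.
Variable C : fgmod R -> Prop.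

Definition Kminus X : Prop := forall i, C (X i).

Definition Kminus_le0 X : Prop :=
  Kminus X /\ exists Y (f : KHom X Y),
    [/\ Kminus Y, forall i, 0 < i -> zero_module (Y i) & is_iso f].

Definition Kminus_ge0 X : Prop :=
  Kminus X /\ forall Y, Kminus_le0 Y -> forall f : KHom (cshift Y) X, f = 0.

Definition heart X : Prop := Kminus_le0 X /\ Kminus_ge0 X.

Definition quasi_iso X Y (q : KHom X Y) : Prop :=
  exists f : chmap X Y, q = hclass f /\ chain_quasi_iso f.

Definition is_approximation X XC (q : KHom XC X) : Prop :=
  [/\ Kminus XC, quasi_iso q &
      forall Y, Kminus Y -> bijective (fun f : KHom Y XC => q ∘ f)].

Definition approximating : Prop :=
  forall X, exists XC (q : KHom XC X), is_approximation q.

(* The functor pi_C, together with the chosen approximations pi_C X -> X; its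
   action on morphisms is determined by naturality of the latter. *)
Definition approximation_functor (piC : functor_data)
    (eps : forall X, KHom (piC X) X) : Prop :=
  (forall X, is_approximation (eps X)) /\
  (forall X Y (f : KHom X Y), eps Y ∘ fmap piC f = f ∘ eps X).

Definition distinguished X Y Z
    (u : KHom X Y) (v : KHom Y Z) (w : KHom Z (cshift X)) : Prop :=
  exists X' Y' (f : chmap X' Y')
         (a : KHom X X') (b : KHom Y Y') (c : KHom Z (cone f)),
    [/\ Kminus X' /\ Kminus Y',
        [/\ is_iso a, is_iso b & is_iso c],
        b ∘ u = hclass f ∘ a,
        c ∘ v = hclass (cone_in f) ∘ b &
        hshift a ∘ w = hclass (cone_out f) ∘ c].

Definition triangulated_functor (F : functor_data) : Prop :=
  is_functor Kminus Kminus F /\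
  exists phi : forall X, KHom (F (cshift X)) (cshift (F X)),
    [/\ forall X, Kminus X -> is_iso (phi X),
        forall X Y (f : KHom X Y), Kminus X -> Kminus Y ->
          hshift (fmap F f) ∘ phi X = phi Y ∘ fmap F (hshift f) &
        forall X Y Z (u : KHom X Y) (v : KHom Y Z) (w : KHom Z (cshift X)),
          Kminus X -> Kminus Y -> Kminus Z -> distinguished u v w ->
          distinguished (fmap F u) (fmap F v) (phi X ∘ fmap F w)].

(* An isomorphism Hom(Y, S P_M) -> D Hom(P_M, Y) of k-modules for M in C and Y
   in the heart of K^-(C), natural in Y and in M. *)
Definition serre_duality (E : lmodType k) (S : functor_data) : Prop :=
  exists theta : forall M Y, KHom Y (S (stalk M)) -> Edual E (KHom (stalk M) Y),
    [/\ forall M Y, C M -> heart Y -> bijective (theta M Y),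
        forall M Y c f g v, C M -> heart Y ->
          theta M Y (c *: f + g) v = c *: theta M Y f v + theta M Y g v,
        forall M Y Y' (h : KHom Y' Y) f v, C M -> heart Y -> heart Y' ->
          theta M Y' (f ∘ h) v = theta M Y f (h ∘ v) &
        forall M M' (u : KHom (stalk M) (stalk M')) Y f v,
          C M -> C M' -> heart Y ->
          theta M' Y (fmap S u ∘ f) v = theta M Y f (v ∘ u)].

End Heart.

End HomotopyCategory.

(* Main.v *)
Require Import Defs.
From HB Require Import structures.
From mathcomp Require Import all_boot all_order all_algebra.
From mathcomp Require Import boolp classical_sets ring zify.

(* For (i), the duality S_A on H_A is transported to H_C: for Y in H_C let T be
   its truncation in H_A, so that Hom(Y, pi S_A P_M) = Hom(Y, S_A P_M)
   = Hom(T, S_A P_M) = D Hom(P_M, T) = D Hom(P_M, Y).  Parts (ii) and (iii)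
   follow from this duality and from the reflexivity of the finitely generated
   k-modules Hom(P_M, P_N); for the essentiality in (iii), any two nonzero
   submodules of D End(M) meet because End(M) is local.
   For (iv), S_C P_M gives a presentation of the functor D Hom(M, -) on C by
   representable functors.  Building from the top degree downwards, every
   complex X gets a complex S in K^-(C) with a degreewise surjective
   quasi-isomorphism Hom(-, S) -> D Hom(X, -).  Such an S behaves like a
   projective resolution: chain maps lift, uniquely up to homotopy, and the
   cone of a lift of f is a resolution for the cone of f, so that X |-> S is a
   triangulated functor; on a stalk it is S_C by duality. *)

Set Implicit Arguments.
Unset Strict Implicit.
Unset Printing Implicit Defensive.

Import Order.TTheory GRing.Theory Num.Theory.
Local Open Scope ring_scope.
#[local] Obligation Tactic := idtac.

(** * Submodules *)

(** The hearts are never given an abelian structure, and no category of functors on C is formed.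
    Kernels, epimorphisms and truncations in a heart are read off from cones. A natural map from
    Hom(-, S^i) to D Hom(X^i, -) on C is, by Yoneda, one linear form on Hom(X^i, S^i), so a
    comparison with D Hom(X, -) is a family of forms and its naturality is built in. The duality for
    S_C is proved for every M in mod(R), not only for M in C. Hence D Hom(M, -) is presented on C
    for all M, and resolutions exist for all complexes over mod(R). Reflexivity rests on the fact
    that every endomorphism of E is multiplication by a scalar. This is shown along a finite
    filtration of k with simple steps, which also gives that k is noetherian. Degrees i - 1 + 1 and
    i are not convertible, so data are stated in degrees i and i + 1. As complexes are bounded
    above, contractions, lifts and homotopies are all made by recursion from the top degree down. *)

Section Submodules.
Variables (A : pzRingType) (V : lmodType A).

Record submodule := Submodule {
  smem :> V -> Prop;
  smem0 : smem 0;
  smemD : forall x y, smem x -> smem y -> smem (x + y);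
  smemZ : forall a x, smem x -> smem (a *: x) }.

Lemma smemN (S : submodule) x : S x -> S (- x).
Proof. by move=> ?; rewrite -scaleN1r; apply: smemZ. Qed.

Lemma smemB (S : submodule) x y : S x -> S y -> S (x - y).
Proof. by move=> ? ?; apply: smemD => //; apply: smemN. Qed.

Lemma submodule_ext (S T : submodule) : (forall x, S x <-> T x) -> S = T.
Proof.
case: S T => [S S0 SD SZ] [T T0 TD TZ] /= e.
have E : S = T by apply: funext => x; apply/propext.
by move: S0 SD SZ T0 TD TZ; rewrite E => *; congr Submodule;
  apply: Prop_irrelevance.
Qed.

Definition sm_pred (S : submodule) : {pred V} := [pred x | `[< S x >]].

Lemma sm_predP (S : submodule) : submod_closed (sm_pred S).
Proof.
split; first by apply/asboolP; apply: smem0.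
move=> a x y /asboolP Sx /asboolP Sy; apply/asboolP.
by apply: smemD => //; apply: smemZ.
Qed.

HB.instance Definition _ (S : submodule) :=
  GRing.isSubmodClosed.Build A V (sm_pred S) (sm_predP S).

(** Membership passes through the boolean [sm_pred] so that the generic subtype construction
    supplies the module structure. *)
Record sub_type (S : submodule) := SubType {
  sub_val :> V; sub_valP : sub_val \in sm_pred S }.

HB.instance Definition _ S := [isSub for @sub_val S].
HB.instance Definition _ S := [Choice of sub_type S by <:].
HB.instance Definition _ S := [SubChoice_isSubLmodule of sub_type S by <:].

Lemma sub_inj S : injective (@sub_val S).
Proof. exact: val_inj. Qed.

Lemma sub_mem (S : submodule) (x : sub_type S) : S x.
Proof. by apply/asboolP; apply: sub_valP. Qed.

Definition tosub (S : submodule) x (Sx : S x) : sub_type S := @SubType S x (introT (asboolP _) Sx).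

Lemma sub_val_linear S : linear (@sub_val S).
Proof. by []. Qed.

HB.instance Definition _ S :=
  GRing.isLinear.Build A (sub_type S) V _ (@sub_val S) (@sub_val_linear S).

Lemma sub_pick (S : submodule) : exists f : V -> sub_type S, forall x, S x -> f x = x :> V.
Proof.
have H x : exists y : sub_type S, S x -> y = x :> V.
  by have [Sx|nSx] := pselect (S x); [exists (tosub Sx)|exists 0].
by have [f hf] := choice H; exists f.
Qed.

Definition sm_full : submodule.
Proof. by exists (fun _ => True). Defined.

Definition sm_zero : submodule.
Proof.
exists (fun x => x = 0) => // [x y -> ->|a x ->]; first by rewrite addr0.
by rewrite scaler0.
Defined.

Definition sm_cap (S T : submodule) : submodule.
Proof.
exists (fun x => S x /\ T x); first by split; apply: smem0.
  by move=> x y [? ?] [? ?]; split; apply: smemD.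
by move=> a x [? ?]; split; apply: smemZ.
Defined.

Definition sm_add (S T : submodule) : submodule.
Proof.
exists (fun x => exists s t, [/\ S s, T t & x = s + t]).
- by exists 0, 0; split; [exact: smem0|exact: smem0|rewrite addr0].
- move=> x y [s [t [Ss Tt ->]]] [s' [t' [Ss' Tt' ->]]].
  by exists (s + s'), (t + t'); split; [exact: smemD|exact: smemD|rewrite addrACA].
- move=> a x [s [t [Ss Tt ->]]]; exists (a *: s), (a *: t).
  by split; [exact: smemZ|exact: smemZ|rewrite scalerDr].
Defined.

End Submodules.

Arguments sm_full {A V}.
Arguments sm_zero {A V}.

Section IntoSubmodule.
Variables (A : pzRingType) (U V : lmodType A) (f : {linear U -> V}).

Definition sm_ker : submodule U.
Proof.
exists (fun x => f x = 0); first exact: raddf0.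
  by move=> x y fx fy; rewrite linearD /= fx fy addr0.
by move=> a x /= fx; rewrite linearZZ fx scaler0.
Defined.

Definition sm_im : submodule V.
Proof.
exists (fun y => exists x, y = f x); first by exists 0; rewrite raddf0.
  by move=> y y' [x ->] [x' ->]; exists (x + x'); rewrite raddfD.
by move=> a y [x ->]; exists (a *: x); rewrite linearZ_LR.
Defined.

Definition sm_preim (S : submodule V) : submodule U.
Proof.
exists (fun x => S (f x)); first by rewrite raddf0; apply: smem0.
  by move=> x y ? ?; rewrite raddfD; apply: smemD.
by move=> a x ?; rewrite linearZ_LR; apply: smemZ.
Defined.

Lemma into_sub (S : submodule V) : (forall x, S (f x)) ->
  exists g : {linear U -> sub_type S}, forall x, g x = f x :> V.
Proof.
move=> H; pose g x := tosub (H x).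
have lg : linear g by move=> a x y; apply: val_inj; rewrite /= linearP.
pose hg := GRing.isLinear.Build _ _ _ _ g lg.
by exists (HB.pack_for {linear U -> sub_type S} g hg).
Qed.

End IntoSubmodule.

Section Lift.
Variables (A : pzRingType) (U V W : lmodType A).

Lemma mk_linear (g : U -> V) : linear g ->
  exists h : {linear U -> V}, forall x, h x = g x.
Proof.
move=> lg; pose hg := GRing.isLinear.Build _ _ _ _ g lg.
by exists (HB.pack_for {linear U -> V} g hg).
Qed.

End Lift.

(** * Artinian commutative rings *)

(** Zorn's lemma on the submodules above S that avoid y. For y = 1 in the ring, T is a maximal
    ideal; in general y lies in every strictly larger submodule, which produces simple quotients. *)
Lemma zorn_avoid (A : pzRingType) (V : lmodType A) (S : submodule V) y : ~ S y ->
  exists T : submodule V, [/\ forall x, S x -> T x, ~ T y &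
    forall T' : submodule V, (forall x, T x -> T' x) -> ~ T' y ->
      forall x, T' x -> T x].
Proof.
move=> nSy; pose Q (T : submodule V) := (forall x, S x -> T x) /\ ~ T y.
pose R (s t : {T | Q T}) := `[< forall x, sval s x -> sval t x >].
have [||||[T [ST nTy]] hT] := @Zorn _ R.
- by move=> t; apply/asboolP.
- by move=> r s t /asboolP rs /asboolP st; apply/asboolP => x /rs/st.
- move=> [s qs] [t qt] /asboolP st /asboolP ts.
  have E : s = t by apply: submodule_ext => x; split; [exact: st|exact: ts].
  by move: qs qt {st ts}; rewrite E => qs qt; rewrite (Prop_irrelevance qs qt).
(* The empty chain is bounded by S, a nonempty one by its union. *)
- move=> F totF; have [[s0 Fs0]|F0] := pselect (exists s, F s); last first.
    have QS : Q S by split.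
    by exists (exist _ S QS) => s Fs; case: F0; exists s.
  have U0 : exists2 s, F s & sval s 0 by exists s0 => //; apply: smem0.
  have UD x z : (exists2 s, F s & sval s x) -> (exists2 s, F s & sval s z) ->
      exists2 s, F s & sval s (x + z).
    move=> [s Fs sx] [t Ft tz].
    have [/asboolP st|/asboolP ts] := totF _ _ Fs Ft.
      by exists t => //; apply: smemD => //; apply: st.
    by exists s => //; apply: smemD => //; apply: ts.
  have UZ a x : (exists2 s, F s & sval s x) -> exists2 s, F s & sval s (a *: x).
    by move=> [s Fs sx]; exists s => //; apply: smemZ.
  have QU : Q (Submodule U0 UD UZ).
    split => [x Sx|[s Fs sy]] /=; last by case: (svalP s).
    by exists s0 => //; case: (svalP s0) => /(_ x Sx).
  by exists (exist _ _ QU) => s Fs; apply/asboolP => x sx /=; exists s.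
exists T; split=> // T' TT' nT'y x T'x.
have QT' : Q T' by split=> // z /ST/TT'.
have := hT (exist _ T' QT') (introT (asboolP _) TT').
by move=> [E]; rewrite -E.
Qed.

Section Ideals.
Variable k : comNzRingType.
Local Notation ideal := (submodule k^o).

Lemma idealM (I : ideal) (a x : k) : I x -> I (a * x).
Proof. exact: (@smemZ _ _ I a x). Qed.

Lemma idealMr (I : ideal) (a x : k) : I x -> I (x * a).
Proof. by rewrite mulrC; apply: idealM. Qed.

Lemma ideal_of (I : k -> Prop) : is_ideal I -> exists J : ideal, forall x, J x <-> I x.
Proof. by case=> I0 ID IZ; exists (@Submodule _ k^o I I0 ID IZ). Qed.

Lemma is_ideal_of (I : ideal) : is_ideal I.
Proof. by split; [exact: smem0|exact: smemD|exact: (@smemZ _ _ I)]. Qed.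

Definition maximal (m : ideal) := maximal_ideal m.

(** This is the field property of k/m, phrased without the quotient. *)
Lemma maximal_inv (m : ideal) a : maximal m -> ~ m a -> exists b, m (1 - b * a).
Proof.
move=> [_ n1 hm] nma.
pose J0 x := exists u b : k, m u /\ x = u + b * a.
have JI : is_ideal J0.
  split; first by exists 0, 0; split; [exact: smem0|rewrite mul0r addr0].
    move=> x y [u [b [mu ->]]] [u' [b' [mu' ->]]]; exists (u + u'), (b + b').
    by split; [exact: smemD|rewrite mulrDl addrACA].
  move=> c x [u [b [mu ->]]]; exists (c * u), (c * b).
  by split; [exact: idealM|rewrite mulrDr mulrA].
have [[u [b [mu E]]]|nJ1] := pselect (J0 1).
  by exists b; rewrite E addrK.
case: nma; apply: (hm J0) => //.
  by move=> x mx; exists x, 0; rewrite mul0r addr0.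
by exists 0, 1; rewrite mul1r add0r; split=> //; apply: smem0.
Qed.

Lemma exists_maximal (I : ideal) : ~ I 1 ->
  exists m : ideal, maximal m /\ forall x, I x -> m x.
Proof.
move=> /zorn_avoid[m [Im nm1 hm]]; exists m; split=> //; split=> //.
  exact: is_ideal_of.
move=> J /ideal_of[J' EJ] nJ1 mJ x /EJ; apply: hm; last by move/EJ.
by move=> y /mJ/EJ.
Qed.

(* [colength_finite I] says that k/I has finite length: I is reached from k by
   finitely many steps I + (x) > I with simple quotient. *)
Inductive colength_finite : ideal -> Prop :=
| colength_top (I : ideal) : I 1 -> colength_finite I
| colength_step (I J m : ideal) (x : k) : maximal m ->
    (forall a, m a -> I (a * x)) -> ~ I x ->
    (forall y, J y <-> exists a, I (y - a * x)) ->
    colength_finite J -> colength_finite I.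

Hypothesis artk : artinian k.

(** Without a minimal element, iterating a chosen strictly smaller ideal would give a chain that
    never becomes stationary. *)
Lemma ideal_min (P : ideal -> Prop) I0 : P I0 -> exists I, P I /\
  forall J : ideal, P J -> (forall x, J x -> I x) -> forall x, I x -> J x.
Proof.
move=> PI0; apply: contrapT => nmin.
have step (s : {I | P I}) : exists t : {I | P I},
    (forall x, sval t x -> sval s x) /\ exists x, sval s x /\ ~ sval t x.
  case: s => I PI; apply: contrapT => nt; case: nmin; exists I; split=> //.
  move=> J PJ JI x Ix; apply: contrapT => nJx; case: nt.
  by exists (exist _ J PJ); split=> //; exists x.
have [f hf] := choice step.
pose c n := iter n f (exist _ I0 PI0).
have [|n x Ix|n hn] := artk (I := fun n => sval (c n)).
- by move=> n; apply: is_ideal_of.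
- by have [+ _] := hf (c n); apply.
have [_ [x [nx]]] := hf (c n); case; exact: (hn n.+1).
Qed.

(** The product ideal as an intersection: to use membership, apply it to an ideal K containing all
    products. *)
Definition mulI (I J : ideal) : ideal.
Proof.
exists (fun x => forall K : ideal, (forall a b, I a -> J b -> K (a * b)) -> K x).
- by move=> K _; apply: smem0.
- by move=> x y hx hy K hK; apply: smemD; [exact: hx|exact: hy].
- by move=> a x hx K hK; apply: smemZ; apply: hx.
Defined.

Lemma mulI_in (I J : ideal) a b : I a -> J b -> mulI I J (a * b).
Proof. by move=> Ia Jb K; apply. Qed.

Lemma mulI_sub (I J : ideal) x : mulI I J x -> J x.
Proof. by apply=> a b _ Jb; apply: idealM. Qed.

Definition idl (x : k) : ideal.
Proof.
exists (fun y => exists a, y = a * x); first by exists 0; rewrite mul0r.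
  by move=> y z [a ->] [b ->]; exists (a + b); rewrite mulrDl.
by move=> c y [a ->]; exists (c * a); rewrite [LHS]mulrA.
Defined.

(* An ideal I of minimal colength satisfies mI = I for every maximal m; a
   minimal J with JI <> 0 is then a principal ideal (x) with mJ = J for all m,
   so that the annihilator of x lies in no maximal ideal. *)
Lemma artinian_colength : colength_finite sm_zero.
Proof.
have [I [FI Imin]] := ideal_min (P := fun I => colength_finite I) (I0 := sm_full)
  (@colength_top sm_full I).
have mI (m : ideal) : maximal m -> forall y, I y -> mulI m I y.
  move=> mm y Iy; apply: contrapT => nmy.
  (* T contains mI and is maximal avoiding y, so I modulo its intersection with T is simple and
     generated by y. The intersection thus has finite colength, and minimality of I forces y into
     T. *)
  have [T [mT nTy hT]] := zorn_avoid nmy.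
  pose I' := sm_cap T I.
  apply: (nTy); suff: I' y by case.
  apply: Imin => //; last by move=> x [].
  apply: (@colength_step I' I m y mm) => //.
  - move=> a ma; split; last exact: idealM.
    by apply: mT; apply: mulI_in.
  - by move=> [Ty _]; apply: nTy.
  move=> z; split=> [Iz|[a [_]]]; last first.
    by move=> Iza; rewrite -(subrK (a * y) z); apply: smemD => //; apply: idealM.
  have [Tz|nTz] := pselect (T z).
    by exists 0; rewrite mul0r subr0.
  have Ty : sm_add T (idl z) y.
    apply: contrapT => n; apply: nTz; apply: (hT _ _ n).
      move=> x Tx; exists x, 0; split=> //; last by rewrite addr0.
      exact: smem0.
    exists 0, z; split; [exact: smem0|by exists 1; rewrite mul1r|by rewrite add0r].
  have [t [_ [Tt [a ->] Ey]]] := Ty.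
  have nma : ~ m a.
    move=> ma; apply: nTy; rewrite Ey; apply: smemD => //.
    by apply: mT; apply: mulI_in.
  have [b mb] := maximal_inv mm nma; exists b; split; last first.
    by apply: smemB => //; apply: idealM.
  have -> : z - b * y = (1 - b * a) * z - b * t.
    by rewrite Ey mulrDr mulrBl mul1r opprD addrAC mulrA addrA.
  apply: smemB; first by apply: mT; apply: mulI_in.
  exact: idealM.
suff I0 x : I x -> x = 0.
  have E : I = sm_zero.
    by apply: submodule_ext => x; split=> [/I0//|->]; apply: smem0.
  by rewrite -E.
move=> Ix; apply: contrapT => nx.
(* P J says that JI is nonzero; the whole ring has this property because I contains x. *)
pose P (J : ideal) := exists a b : k, [/\ J a, I b & a * b <> 0].
have [|J [[a [b [Ja Ib nab]]] Jmin]] := ideal_min (P := P) (I0 := sm_full).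
  by exists 1, x; split=> //; rewrite mul1r.
have mJ (m : ideal) : maximal m -> forall y, J y -> mulI m J y.
  move=> mm; apply: Jmin; last exact: mulI_sub.
  apply: contrapT => nP; apply: nab.
  have K0 : forall c, J c -> c * 0 = 0 :> k by move=> c _; rewrite mulr0.
  have KD u v : (forall c, J c -> c * u = 0 :> k) ->
     (forall c, J c -> c * v = 0 :> k) -> forall c, J c -> c * (u + v) = 0 :> k.
    by move=> hu hv c Jc; rewrite mulrDr hu // hv // addr0.
  have KZ (e : k) u : (forall c, J c -> c * u = 0 :> k) ->
     forall c, J c -> c * (e * u) = 0 :> k.
    by move=> hu c Jc; rewrite mulrCA hu // mulr0.
  have := mI m mm b Ib (@Submodule _ k^o _ K0 KD KZ); apply=> // u v mu Iv c Jc.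
  apply: contrapT => n; apply: nP; exists (u * c), v; split=> //.
    exact: mulI_in.
  by rewrite (mulrC u) -mulrA.
have Ja' y : J y -> exists c, y = c * a.
  apply: (Jmin (idl a)); first by exists a, b; split=> //; exists 1; rewrite mul1r.
  by move=> z [c ->]; apply: idealM.
have A0 : 0 * a = 0 by rewrite mul0r.
have AD u v : u * a = 0 -> v * a = 0 -> (u + v) * a = 0.
  by move=> hu hv; rewrite mulrDl hu hv addr0.
have AZ (e u : k) : u * a = 0 -> (e * u) * a = 0.
  by move=> hu; rewrite -mulrA hu mulr0.
have [|m [mm hm]] := @exists_maximal (@Submodule _ k^o _ A0 AD AZ).
  by rewrite /= mul1r => a0; apply: nab; rewrite a0 mul0r.
(* M0 is ma, where m contains the annihilator of a. Since J = ka and mJ = J, a = ua for some u in m;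
   then 1 - u kills a, so it lies in m too and 1 is in m. *)
pose M0 y := exists2 u, m u & y = u * a.
have M00 : M0 0 by exists 0; [exact: smem0|rewrite mul0r].
have MD u v : M0 u -> M0 v -> M0 (u + v).
  by move=> [p mp ->] [q mq ->]; exists (p + q); [exact: smemD|rewrite mulrDl].
have MZ (e u : k) : M0 u -> M0 (e * u).
  by move=> [p mp ->]; exists (e * p); [exact: idealM|rewrite mulrA].
have [|u mu Ea] := mJ m mm a Ja (@Submodule _ k^o _ M00 MD MZ).
  move=> p q mp /Ja'[c ->]; exists (p * c); last by rewrite mulrA.
  exact: idealMr.
case: mm => _ n1 _; apply: n1; rewrite -(subrK u 1); apply: smemD => //.
by apply: hm; rewrite /= mulrBl mul1r -Ea subrr.
Qed.

End Ideals.

(** * Finitely generated modules *)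

Section Spans.
Variables (A : pzRingType) (V : lmodType A).

Definition fg_sub (N : submodule V) : Prop :=
  exists s : seq V, (forall y, y \in s -> N y) /\
    forall S : submodule V, (forall y, y \in s -> S y) -> forall x, N x -> S x.

Lemma mem_sum (S : submodule V) (I : Type) (r : seq I) (f : I -> V) :
  (forall i, S (f i)) -> S (\sum_(i <- r) f i).
Proof. by move=> h; elim/big_ind: _ => //; [exact: smem0|exact: smemD]. Qed.

Definition sm_span (s : seq V) : submodule V.
Proof.
exists (fun x => forall S : submodule V, (forall y, y \in s -> S y) -> S x).
- by move=> S _; apply: smem0.
- by move=> x y hx hy S hS; apply: smemD; [exact: hx|exact: hy].
- by move=> a x hx S hS; apply: smemZ; apply: hx.
Defined.

Lemma span_in s y : y \in s -> sm_span s y.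
Proof. by move=> ys S; apply. Qed.

Lemma span_sub (S : submodule V) s : (forall y, y \in s -> S y) ->
  forall x, sm_span s x -> S x.
Proof. by move=> h x; apply. Qed.

Lemma span_nil x : sm_span [::] x -> x = 0.
Proof. exact: (@span_sub sm_zero). Qed.

Lemma span_cons y s x : sm_span (y :: s) x -> exists a, sm_span s (x - a *: y).
Proof.
have h0 : exists a, sm_span s (0 - a *: y).
  by exists 0; rewrite scale0r subr0; apply: smem0.
have hD u v : (exists a, sm_span s (u - a *: y)) ->
    (exists a, sm_span s (v - a *: y)) -> exists a, sm_span s (u + v - a *: y).
  move=> [a ha] [b hb]; exists (a + b); rewrite scalerDl opprD addrACA.
  exact: smemD.
have hZ c u : (exists a, sm_span s (u - a *: y)) ->
    exists a, sm_span s (c *: u - a *: y).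
  by move=> [a ha]; exists (c * a); rewrite -scalerA -scalerBr; apply: smemZ.
apply: (@span_sub (Submodule h0 hD hZ)) => z; rewrite inE => /predU1P[->|zs].
  by exists 1; rewrite scale1r subrr; apply: smem0.
by exists 0; rewrite scale0r subr0; apply: span_in.
Qed.

Lemma fin_genP : fin_gen V <-> exists s : seq V, forall x, sm_span s x.
Proof.
split=> [[n [s hs]]|[s hs]].
  exists (codom s) => x; have [c ->] := hs x.
  by apply: mem_sum => i; apply: smemZ; apply: span_in; apply: codom_f.
exists (size s), (fun i => nth 0 s i) => x.
pose Q x := exists c : 'I_(size s) -> A, x = \sum_i c i *: nth 0 s i.
have Q0 : Q 0 by exists (fun _ => 0); rewrite big1 // => i _; rewrite scale0r.
have QD u v : Q u -> Q v -> Q (u + v).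
  move=> [c ->] [d ->]; exists (fun i => c i + d i).
  by rewrite -big_split; apply: eq_bigr => i _; rewrite scalerDl.
have QZ a u : Q u -> Q (a *: u).
  move=> [c ->]; exists (fun i => a * c i).
  by rewrite scaler_sumr; apply: eq_bigr => i _; rewrite scalerA.
apply: (hs x (Submodule Q0 QD QZ)) => y ys.
have lt : (index y s < size s)%N by rewrite index_mem.
exists (fun i => if i == Ordinal lt then 1 else 0).
rewrite (bigD1 (Ordinal lt)) //= eqxx scale1r nth_index // big1 ?addr0 //.
by move=> i /negPf ->; rewrite scale0r.
Qed.

End Spans.

Lemma fg_subP (A : pzRingType) (V : lmodType A) (N : submodule V) : fg_sub N <-> fin_gen (sub_type N).
Proof.
split=> [[s [sN hs]]|/fin_genP[s hs]].
  have [f hf] := sub_pick N; apply/fin_genP; exists (map f s) => x S hS.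
  pose Q y := exists2 z : sub_type N, S z & y = z :> V.
  have Q0 : Q 0 by exists 0; [exact: smem0|].
  have QD u v : Q u -> Q v -> Q (u + v).
    by move=> [u' Su ->] [v' Sv ->]; exists (u' + v'); [exact: smemD|].
  have QZ a u : Q u -> Q (a *: u).
    by move=> [u' Su ->]; exists (a *: u'); [exact: smemZ|].
  have [|z Sz /sub_inj -> //] := hs (Submodule Q0 QD QZ) _ x (sub_mem x).
  move=> y ys; exists (f y); first by apply: hS; apply: map_f.
  by rewrite hf //; apply: sN.
exists (map (@sub_val _ _ N) s); split=> [y /mapP[x _ ->]|S hS x Nx].
  exact: sub_mem.
have := hs (tosub Nx) (sm_preim (@sub_val _ _ N) S); apply=> y ys.
by apply: hS; apply: map_f.
Qed.

Section ArtinianModules.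
Variables (k : comNzRingType) (artk : artinian k).

(** Induction on the colength of 0: N is generated modulo each ideal of the filtration. *)
Lemma artinian_noetherian (N : submodule k^o) : fg_sub N.
Proof.
suff: exists s : seq k, (forall y, y \in s -> N y) /\
    forall S : submodule k^o, (forall y, y \in s -> S y) -> forall x, N x ->
      exists2 z, S z & (@sm_zero _ k^o) (x - z).
  move=> [s [sN hs]]; exists s; split=> // S hS x /(hs S hS)[z Sz].
  by move=> /= /subr0_eq ->.
elim: (artinian_colength artk) => [I I1|I J m x mm mI nIx hJ _ [s [sN hs]]].
  exists [::]; split=> // S _ x _; exists 0; first exact: smem0.
  by rewrite subr0 -(mulr1 x); apply: idealM.
(* J/I is simple. Either N meets J inside I and the old generators suffice, or one element z of N in
   J but not in I is added and generates J modulo I. *)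
have [NI|] := pselect (forall y, N y -> J y -> I y).
  exists s; split=> // S hS y Ny.
  have hS' y' : y' \in s -> sm_cap S N y'.
    by move=> ?; split; [exact: hS|exact: sN].
  have [z [Sz Nz] Jz] := hs _ hS' y Ny; exists z => //.
  by apply: NI => //; apply: smemB.
move=> /existsNP[z /not_implyP[Nz /not_implyP[Jz nIz]]].
exists (z :: s); split=> [y|S hS y Ny].
  by rewrite inE => /predU1P[->//|]; apply: sN.
have Sz : S z by apply: hS; rewrite mem_head.
have hS' y' : y' \in s -> sm_cap S N y'.
  by move=> ys; split; [apply: hS; rewrite inE ys orbT|exact: sN].
have [w [Sw Nw] Jw] := hs _ hS' y Ny.
have /hJ[a Ia] := Jw; have /hJ[b Ib] := Jz.
have nmb : ~ m b by move=> mb; apply: nIz; rewrite -(subrK (b * x) z);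
  apply: smemD => //; apply: mI.
have [c mc] := maximal_inv mm nmb.
(* Modulo I, y - w is ax and z is bx, and c inverts b modulo m, which kills x. *)
exists (w + a * c * z); first by apply: smemD => //; apply: idealM.
have -> : y - (w + a * c * z) =
  (y - w - a * x) - a * c * (z - b * x) + a * ((1 - c * b) * x) :> k by ring.
apply: smemD; last by apply: idealM; apply: mI.
by apply: smemB => //; apply: idealM.
Qed.

(** Induction on the generators of V: the coefficients of the first generator that occur in N form a
    finitely generated ideal Q, and lifts of its generators reduce N to the span of the others. *)
Lemma submodule_fg (V : lmodType k) (N : submodule V) : fin_gen V -> fg_sub N.
Proof.
move=> /fin_genP[s hs].
suff: fg_sub (sm_cap N (sm_span s)).
  move=> [t [tN ht]]; exists t; split=> [y /tN[]//|S hS x Nx].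
  by apply: ht => //; split.
elim: s {hs} => [|y s [t [tN ht]]].
  exists [::]; split=> // S _ x [_ /span_nil ->]; exact: smem0.
pose Q c := exists2 x, N x & sm_span s (x - c *: y).
have Q0 : Q 0 by exists 0; rewrite ?scale0r ?subr0; exact: smem0.
have QD u v : Q u -> Q v -> Q (u + v).
  move=> [x Nx hx] [z Nz hz]; exists (x + z); first exact: smemD.
  by rewrite scalerDl opprD addrACA; apply: smemD.
have QZ (a u : k) : Q u -> Q (a * u).
  move=> [x Nx hx]; exists (a *: x); first exact: smemZ.
  by rewrite -scalerA -scalerBr; apply: smemZ.
have [cs [csQ hcs]] := artinian_noetherian (@Submodule _ k^o _ Q0 QD QZ).
have [c|f hf] := choice (P := fun c x => Q c -> N x /\ sm_span s (x - c *: y)).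
  by have [[x Nx hx]|nQ] := pselect (Q c); [exists x|exists 0].
have ssub x : sm_span s x -> sm_span (y :: s) x.
  by move=> hx S hS; apply: hx => z zs; apply: hS; rewrite inE zs orbT.
exists (map f cs ++ t); split=> [z|S hS x [Nx /span_cons[a ha]]].
  rewrite mem_cat => /orP[/mapP[c /csQ/hf[Nc hc] ->]|/tN[Nz zs]]; split=> //.
    rewrite -(subrK (c *: y) (f c)); apply: smemD; first exact: ssub.
    by apply: smemZ; apply: span_in; rewrite mem_head.
  exact: ssub.
pose S' c := exists2 z, sm_cap S N z & sm_span s (z - c *: y).
have S0 : S' 0 by exists 0; rewrite ?scale0r ?subr0; exact: smem0.
have SD u v : S' u -> S' v -> S' (u + v).
  move=> [u1 Nu hu] [z Nz hz]; exists (u1 + z); first exact: smemD.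
  by rewrite scalerDl opprD addrACA; apply: smemD.
have SZ (b u : k) : S' u -> S' (b * u).
  move=> [z Nz hz]; exists (b *: z); first exact: smemZ.
  by rewrite -scalerA -scalerBr; apply: smemZ.
have [||z [Sz Nz] hz] := hcs (@Submodule _ k^o _ S0 SD SZ) _ a.
- move=> c cc; have [Nc hc] := hf _ (csQ _ cc); exists (f c) => //; split=> //.
  by apply: hS; rewrite mem_cat map_f.
- by exists x.
rewrite -(subrK z x); apply: smemD => //; apply: ht.
  by move=> w wt; apply: hS; rewrite mem_cat wt orbT.
split; first exact: smemB.
have -> : x - z = (x - a *: y) - (z - a *: y) by rewrite opprB addrA subrK.
exact: smemB.
Qed.

(** The same induction on generators: the chain stabilizes once both its ideals of first
    coefficients and its traces on the span of the others do. *)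
Lemma submodule_dcc (V : lmodType k) (N : nat -> submodule V) : fin_gen V ->
  (forall n x, N n.+1 x -> N n x) ->
  exists n, forall m, (n <= m)%N -> forall x, N n x -> N m x.
Proof.
move=> /fin_genP[s hs] dec.
have dec' n m x : (n <= m)%N -> N m x -> N n x.
  by move=> /subnK <-; elim: (m - n)%N => // d IH /dec.
suff [n hn] : exists n, forall m, (n <= m)%N -> forall x, sm_span s x -> N n x -> N m x.
  by exists n => m nm x; apply: hn.
elim: s {hs} => [|y s [n1 h1]].
  by exists 0%N => m _ x /span_nil -> _; apply: smem0.
pose Q n c := exists2 x, N n x & sm_span s (x - c *: y).
have [||n2 h2] := artk (I := Q).
- move=> n; split.
  + by exists 0; rewrite ?scale0r ?subr0; exact: smem0.
  + move=> u v [x Nx hx] [z Nz hz]; exists (x + z); first exact: smemD.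
    by rewrite scalerDl opprD addrACA; apply: smemD.
  + move=> a u [x Nx hx]; exists (a *: x); first exact: smemZ.
    by rewrite -scalerA -scalerBr; apply: smemZ.
- by move=> n c [x /dec Nx hx]; exists x.
exists (maxn n1 n2) => m; rewrite geq_max => /andP[m1 m2] x /span_cons[a ha] Nx.
have [|z Nz hz] := h2 m m2 a.
  by exists x => //; apply: dec' Nx; rewrite leq_maxr.
rewrite -(subrK z x); apply: smemD => //; apply: (h1 m m1).
  have -> : x - z = (x - a *: y) - (z - a *: y) by rewrite opprB addrA subrK.
  exact: smemB.
apply: smemB; first by apply: dec' Nx; rewrite leq_maxl.
exact: dec' Nz.
Qed.

End ArtinianModules.

(** * Injective hulls and duality *)

Section Dual.
Variables (k : comNzRingType) (E : lmodType k).

(** A partial linear map is given by its graph G, which need only be single-valued at 0; this spares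
    the construction of its domain. *)
Lemma injective_extend (injE : injective_module E) (V : lmodType k)
    (G : submodule (V * E)%type) :
  (forall y, G (0, y) -> y = 0) ->
  exists h : {linear V -> E}, forall x y, G (x, y) -> h x = y.
Proof.
move=> G0.
have [f hf] := mk_linear (g := fun z : sub_type G => (sub_val z).1)
  (fun _ _ _ => erefl).
have [g hg] := mk_linear (g := fun z : sub_type G => (sub_val z).2)
  (fun _ _ _ => erefl).
have [|h hh] := injE _ _ f g.
  move=> z z' e; apply/subr0_eq/sub_inj; set w := z - z'.
  have w1 : (sub_val w).1 = 0 by rewrite -hf linearB e subrr.
  have Gw := sub_mem w; move: w w1 Gw => [[u v] /= _] -> /G0 ->.
  by [].
by exists h => x y Gxy; have := hh (tosub Gxy); rewrite hf hg.
Qed.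

Hypotheses (artk : artinian k) (hullE : hull_of_top E).

(** So every simple module k/m embeds into E. Take I minimal among the ideals not inside m: for any
    other maximal m', m'I = I lies in m', so c in I outside m satisfies mc inside rad(k), and e(c)
    is the required element. *)
Lemma maximal_socle (m : submodule k^o) : maximal m ->
  exists s : E, s <> 0 /\ forall a, m a -> a *: s = 0.
Proof.
move=> mm; have [mI n1 hm] := mm; have [_ [e [he _]]] := hullE.
pose P (I : submodule k^o) := exists2 c, I c & ~ m c.
have [|I [[c Ic nmc] Imin]] := ideal_min artk (P := P) (I0 := sm_full).
  by exists 1.
exists (e c); split.
  by move=> /he/(_ m mm).
move=> a ma; rewrite -linearZZ; apply/he => m0 mm0.
have [m' Em'] := ideal_of (let: And3 x _ _ := mm0 in x).
have mm' : maximal m'.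
  rewrite /maximal; have -> : smem m' = m0 by apply: funext => x; apply/propext.
  exact: mm0.
apply/Em'; have [sub|] := pselect (forall b, m' b -> m b).
  apply: idealMr; have [_ _ h'] := mm'; apply: h' ma => //.
move=> /existsNP[b /not_implyP[mb nmb]].
apply: idealM; suff H : mulI m' I c by apply: (H m') => u v mu _; apply: idealMr.
apply: Imin (Ic) => [|x]; last exact: mulI_sub.
exists (b * c : k); first exact: (@mulI_in _ m' I b c mb Ic).
have [d md] := maximal_inv mm nmb.
move=> mbc; apply: nmc.
have -> : c = (1 - d * b) * c + d * (b * c) :> k by ring.
by apply: smemD; [apply: idealMr|apply: idealM].
Qed.

(** By essentiality both elements come from k/rad(k), where the part killed by m is at most
    one-dimensional over k/m. *)
Lemma socle_dim1 (m : submodule k^o) (s t : E) : maximal m -> s <> 0 ->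
  (forall a, m a -> a *: s = 0) -> (forall a, m a -> a *: t = 0) ->
  exists a, t = a *: s.
Proof.
move=> mm s0 ms mt; have [_ [e [he ess]]] := hullE.
have img u : u <> 0 -> (forall a, m a -> a *: u = 0) -> exists c, u = e c.
  move=> u0 mu; have [a [c [ac au0]]] := ess _ u0.
  have [|b mb] := @maximal_inv _ m a mm; first by move/mu.
  exists (b * c); have := linearZZ e b c; rewrite -ac scalerA => ->.
  apply/subr0_eq; rewrite -[X in X - _]scale1r -scalerBl; exact: mu.
have [->|/eqP t0] := eqVneq t 0; first by exists 0; rewrite scale0r.
have [c Es] := img s s0 ms; have [d Et] := img t t0 mt.
have /existsNP[m0 /not_implyP[mm0 nc]] : ~ jacobson_rad c.
  by move=> /he; rewrite -Es.
have [m' Em'] := ideal_of (let: And3 x _ _ := mm0 in x).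
have mm' : maximal m'.
  rewrite /maximal; have -> : smem m' = m0 by apply: funext => x; apply/propext.
  exact: mm0.
have nmc' : ~ m' c by move/Em'.
have [b' mb'] := maximal_inv mm' nmc'.
have sub a : m a -> m' a.
  move=> ma; have rad : jacobson_rad (a * c).
    by apply/he; rewrite [LHS]linearZZ -Es ms.
  have -> : a = (1 - b' * c) * a + b' * (a * c) :> k by ring.
  apply: smemD; first exact: idealMr.
  by apply: idealM; apply: rad mm'.
have nmc : ~ m c by move/sub.
have [b mb] := maximal_inv mm nmc.
exists (b * d); rewrite Es -linearZZ Et; apply/subr0_eq.
rewrite -linearB.
have -> : d - (b * d) *: (c : k^o) = (1 - b * c) *: (d : k^o).
  by rewrite /GRing.scale /=; ring.
by rewrite linearZZ -Et mt.
Qed.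

(** Take m maximal above the annihilator of v modulo S and s in E nonzero and killed by m; then kill
    S, send v to s, and extend by injectivity. *)
Lemma cogenerator (V : lmodType k) (S : submodule V) v : ~ S v ->
  exists f : {linear V -> E}, (forall x, S x -> f x = 0) /\ f v <> 0.
Proof.
move=> nSv.
have A0 : S (0 *: v) by rewrite scale0r; apply: smem0.
have AD (a b : k) : S (a *: v) -> S (b *: v) -> S ((a + b) *: v).
  by move=> ? ?; rewrite scalerDl; apply: smemD.
have AZ (a b : k) : S (b *: v) -> S ((a * b) *: v).
  by move=> ?; rewrite -scalerA; apply: smemZ.
have [|m [mm hm]] := @exists_maximal _ (@Submodule _ k^o _ A0 AD AZ).
  by rewrite /= scale1r.
have [s [s0 ms]] := maximal_socle mm.
pose G (z : V * E) := exists a, S (z.1 - a *: v) /\ z.2 = a *: s.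
have G0 : G 0 by exists 0; rewrite /= !scale0r subr0; split=> //; apply: smem0.
have GD x y : G x -> G y -> G (x + y).
  move=> [a [Sa ea]] [b [Sb eb]]; exists (a + b); rewrite /= ea eb !scalerDl.
  by rewrite opprD addrACA; split=> //; apply: smemD.
have GZ c x : G x -> G (c *: x).
  move=> [a [Sa ea]]; exists (c * a); rewrite /= ea -!scalerA -scalerBr.
  by split=> //; apply: smemZ.
have [|f hf] := injective_extend (let: conj x _ := hullE in x) (G := Submodule G0 GD GZ).
  move=> y [a [/=]]; rewrite sub0r => /smemN; rewrite opprK => Sa ->.
  exact/ms/hm.
exists f; split=> [x Sx|].
  by rewrite (hf x 0) //; exists 0; rewrite /= !scale0r subr0.
rewrite (hf v s) //.
by exists 1; rewrite /= !scale1r subrr; split=> //; apply: smem0.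
Qed.

(** Induction on the colength of I, for the elements of E killed by I. If c works for J = I + kx,
    then [phi] - c depends only on xy, which lies in a socle of dimension at most one, so [phi] - c
    is bx for some b. *)
Lemma hull_endo (phi : {linear E -> E}) : exists c, forall x, phi x = c *: x.
Proof.
suff: forall phi : {linear E -> E}, exists c : k, forall x,
    (forall a, (@sm_zero _ k^o) a -> a *: x = 0) -> phi x = c *: x.
  move=> /(_ phi)[c hc]; exists c => x; apply: hc => a ->; exact: scale0r.
elim: (artinian_colength artk) => [I I1|I J m x mm mI nIx hJ _ IH] {}phi.
  by exists 0 => x /(_ 1 I1); rewrite !scale1r => ->; rewrite linear0 scaler0.
have [c hc] := IH phi; pose psi y := phi y - c *: y.
have psiD y z : psi (y + z) = psi y + psi z.
  by rewrite /psi linearD scalerDr opprD addrACA.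
have psiZ a y : psi (a *: y) = a *: psi y.
  by rewrite /psi linearZZ scalerBr !scalerA (mulrC c).
have psi0 y : (forall a, I a -> a *: y = 0) -> x *: y = 0 -> psi y = 0.
  move=> Iy xy; apply/eqP; rewrite subr_eq0; apply/eqP/hc => a /hJ[b Ib].
  by rewrite -(subrK (b * x) a) scalerDl Iy // -scalerA xy scaler0 addr0.
have [h|] := pselect (forall y : E, (forall a, I a -> a *: y = 0) -> x *: y = 0).
  exists c => y Iy; apply/subr0_eq/psi0 => //; exact: h.
move=> /existsNP[y0 /not_implyP[Iy0 xy0]].
have kill y a : (forall a, I a -> a *: y = 0) -> m a -> a *: (x *: y) = 0.
  by move=> Iy ma; rewrite scalerA; apply/Iy/mI.
have [||b Eb] := @socle_dim1 m (x *: y0) (psi y0) mm xy0.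
- by move=> a; apply: kill.
- move=> a ma; rewrite -psiZ; apply: psi0.
    by move=> d Id; rewrite scalerA mulrC -scalerA Iy0 // scaler0.
  by rewrite scalerA mulrC -scalerA kill.
exists (c + b * x) => y Iy; apply/subr0_eq.
rewrite scalerDl opprD addrA -/(psi y); apply/eqP; rewrite subr_eq0; apply/eqP.
have [||d Ed] := @socle_dim1 m (x *: y0) (x *: y) mm xy0.
- by move=> a; apply: kill.
- by move=> a; apply: kill.
have /eqP : psi (y - d *: y0) = 0.
  apply: psi0 => [a Ia|].
    by rewrite scalerBr Iy // scalerA mulrC -scalerA Iy0 // scaler0 subrr.
  by rewrite scalerBr Ed !scalerA (mulrC d) subrr.
rewrite psiD -scaleN1r psiZ scaleN1r subr_eq0 => /eqP ->.
by rewrite psiZ Eb -scalerA Ed !scalerA; congr (_ *: y0); ring.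
Qed.

(** Restriction to n generators embeds the dual of V into E^n; F extends to E^n by injectivity, and
    its components are scalars by [hull_endo]. Linearity of F is expressed pointwise, without a
    module structure on the dual. *)
Lemma reflexive (V : lmodType k) (F : {linear V -> E} -> E) : fin_gen V ->
  (forall c (f g h : {linear V -> E}),
     (forall x, h x = c *: f x + g x) -> F h = c *: F f + F g) ->
  exists v, forall f, F f = f v.
Proof.
move=> [n [s hs]] FL.
pose G (z : {ffun 'I_n -> E} * E) :=
  exists f : {linear V -> E}, (forall i, z.1 i = f (s i)) /\ z.2 = F f.
have [zl hzl] := mk_linear (g := fun _ : V => 0 : E)
  (fun a x y => esym (etrans (addr0 _) (scaler0 _ a))).
have Fzl : F zl = 0.
  have := FL (-1) zl zl zl; rewrite scaleN1r addNr; apply=> x.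
  by rewrite !hzl scaler0 addr0.
have lin c (f g : {linear V -> E}) :
    exists h : {linear V -> E}, forall x, h x = c *: f x + g x.
  apply: mk_linear => a x y; rewrite !linearP /= !scalerA.
  by rewrite [c * a]mulrC addrACA.
have G0 : G 0 by exists zl; split=> [i|]; rewrite /= ?ffunE ?hzl ?Fzl.
have GD x y : G x -> G y -> G (x + y).
  move=> [f [f1 f2]] [g [g1 g2]]; have [h hh] := lin 1 f g; exists h.
  split=> [i|]; first by rewrite ffunE f1 g1 hh scale1r.
  by rewrite /= f2 g2 (FL _ _ _ _ hh) scale1r.
have GZ c x : G x -> G (c *: x).
  move=> [f [f1 f2]]; have [h hh] := lin c f zl; exists h.
  split=> [i|]; first by rewrite ffunE f1 hh hzl addr0.
  by rewrite /= f2 (FL _ _ _ _ hh) Fzl addr0.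
have [|h hh] := injective_extend (let: conj x _ := hullE in x) (G := Submodule G0 GD GZ).
  move=> y [f [/= f1 ->]]; rewrite -Fzl.
  have := FL 1 f zl zl; rewrite Fzl addr0 scale1r => <- // x.
  rewrite scale1r hzl addr0; have [c ->] := hs x.
  by rewrite linear_sum big1 // => i _; rewrite linearZZ -f1 ffunE scaler0.
have [c hc] : {c : 'I_n -> k & forall i (x : E),
    h [ffun j => if j == i then x else 0] = c i *: x}.
  apply: (@choice _ _ (fun i c => forall x : E,
    h [ffun j => if j == i then x else 0] = c *: x)) => i.
  have lg : linear (fun x : E => h [ffun j => if j == i then x else 0]).
    move=> a x y; rewrite -linearP; congr (h _); apply/ffunP => j.
    by rewrite !ffunE; case: ifP => //; rewrite scaler0 addr0.
  have [p hp] := mk_linear lg.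
  by have [c hc] := hull_endo p; exists c => x; rewrite -hp hc.
exists (\sum_i c i *: s i) => f.
rewrite -(hh [ffun i => f (s i)] (F f)); last by exists f; split=> //= i; rewrite ffunE.
have -> : [ffun i => f (s i)] =
    \sum_i [ffun j => if j == i then f (s i) else 0].
  apply/ffunP => j; rewrite sum_ffunE ffunE (bigD1 j) //= ffunE eqxx.
  by rewrite big1 ?addr0 // => i ne; rewrite ffunE eq_sym (negPf ne).
by rewrite !linear_sum; apply: eq_bigr => i _; rewrite hc linearZZ.
Qed.

End Dual.

(** * Modules over an artin algebra *)

Lemma fin_gen_inj (k : comNzRingType) (artk : artinian k) (U V : lmodType k)
  (f : {linear U -> V}) : injective f -> fin_gen V -> fin_gen U.
Proof.
move=> injf /(submodule_fg artk (sm_im f)) [s [sI hs]].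
have [y|g hg] := choice (P := fun y x => y \in s -> y = f x).
  by have [/sI[x ->]|n] := pselect (y \in s); [exists x|exists 0].
apply/fin_genP; exists (map g s) => x S hS.
pose T y := exists2 x, S x & y = f x.
have T0 : T 0 by exists 0; [exact: smem0|rewrite raddf0].
have TD u v : T u -> T v -> T (u + v).
  by move=> [u' Su ->] [v' Sv ->]; exists (u' + v'); [exact: smemD|rewrite raddfD].
have TZ a u : T u -> T (a *: u).
  by move=> [u' Su ->]; exists (a *: u'); [exact: smemZ|rewrite linearZZ].
have [||z Sz /injf -> //] := hs (Submodule T0 TD TZ) _ (f x).
  by move=> y ys; exists (g y); [apply: hS; apply: map_f|exact: hg].
by exists x.
Qed.

Lemma fin_gen_ffun (k : comNzRingType) (V : lmodType k) n :
  fin_gen V -> fin_gen {ffun 'I_n -> V}.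
Proof.
move=> /fin_genP[s hs]; apply/fin_genP.
pose one (i : 'I_n) (v : V) : {ffun 'I_n -> V} := [ffun j => if j == i then v else 0].
exists [seq one i v | i <- enum 'I_n, v <- s] => w S hS.
have -> : w = \sum_i one i (w i).
  apply/ffunP => j; rewrite sum_ffunE (bigD1 j) //= ffunE eqxx.
  by rewrite big1 ?addr0 // => i ne; rewrite ffunE eq_sym (negPf ne).
apply: mem_sum => i.
have lo : linear (one i).
  move=> a x y; apply/ffunP => j; rewrite !ffunE; case: ifP => //.
  by rewrite scaler0 addr0.
have [p hp] := mk_linear lo; rewrite -hp.
have := hs (w i) (sm_preim p S); apply=> v vs /=; rewrite hp.
by apply: hS; apply/allpairsP; exists (i, v); rewrite mem_enum.
Qed.

Section Restriction.
Variables (k : comNzRingType) (R : algType k).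

Section RestrictedModule.
Variable M : lmodType R.

(** An alias, so that M can carry a k-module structure beside its R-module structure. *)
Definition restr : Type := M.
HB.instance Definition _ := GRing.Zmodule.on restr.
Definition rscale (c : k) (x : restr) : restr := (c%:A : R) *: (x : M).

Lemma rscaleA a b x : rscale a (rscale b x) = rscale (a * b) x.
Proof. by rewrite /rscale scalerA mulr_algl scalerA. Qed.
Lemma rscale1 : left_id 1 rscale.
Proof. by move=> x; rewrite /rscale !scale1r. Qed.
Lemma rscaleDr : right_distributive rscale +%R.
Proof. by move=> a x y; rewrite /rscale scalerDr. Qed.
Lemma rscaleDl x : {morph rscale^~ x : a b / a + b}.
Proof. by move=> a b; rewrite /rscale !scalerDl. Qed.

HB.instance Definition _ := GRing.Zmodule_isLmodule.Build k restr
  rscaleA rscale1 rscaleDr rscaleDl.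

End RestrictedModule.

Section HomModule.
Variables M N : lmodType R.

(** An alias of the type of R-linear maps that carries the k-module structure of Hom, with scalars
    acting as in [chscale]. *)
Definition rHom : Type := {linear M -> N}.
Definition rfun (f : rHom) : {linear M -> N} := f.
Coercion rfun : rHom >-> GRing.Linear.type.

HB.instance Definition _ := gen_eqMixin rHom.
HB.instance Definition _ := gen_choiceMixin rHom.

Lemma rHomP (f g : rHom) : (forall x, f x = g x) -> f = g.
Proof. exact: linear_ext. Qed.

Definition rH0 : rHom := [the {linear M -> N} of \0].
Definition rHD (f g : rHom) : rHom := [the {linear M -> N} of f \+ g].
Definition rHN (f : rHom) : rHom := [the {linear M -> N} of \- f].
Definition rHZ (c : k) (f : rHom) : rHom :=
  [the {linear M -> N} of @central_scale k R N c \o f].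

Lemma rHA : associative rHD.
Proof. by move=> f g h; apply: rHomP => x /=; rewrite addrA. Qed.
Lemma rHC : commutative rHD.
Proof. by move=> f g; apply: rHomP => x /=; rewrite addrC. Qed.
Lemma rH0l : left_id rH0 rHD.
Proof. by move=> f; apply: rHomP => x /=; rewrite add0r. Qed.
Lemma rHNl : left_inverse rH0 rHN rHD.
Proof. by move=> f; apply: rHomP => x /=; rewrite addNr. Qed.
HB.instance Definition _ := GRing.isZmodule.Build rHom rHA rHC rH0l rHNl.

Lemma rHZA a b (f : rHom) : rHZ a (rHZ b f) = rHZ (a * b) f.
Proof.
by apply: rHomP => x /=; rewrite /central_scale scalerA mulr_algl scalerA.
Qed.
Lemma rHZ1 : left_id 1 rHZ.
Proof. by move=> f; apply: rHomP => x /=; rewrite /central_scale !scale1r. Qed.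
Lemma rHZDr : right_distributive rHZ +%R.
Proof. by move=> a f g; apply: rHomP => x /=; rewrite /central_scale scalerDr. Qed.
Lemma rHZDl f : {morph rHZ^~ f : a b / a + b}.
Proof. by move=> a b; apply: rHomP => x /=; rewrite /central_scale !scalerDl. Qed.
HB.instance Definition _ := GRing.Zmodule_isLmodule.Build k rHom
  rHZA rHZ1 rHZDr rHZDl.

Lemma rHomDE (f g : rHom) x : (f + g) x = f x + g x. Proof. by []. Qed.
Lemma rHomZE c (f : rHom) x : (c *: f) x = (c%:A : R) *: f x. Proof. by []. Qed.

End HomModule.

Definition rid (M : lmodType R) : rHom M M := [the {linear M -> M} of idfun].
Definition rcomp (M N P : lmodType R) (g : rHom N P) (f : rHom M N) : rHom M P :=
  [the {linear M -> P} of g \o f].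

Lemma rcompE M N P (g : rHom N P) (f : rHom M N) x : rcomp g f x = g (f x).
Proof. by []. Qed.

Lemma rcomp_linearl M N P (f : rHom M N) : linear (fun g : rHom N P => rcomp g f).
Proof. by move=> a g g'; apply: rHomP. Qed.

Lemma rcomp_linearr M N P (g : rHom N P) : linear (fun f : rHom M N => rcomp g f).
Proof.
move=> a f f'; apply: rHomP => x; rewrite rHomDE rHomZE !rcompE rHomDE rHomZE.
by rewrite linearP.
Qed.

Section EndRing.
Variable M : lmodType R.
Definition endo : Type := rHom M M.
HB.instance Definition _ := GRing.Lmodule.on endo.
Definition emul (f g : endo) : endo := rcomp f g.
Lemma emulA : associative emul. Proof. by move=> f g h; apply: rHomP. Qed.
Lemma emul1l : left_id (rid M : endo) emul. Proof. by move=> f; apply: rHomP. Qed.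
Lemma emul1r : right_id (rid M : endo) emul. Proof. by move=> f; apply: rHomP. Qed.
Lemma emulDl : left_distributive emul +%R.
Proof. by move=> f g h; apply: rHomP. Qed.
Lemma emulDr : right_distributive emul +%R.
Proof. by move=> f g h; apply: rHomP => x; rewrite /= raddfD. Qed.
HB.instance Definition _ := GRing.Zmodule_isPzRing.Build endo
  emulA emul1l emul1r emulDl emulDr.
End EndRing.

Hypothesis artR : artin_algebra R.

Let artk : artinian k. Proof. by case: artR. Qed.

Lemma restr_fg (M : lmodType R) : fin_gen M -> fin_gen (restr M).
Proof.
move=> /fin_genP[s hs]; have [_ _ _ /fin_genP[t ht]] := artR.
apply/fin_genP; exists [seq (r *: (x : M) : restr M) | r <- t, x <- s] => z S hS.
have S' r x : x \in s -> S (r *: (x : M)).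
  move=> xs; have := ht r.
  have P0 : S ((0 : R) *: (x : M)) by rewrite scale0r; apply: smem0.
  have PD (u v : R) : S (u *: (x : M)) -> S (v *: (x : M)) -> S ((u + v) *: (x : M)).
    by move=> ? ?; rewrite scalerDl; apply: smemD.
  have PZ (c : k) (u : R) : S (u *: (x : M)) -> S ((c *: u) *: (x : M)).
    by move=> ?; rewrite -mulr_algl -scalerA; apply: (@smemZ _ _ S c).
  apply: (span_sub (S := Submodule P0 PD PZ)) => u ut; apply: hS.
  by apply/allpairsP; exists (u, x).
pose Q (z : M) := forall r : R, S (r *: z).
have Q0 : Q 0 by move=> r; rewrite scaler0; apply: smem0.
have QD u v : Q u -> Q v -> Q (u + v).
  by move=> hu hv r; rewrite scalerDr; apply: (@smemD _ _ S).
have QZ a u : Q u -> Q (a *: u) by move=> hu r; rewrite scalerA.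
rewrite -[z]scale1r.
by apply: (hs z (Submodule Q0 QD QZ)) => x xs r; apply: S'.
Qed.

Lemma sub_fg (M : fgmod R) (N : submodule M) : fin_gen (sub_type N).
Proof.
apply/fg_subP.
have [s [sN hs]] := submodule_fg artk (@Submodule _ (restr M) N
  (smem0 N) (@smemD _ _ N) (fun c => @smemZ _ _ N c%:A)) (restr_fg (fgmodP M)).
exists s; split=> // S hS.
exact: (hs (@Submodule _ (restr M) S (smem0 S) (@smemD _ _ S)
  (fun c => @smemZ _ _ S c%:A))).
Qed.

Definition subfg (M : fgmod R) (N : submodule M) : fgmod R := FgMod (sub_fg N).

Lemma rHom_fg (M N : fgmod R) : fin_gen (rHom M N).
Proof.
have [n [s hs]] := fgmodP M.
have lf : linear (fun f : rHom M N => [ffun i => f (s i)] : {ffun 'I_n -> restr N}).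
  by move=> a f g; apply/ffunP => i; rewrite !ffunE.
have [p hp] := mk_linear lf.
apply: (fin_gen_inj artk (f := p)); last exact/fin_gen_ffun/restr_fg/fgmodP.
move=> f g; rewrite !hp => /ffunP e; apply: rHomP => x; have [c ->] := hs x.
by rewrite !linear_sum; apply: eq_bigr => i _; rewrite !linearZZ; have := e i;
  rewrite !ffunE => ->.
Qed.

(** The image of e is written as the kernel of 1 - e, so that both summands are kernels. *)
Lemma split_idem (M : fgmod R) (e : endo M) : e * e = e ->
  mod_iso M (modprod (subfg (sm_ker (1 - e : endo M))) (subfg (sm_ker e))).
Proof.
move=> ee.
have eK x : e (e x) = e x by have := congr1 (fun f : endo M => f x) ee.
have h1 x : (1 - e : endo M) (e x) = 0.
  by rewrite [LHS]/= eK subrr.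
have h2 x : e ((1 - e : endo M) x) = 0.
  by rewrite [LHS]/= linearB /= eK subrr.
have [f hf] := into_sub (f := e) (S := sm_ker (1 - e : endo M)) h1.
have [g hg] := into_sub (f := (1 - e : endo M)) (S := sm_ker e) h2.
have [p hp] := mk_linear (g := fun x => (f x, g x) :
  modprod (subfg (sm_ker (1 - e : endo M))) (subfg (sm_ker e)))
  (fun a x y => f_equal2 pair (linearP f a x y) (linearP g a x y)).
exists p; exists (fun z => sub_val z.1 + sub_val z.2) => [x|[y z]].
  by rewrite hp /= hf hg /= addrC subrK.
have ey : e (sub_val y) = sub_val y.
  by have /= /subr0_eq -> := sub_mem y.
have ez : e (sub_val z) = 0 by have := sub_mem z.
rewrite hp; congr pair; apply: sub_inj; rewrite ?hf ?hg /=.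
  by rewrite linearD /= ey ez addr0.
by rewrite linearD /= ey ez addr0 addrAC subrr add0r.
Qed.

(** Fitting's argument: a high power of a yields an idempotent e, and indecomposability makes e = 0,
    with a nilpotent, or e = 1, with a invertible. *)
Lemma endo_local (M : fgmod R) (a : endo M) : indecomposable M ->
  (exists b : endo M, b * a = 1) \/ (exists b : endo M, b * (1 - a) = 1).
Proof.
move=> [_ indM].
(* The double commutant of a. Working with the chain a^t Bic guarantees that the q with a^(n+1) =
   a^(2n+2) q commutes with a, which makes e = a^(n+1) q idempotent. *)
pose Bic (q : endo M) := forall z : endo M, z * a = a * z -> q * z = z * q.
pose N0 t (x : endo M) := exists2 q, Bic q & x = a ^+ t * q.
have NS t : exists S : submodule (endo M), forall x, S x <-> N0 t x.
  have S0 : N0 t 0 by exists 0; rewrite ?mulr0 // => z _; rewrite mul0r mulr0.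
  have SD u v : N0 t u -> N0 t v -> N0 t (u + v).
    move=> [q hq ->] [r hr ->]; exists (q + r); last by rewrite mulrDr.
    by move=> z hz; rewrite mulrDl mulrDr hq // hr.
  have SZ c u : N0 t u -> N0 t (c *: u).
    move=> [q hq ->]; exists (c *: q).
      move=> z hz; apply: rHomP => x; have := congr1 (fun f : endo M => f x) (hq z hz).
      by move=> /= E; rewrite /central_scale /= in E *; rewrite E linearZZ.
    apply: rHomP => x /=; rewrite /central_scale.
    by rewrite [RHS]linearZZ.
  by exists (Submodule S0 SD SZ).
have [S hS] := choice NS.
have [n x /hS[q hq ->]|n hn] := submodule_dcc (N := S) artk (rHom_fg M M).
  apply/hS; exists (a * q); last by rewrite exprSr mulrA.
  by move=> z hz; rewrite -mulrA hq // !mulrA hz.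
have Ba : Bic a by move=> z ->.
have aC t : a ^+ t * a = a * a ^+ t by rewrite -exprS exprSr.
have /hS[q hq E] : S (n.+1 + n.+1)%N (a ^+ n.+1).
  apply: hn; first by rewrite addSn -addnS leq_addr.
  apply/hS; exists a; first exact: Ba.
  by rewrite exprSr.
pose e : endo M := a ^+ n.+1 * q.
have qa : q * a ^+ n.+1 = a ^+ n.+1 * q by apply: hq.
have ae : a ^+ n.+1 * e = a ^+ n.+1 by rewrite /e mulrA -exprD.
have ee : e * e = e.
  by rewrite /e -mulrA [q * (_ * q)]mulrA qa !mulrA -exprD -E.
have [h|h] := indM _ _ (split_idem ee).
  right; have e0 : e = 0.
    apply: rHomP => x; have hx : sm_ker (1 - e : endo M) (e x).
      have := congr1 (fun f : endo M => f x) ee => /= ex.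
      by rewrite ex subrr.
    by have := congr1 (@sub_val _ _ _) (h (tosub hx)).
  have an : a ^+ n.+1 = 0 by rewrite -ae e0 mulr0.
  exists (\sum_(i < n.+1) a ^+ i).
  have cm : GRing.comm (\sum_(i < n.+1) a ^+ i) (1 - a).
    apply: commrB; first exact: commr1.
    by apply/commr_sym/commr_sum => i _; apply: commrX.
  rewrite cm; have := subrX1 a n.+1; rewrite an sub0r => /(congr1 -%R).
  by rewrite opprK -mulNr opprB => <-.
left; exists (a ^+ n * q).
have e1 : e = 1.
  apply: rHomP => x; apply/subr0_eq.
  have hx : sm_ker e ((e - 1 : endo M) x).
    have ex : e (e x) = e x := congr1 (fun f : endo M => f x) ee.
    by apply: etrans (linearB e (e x) x) _; rewrite ex subrr.
  by have := congr1 (@sub_val _ _ _) (h (tosub hx)).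
by rewrite -mulrA hq // mulrA -exprSr.
Qed.

End Restriction.

(** * Morphisms and cones in the homotopy category *)

(** Conditions on complexes produce data in the degrees i + 1; this turns them into data in all
    degrees and hides the cast. *)
Lemma int_reindex (P : int -> Type) (p : forall i, P (i + 1)) :
  exists u : forall j, P j, forall i, u (i + 1) = p i.
Proof.
exists (fun j => eq_rect (j - 1 + 1) P (p (j - 1)) j (subrK 1 j)) => i.
have : forall m (e : m + 1 = i + 1), eq_rect (m + 1) P (p m) (i + 1) e = p i.
  move=> m e; have E := addIr 1 e; case: _ / E e => e.
  by rewrite (eq_irrelevance e erefl).
exact.
Qed.

Lemma int_succ_ind (Q : int -> Prop) : (forall i, Q (i + 1)) -> forall j, Q j.
Proof. by move=> h j; rewrite -(subrK 1 j); apply: h. Qed.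

Lemma dep_choice (I : Type) (T : I -> Type) (P : forall i, T i -> Prop) :
  (forall i, exists x, P i x) -> exists f : forall i, T i, forall i, P i (f i).
Proof.
move=> h; exists (fun i => projT1 (cid (h i))) => i.
exact: (projT2 (cid (h i))).
Qed.

Lemma mk_linears (A : pzRingType) (I : Type) (U V : I -> lmodType A)
    (f : forall i, U i -> V i) : (forall i, linear (f i)) ->
  exists h : forall i, {linear U i -> V i}, forall i x, h i x = f i x.
Proof.
move=> lf; exact: (dep_choice (T := fun i => {linear U i -> V i})
  (P := fun i h => forall x, h x = f i x) (fun i => mk_linear (lf i))).
Qed.

Local Notation "g ∘ f" := (hcomp g f) (at level 40, left associativity).

Section Homotopy.
Variables (k : comNzRingType) (R : algType k).
Implicit Types X Y Z W : cpx R.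

Lemma hrep X Y (f : KHom X Y) : exists f0, f = hclass f0.
Proof. by exists (hrepr f); rewrite hreprK. Qed.

Lemma hclass_eq0 X Y (f : chmap X Y) : hclass f = 0 <-> null_homotopic f.
Proof.
have -> : (0 : KHom X Y) = hclass 0.
  by apply: (@addrI _ (hclass 0)); rewrite -hclassD !addr0.
by rewrite hclassE subr0.
Qed.

Lemma hclass0 X Y : hclass (0 : chmap X Y) = 0.
Proof. by apply: (@addrI _ (hclass 0)); rewrite -hclassD !addr0. Qed.

Lemma hclassN X Y (f : chmap X Y) : hclass (- f) = - hclass f.
Proof. by apply: (@addrI _ (hclass f)); rewrite -hclassD !subrr hclass0. Qed.

Lemma hclass_zero X Y (f : chmap X Y) : (forall i x, f i x = 0) -> hclass f = 0.
Proof. by move=> h; rewrite -hclass0; congr hclass; apply: chmapP => i x; rewrite h. Qed.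

Lemma hclassZE X Y c (f : chmap X Y) : hclass (c *: f) = c *: hclass f.
Proof. exact: hclassZ. Qed.

Lemma hcompDl X Y Z (g g' : KHom Y Z) (f : KHom X Y) :
  (g + g') ∘ f = g ∘ f + g' ∘ f.
Proof.
have [f0 ->] := hrep f; have [g0 ->] := hrep g; have [h0 ->] := hrep g'.
by rewrite -hclassD !hcomp_class -hclassD; congr hclass; apply: chmapP.
Qed.

Lemma hcompDr X Y Z (g : KHom Y Z) (f f' : KHom X Y) :
  g ∘ (f + f') = g ∘ f + g ∘ f'.
Proof.
have [f0 ->] := hrep f; have [g0 ->] := hrep g; have [h0 ->] := hrep f'.
rewrite -hclassD !hcomp_class -hclassD; congr hclass; apply: chmapP => i x /=.
by rewrite linearD.
Qed.

Lemma hcompZl X Y Z c (g : KHom Y Z) (f : KHom X Y) : (c *: g) ∘ f = c *: (g ∘ f).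
Proof.
have [f0 ->] := hrep f; have [g0 ->] := hrep g.
by rewrite -hclassZE !hcomp_class -hclassZE; congr hclass; apply: chmapP.
Qed.

Lemma hcompZr X Y Z c (g : KHom Y Z) (f : KHom X Y) : g ∘ (c *: f) = c *: (g ∘ f).
Proof.
have [f0 ->] := hrep f; have [g0 ->] := hrep g.
rewrite -hclassZE !hcomp_class -hclassZE; congr hclass; apply: chmapP => i x /=.
by rewrite /central_scale linearZZ.
Qed.

Lemma hcomp0l X Y Z (f : KHom X Y) : (0 : KHom Y Z) ∘ f = 0.
Proof. by apply: (@addrI _ ((0 : KHom Y Z) ∘ f)); rewrite -hcompDl !addr0. Qed.

Lemma hcomp0r X Y Z (g : KHom Y Z) : g ∘ (0 : KHom X Y) = 0.
Proof. by apply: (@addrI _ (g ∘ (0 : KHom X Y))); rewrite -hcompDr !addr0. Qed.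

Lemma hcompNl X Y Z (g : KHom Y Z) (f : KHom X Y) : (- g) ∘ f = - (g ∘ f).
Proof. by apply: (@addrI _ (g ∘ f)); rewrite -hcompDl !subrr hcomp0l. Qed.

Lemma hcompNr X Y Z (g : KHom Y Z) (f : KHom X Y) : g ∘ (- f) = - (g ∘ f).
Proof. by apply: (@addrI _ (g ∘ f)); rewrite -hcompDr !subrr hcomp0r. Qed.

Lemma hcompBl X Y Z (g g' : KHom Y Z) (f : KHom X Y) :
  (g - g') ∘ f = g ∘ f - g' ∘ f.
Proof. by rewrite hcompDl hcompNl. Qed.

Lemma hcompBr X Y Z (g : KHom Y Z) (f f' : KHom X Y) :
  g ∘ (f - f') = g ∘ f - g ∘ f'.
Proof. by rewrite hcompDr hcompNr. Qed.

Lemma iso_id X : is_iso (hid X).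
Proof. by exists (hid X); rewrite hcomp1l. Qed.

Lemma iso_comp X Y Z (g : KHom Y Z) (f : KHom X Y) :
  is_iso g -> is_iso f -> is_iso (g ∘ f).
Proof.
move=> [g' [g1 g2]] [f' [f1 f2]]; exists (f' ∘ g'); split.
  by rewrite -hcompA (hcompA g') g1 hcomp1l f1.
by rewrite -hcompA (hcompA f) f2 hcomp1l g2.
Qed.

Lemma iso_cancel X Y Z (g : KHom Y Z) (f f' : KHom X Y) :
  is_iso g -> g ∘ f = g ∘ f' -> f = f'.
Proof.
by move=> [h [h1 _]] e; rewrite -[f]hcomp1l -[f']hcomp1l -h1 -!hcompA e.
Qed.

Lemma iso_cancelr X Y Z (g g' : KHom Y Z) (f : KHom X Y) :
  is_iso f -> g ∘ f = g' ∘ f -> g = g'.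
Proof.
by move=> [h [_ h1]] e; rewrite -[g]hcomp1r -[g']hcomp1r -h1 !hcompA e.
Qed.

Lemma hshift_id X : hshift (hid X) = hid (cshift X).
Proof. by rewrite /hid hshift_class; congr hclass; apply: chmapP. Qed.

Lemma hshift_comp X Y Z (g : KHom Y Z) (f : KHom X Y) :
  hshift (g ∘ f) = hshift g ∘ hshift f.
Proof.
have [f0 ->] := hrep f; have [g0 ->] := hrep g.
by rewrite hcomp_class !hshift_class hcomp_class; congr hclass; apply: chmapP.
Qed.

Lemma iso_shift X Y (f : KHom X Y) : is_iso f -> is_iso (hshift f).
Proof.
by move=> [g [gf fg]]; exists (hshift g); rewrite -!hshift_comp gf fg !hshift_id.
Qed.

Lemma mk_chmap X Y (f : forall i, {linear X (i + 1) -> Y (i + 1)}) :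
  (forall i (x : X (i + 1)), f (i + 1) (d_[X, i + 1] x) = d_[Y, i + 1] (f i x)) ->
  exists g : chmap X Y, forall i x, g (i + 1) x = f i x.
Proof.
move=> hf; have [u hu] := int_reindex (P := fun i => {linear X i -> Y i}) f.
have hd : forall i (x : X i), u (i + 1) (d_[X, i] x) = d_[Y, i] (u i x).
  by apply: int_succ_ind => i x; rewrite !hu hf.
by exists (Chmap hd) => i x /=; rewrite hu.
Qed.

Lemma hshift_inj X Y (f : KHom X Y) : hshift f = 0 -> f = 0.
Proof.
have [f0 ->] := hrep f; rewrite hshift_class => /hclass_eq0[h hh].
apply/hclass_eq0; have [s hs] := int_reindex (P := fun i => {linear X (i + 1) -> Y i})
  (fun i => [the {linear X (i + 1 + 1) -> Y (i + 1)} of \- h i]).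
exists s; apply: int_succ_ind => i x; rewrite !hs /=.
by have := hh i x => /= ->; rewrite !linearN.
Qed.

Lemma hshift_surj X Y (f : KHom (cshift X) (cshift Y)) : exists g, f = hshift g.
Proof.
have [f0 ->] := hrep f.
have [i x|g hg] := mk_chmap (X := X) (Y := Y) (f := fun i => f0 i).
  by have := chfunD f0 x; rewrite /= linearN => /(congr1 -%R); rewrite !opprK.
by exists (hclass g); rewrite hshift_class; congr hclass; apply: chmapP => i x;
  rewrite /= hg.
Qed.

(** * Exactness of Hom on the triangle of a cone *)

Section Cone.
Variables (X Y : cpx R) (f : chmap X Y).

Lemma cone_in_comp : hclass (cone_in f) ∘ hclass f = 0.
Proof.
rewrite hcomp_class; apply/hclass_eq0.
pose H i (x : X (i + 1)) : cone f i := (x, 0).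
have lH i : linear (H i) by move=> a x y; congr pair; rewrite /= scaler0 addr0.
have [h hh] := mk_linears lH.
exists (fun i => h i) => i x; rewrite !hh /= /cone_diff /cone_in_fun /=.
by congr pair; rewrite /= ?addNr // linear0 !addr0.
Qed.

Lemma cone_extend Z (g : KHom Y Z) : g ∘ hclass f = 0 ->
  exists g' : KHom (cone f) Z, g' ∘ hclass (cone_in f) = g.
Proof.
have [g0 ->] := hrep g; rewrite hcomp_class => /hclass_eq0[h hh].
pose G i (z : cone f i) := g0 i z.2 + h i z.1.
have lG i : linear (G i).
  by move=> a [x y] [x' y']; rewrite /G /= !linearP scalerDr addrACA.
have [u hu] := mk_linears lG.
have hd i (z : cone f i) : u (i + 1) (d_[cone f, i] z) = d_[Z, i] (u i z).
  rewrite !hu /G /= linearD linearD linearN /=.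
  by have /= -> := hh i z.1; rewrite chfunD addrAC addrK addrC.
exists (hclass (Chmap hd)); rewrite hcomp_class; congr hclass.
by apply: chmapP => i y; rewrite /= hu /G /= linear0 addr0.
Qed.

Lemma cone_factor_out Z (g : KHom (cone f) Z) : g ∘ hclass (cone_in f) = 0 ->
  exists g' : KHom (cshift X) Z, g = g' ∘ hclass (cone_out f).
Proof.
have [g0 ->] := hrep g; rewrite hcomp_class => /hclass_eq0[h hh].
pose G i (x : cshift X i) := g0 i (x, 0) - h i (f (i + 1) x).
have lG i : linear (G i).
  move=> a x y; rewrite /G linearP /= linearP /= scalerBr.
  have -> : (a *: x + y, 0) = a *: (x, 0) + (y, 0) :> cone f i.
    by congr pair; rewrite /= scaler0 addr0.
  by rewrite linearP opprD addrACA.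
have [u hu] := mk_linears lG.
have hd i (z : cshift X i) : u (i + 1) (d_[cshift X, i] z) = d_[Z, i] (u i z).
  rewrite !hu /G linearB /= -(chfunD g0 ((z, 0) : cone f i)) /= /cone_diff /= linear0 addr0.
  have -> : (- d_[X, i + 1] z, f (i + 1) z) =
     (- d_[X, i + 1] z, 0) + (0, f (i + 1) z) :> cone f (i + 1).
    by congr pair; rewrite /= ?addr0 ?add0r.
  have := hh i (f (i + 1) z); rewrite /= /cone_in_fun => E.
  rewrite [in RHS]linearD [X in _ = _ + X - _]E.
  by rewrite !linearN /= opprK chfunD addrA addrAC addrK.
exists (hclass (Chmap hd)); rewrite hcomp_class; apply/hclassE.
pose H i (z : cone f (i + 1)) := h i z.2.
have lH i : linear (H i).
  by move=> a [x y] [x' y']; rewrite /H /= linearP.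
have [v hv] := mk_linears lH.
exists (fun i => v i) => i [x y]; rewrite !hv /H /= hu /G /=.
have -> : (x, y) = (x, 0) + (0, y) :> cone f (i + 1).
  by congr pair; rewrite /= ?addr0 ?add0r.
rewrite [g0 _ (_ + _)]linearD opprB addrCA [g0 _ _ + _]addrC addrK.
have := hh i y; rewrite /= /cone_in_fun => ->.
by rewrite linearD addrCA addrA addrC addrA.
Qed.

Lemma cone_lift Z (g : KHom Z Y) : hclass (cone_in f) ∘ g = 0 ->
  exists g' : KHom Z X, hclass f ∘ g' = g.
Proof.
have [g0 ->] := hrep g; rewrite hcomp_class => /hclass_eq0[h hh].
have lp i : linear (fun z : Z (i + 1) => (h i z).1).
  by move=> a x y; rewrite linearP.
have lq i : linear (fun z : Z (i + 1) => (h i z).2).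
  by move=> a x y; rewrite linearP.
(* A null homotopy into the cone has two components: the one in X is the lift sought, and minus the
   one in Y is the homotopy comparing it with g. *)
have [p hp] := mk_linears lp.
have [q hq] := mk_linears lq.
have E i z := congr1 fst (hh i z); have E' i z := congr1 snd (hh i z).
have [i x|u hu] := mk_chmap (X := Z) (Y := X) (f := fun i => p i).
  by rewrite !hp; have := E i x => /= /esym/addr0_eq <-; rewrite opprK.
exists (hclass u); rewrite hcomp_class; apply/hclassE.
exists (fun i => [the {linear Z (i + 1) -> Y i} of \- q i]) => i z /=.
have := E' i z => /= ->; rewrite hu hp !hq linearN /=.
by rewrite !opprD !addrA subrr add0r.
Qed.

Lemma cone_factor_in Z (g : KHom Z (cone f)) : hclass (cone_out f) ∘ g = 0 ->
  exists g' : KHom Z Y, g = hclass (cone_in f) ∘ g'.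
Proof.
have [g0 ->] := hrep g; rewrite hcomp_class => /hclass_eq0[h hh].
have lu i : linear (fun z : Z (i + 1) => (g0 (i + 1) z).2 - f (i + 1) (h i z)).
  by move=> a x y; rewrite !linearP /= addrACA -scalerDr.
have [p hp] := mk_linears lu.
have [i x|u hu] := mk_chmap (X := Z) (Y := Y) (f := fun i => p i).
  rewrite !hp linearB /= -chfunD; have := congr1 snd (chfunD g0 x) => /= ->.
  have := hh i x => /= ->; rewrite linearD linearN /=.
  have aux (V : zmodType) (a b c : V) : - a + b + c - b = c - a.
    by rewrite addrAC addrK addrC.
  exact: aux.
exists (hclass u); rewrite hcomp_class; apply/hclassE.
have lH i : linear (fun z : Z (i + 1) => (h i z, 0) : cone f i).
  by move=> a x y; congr pair; rewrite /= ?linearP // scaler0 addr0.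
have [v hv] := mk_linears lH.
exists (fun i => v i) => i x; rewrite !hv /= /cone_diff /cone_in_fun /= hu hp.
have := hh i x => /= E; congr pair; rewrite /= ?subr0 ?E // linear0 !addr0.
by rewrite subKr.
Qed.

Lemma cone_shift_out : hshift (hclass f) ∘ hclass (cone_out f) = 0.
Proof.
rewrite hshift_class hcomp_class; apply/hclass_eq0.
exists (fun i => [the {linear modprod (X (i + 1 + 1)) (Y (i + 1)) -> Y (i + 1)} of snd]).
by move=> i [x y] /=; rewrite addrCA addNr addr0.
Qed.

Lemma cone_lift_out Z (g : KHom Z (cshift X)) : hshift (hclass f) ∘ g = 0 ->
  exists g' : KHom Z (cone f), hclass (cone_out f) ∘ g' = g.
Proof.
have [g0 ->] := hrep g; rewrite hshift_class hcomp_class => /hclass_eq0[h hh].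
have lu i : linear (fun z : Z (i + 1) => (g0 (i + 1) z, h i z) : cone f (i + 1)).
  by move=> a x y; congr pair; rewrite /= linearP.
have [p hp] := mk_linears lu.
have [i x|u hu] := mk_chmap (X := Z) (Y := cone f) (f := p).
  rewrite !hp /= /cone_diff /=; congr pair; first by rewrite chfunD.
  by have := hh i x => /= ->; rewrite [RHS]addrAC addNr add0r.
exists (hclass u); rewrite hcomp_class; congr hclass; apply: chmapP.
by apply: int_succ_ind => i x; rewrite /= hu hp.
Qed.

End Cone.
End Homotopy.

(** * Shifts, stalks and subcomplexes *)

Lemma bijective_of (A B : Type) (f : A -> B) :
  injective f -> (forall y, exists x, f x = y) -> bijective f.
Proof.
move=> injf /choice[g hg]; exists g => // x.
by apply: injf; rewrite hg.
Qed.

Lemma bijective_inv (A B : Type) (f : A -> B) y : bijective f -> exists x, f x = y.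
Proof. by case=> g _ gK; exists (g y). Qed.

Section Basics.
Variables (k : comNzRingType) (R : algType k).
Implicit Types (X Y Z W V : cpx R) (M N : fgmod R).

Definition conc (n : int) X : Prop := forall i, n < i -> zero_module (X i).

Lemma conc_le n m X : n <= m -> conc n X -> conc m X.
Proof. by move=> nm h i mi; apply: h; apply: le_lt_trans mi. Qed.

Lemma conc_shift n X : conc (n + 1) X -> conc n (cshift X).
Proof. by move=> h i ni; apply: h; rewrite ltrD2r. Qed.

(* The inverse of the shift is only available up to casts, since i - 1 + 1 and
   i are not convertible. *)
Section Unshift.
Variable X : cpx R.

Definition ccast i j (e : i = j) : {linear X i -> X j} :=
  match e with erefl => [the {linear X i -> X i} of idfun] end.

Lemma ccast_id i (e : i = i) x : ccast e x = x.
Proof. by rewrite (eq_irrelevance e erefl). Qed.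

Lemma ccast_comp i j l (e : i = j) (e' : j = l) (e'' : i = l) x :
  ccast e' (ccast e x) = ccast e'' x.
Proof. by case: _ / e' e''; case: _ / e => e''; rewrite !ccast_id. Qed.

Lemma ccastD i j (e : i = j) (e' : i + 1 = j + 1) x :
  d_[X, j] (ccast e x) = ccast e' (d_[X, i] x).
Proof. by case: _ / e e' => e'; rewrite !ccast_id. Qed.

Lemma unshift_eq (i : int) : i - 1 + 1 = i + 1 - 1.
Proof. by rewrite addrAC. Qed.

Program Definition unshift : cpx R :=
  @Cpx R (fun i => X (i - 1))
    (fun i => [the {linear X (i - 1) -> X (i + 1 - 1)}
      of \- (ccast (unshift_eq i) \o d_[X, i - 1])]) _ _.
Next Obligation.
move=> i x /=; rewrite !linearN /= opprK.
have e : i - 1 + 1 + 1 = i + 1 - 1 + 1 by rewrite unshift_eq.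
by rewrite (ccastD _ e) cdiffK !linear0.
Qed.
Next Obligation.
have [n hn] := cbounded X; exists (n + 1) => i hi; apply: hn.
by rewrite ltrBrDr.
Qed.

Lemma unshift_iso : exists s : KHom (cshift unshift) X, is_iso s.
Proof.
have e1 (i : int) : i + 1 - 1 = i by rewrite addrK.
have e2 (i : int) : i = i + 1 - 1 by rewrite addrK.
have h1 i (x : cshift unshift i) :
  ccast (e1 (i + 1)) (d_[cshift unshift, i] x) = d_[X, i] (ccast (e1 i) x).
  rewrite /= opprK.
  have e' : i + 1 - 1 + 1 = i + 1 by rewrite addrK.
  by rewrite (ccastD _ e') (ccast_comp _ _ e').
have h2 i (x : X i) :
  ccast (e2 (i + 1)) (d_[X, i] x) = d_[cshift unshift, i] (ccast (e2 i) x).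
  rewrite /= opprK.
  have e' : i + 1 = i + 1 - 1 + 1 by rewrite addrK.
  by rewrite (ccastD _ e') (ccast_comp _ _ (e2 (i + 1))).
pose u := @Chmap R (cshift unshift) X (fun i => ccast (e1 i)) h1.
pose v := @Chmap R X (cshift unshift) (fun i => ccast (e2 i)) h2.
exists (hclass u), (hclass v); rewrite !hcomp_class; split;
  by congr hclass; apply: chmapP => i x /=; rewrite (ccast_comp _ _ erefl).
Qed.

Lemma conc_unshift n : conc n X -> conc (n + 1) unshift.
Proof. by move=> h i ni; apply: h; rewrite ltrBrDr. Qed.

Lemma Kminus_unshift C : Kminus C X -> Kminus C unshift.
Proof. by move=> h i; apply: h. Qed.

End Unshift.

Lemma stalk_low M (i : int) : i != 0 -> zero_module (stalk M i).
Proof. by case: i => [[|n]|n] //= _ x; apply/matrixP => ? []. Qed.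

Section Stalks.
Variables (M : fgmod R).

(** The match follows that of [stalk_term], so that the source reduces in every branch. *)
Definition smap_fun Y (v : {linear M -> Y 0}) i : {linear stalk_term M i -> Y i} :=
  match i return {linear stalk_term M i -> Y i} with
  | Posz 0 => v
  | Posz j.+1 => [the {linear mod0 R -> Y j.+1} of \0]
  | Negz j => [the {linear mod0 R -> Y (Negz j)} of \0]
  end.

Definition smap Y (v : {linear M -> Y 0}) (dv : forall x, d_[Y, 0] (v x) = 0) :
  chmap (stalk M) Y.
Proof.
exists (smap_fun v) => i x.
have -> : d_[stalk M, i] x = 0 by [].
by rewrite linear0; case: i x => [[|n]|n] x; rewrite /= ?dv ?linear0.
Defined.

Lemma smap0 Y (v : {linear M -> Y 0}) dv x : smap (v := v) dv 0 x = v x.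
Proof. by []. Qed.

Lemma chmap_stalkP Y (f g : chmap (stalk M) Y) : (forall x, f 0 x = g 0 x) -> f = g.
Proof.
move=> e; apply: chmapP => i; have [->|ne x] := eqVneq i 0; first exact: e.
by rewrite (stalk_low ne x) !linear0.
Qed.

Lemma stalk_null Y (f : chmap (stalk M) Y) :
  hclass f = 0 <-> exists w : {linear M -> Y (-1)}, forall x, f 0 x = d_[Y, -1] (w x).
Proof.
rewrite hclass_eq0; split=> [[h hh]|[w hw]].
  exists (h (-1)) => x; have := hh (-1) x => ->.
  by rewrite [d_[stalk M, _] x](_ : _ = 0) // linear0 addr0.
(* Indexing by the source degree j allows a definition by cases; the target degree is cast
   afterwards. *)
have [h hh] : exists h : forall j, {linear stalk_term M j -> Y (j - 1)},
    forall x, h 0 x = w x.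
  exists (fun j => match j return {linear stalk_term M j -> Y (j - 1)} with
    | Posz 0 => w
    | Posz j.+1 => [the {linear mod0 R -> _} of \0]
    | Negz j => [the {linear mod0 R -> _} of \0] end).
  by [].
have e (i : int) : i + 1 - 1 = i by rewrite addrK.
exists (fun i => [the {linear stalk_term M (i + 1) -> Y i} of
  ccast Y (e i) \o h (i + 1)]) => i x.
rewrite [d_[stalk M, _] x](_ : _ = 0) // linear0 addr0 /=.
have [E|ne] := eqVneq i (-1).
  by subst i; rewrite hw; congr (d_[Y, -1] _); rewrite ccast_id hh.
have z0 : zero_module (stalk M (i + 1)).
  have : i + 1 != 0 by rewrite addr_eq0.
  by case: (i + 1) => [[|n]|n] //= _ y; apply/matrixP => ? [].
by rewrite (z0 x) !linear0.
Qed.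

End Stalks.

Lemma conc_stalk M : conc 0 (stalk M).
Proof. by case=> [[|n]|n] //= _ x; apply/matrixP => ? []. Qed.

Lemma Kminus_stalk C M : additive_sub C -> C M -> Kminus C (stalk M).
Proof. by move=> [C0 _] CM [[|n]|n]. Qed.

Section StalkHom.
Variables M N : fgmod R.

Definition sHom (u : rHom M N) : KHom (stalk M) (stalk N) :=
  hclass (@smap M (stalk N) (rfun u) (fun _ => erefl)).

Lemma sHom_linear : linear sHom.
Proof.
move=> c u v; rewrite /sHom -hclassZE -hclassD; congr hclass.
exact: chmap_stalkP.
Qed.

Lemma sHom_inj : injective sHom.
Proof.
move=> u v /hclassE/hclass_eq0/stalk_null[w hw]; apply: rHomP => x.
by apply/subr0_eq; exact: (hw x).
Qed.

Lemma sHom_surj f : exists u, f = sHom u.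
Proof.
have [f0 ->] := hrep f; exists (f0 0 : rHom M N); congr hclass.
exact: chmap_stalkP.
Qed.

End StalkHom.

Lemma sHom_comp M N (P : fgmod R) (v : rHom N P) (u : rHom M N) :
  sHom v ∘ sHom u = sHom (rcomp v u).
Proof. by rewrite hcomp_class; congr hclass; apply: chmap_stalkP. Qed.

Lemma sHom_id M : sHom (rid M : rHom M M) = hid (stalk M).
Proof. by congr hclass; apply: chmap_stalkP. Qed.

Lemma hom_disjoint X Y (f : KHom X Y) :
  (forall i, zero_module (X i) \/ zero_module (Y i)) -> f = 0.
Proof.
move=> h; have [f0 ->] := hrep f; apply: hclass_zero => i x.
by have [z|z] := h i; [rewrite (z x) linear0|rewrite (z (f0 i x))].
Qed.

End Basics.

Section Subcomplexes.
Variables (k : comNzRingType) (R : algType k) (artR : artin_algebra R).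
Implicit Types (X Y Z W V : cpx R) (M N : fgmod R).

Section Subcomplex.
Variables (X : cpx R) (S : forall i, submodule (X i)).
Hypothesis SD : forall i x, S i x -> S (i + 1) (d_[X, i] x).

(** The subcomplex is returned through its properties, so that later proofs lift maps into it
    without unfolding the subtypes. *)
Lemma subcpx_exists : exists (X' : cpx R) (j : chmap X' X),
  [/\ forall i, X' i = subfg artR (S i),
      forall i, injective (j i),
      forall i y, S i (j i y),
      forall (V : lmodType R) i (f : {linear V -> X i}), (forall x, S i (f x)) ->
        exists g : {linear V -> X' i}, forall x, j i (g x) = f x &
      forall i x, S i x -> exists y, x = j i y].
Proof.
have hd i : exists d : {linear subfg artR (S i) -> subfg artR (S (i + 1))},
    forall x, sub_val (d x) = d_[X, i] (sub_val x).
  have [] := @into_sub _ (sub_type (S i)) (X (i + 1))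
    [the {linear _ -> _} of d_[X, i] \o @sub_val _ _ (S i)] (S (i + 1)).
    by move=> x; apply: SD; apply: sub_mem.
  by move=> d hd; exists d.
have [d dE] := dep_choice hd.
have dd i x : d (i + 1) (d i x) = 0.
  by apply: sub_inj; rewrite !dE cdiffK.
have bd : exists n : int, forall i, n < i -> zero_module (subfg artR (S i)).
  have [n hn] := cbounded X; exists n => i /hn z x.
  by apply: sub_inj; rewrite (z (sub_val x)).
pose X' := @Cpx R (fun i => subfg artR (S i)) d dd bd.
have jd i (x : X' i) : sub_val (d_[X', i] x) = d_[X, i] (sub_val x) by apply: dE.
exists X', (@Chmap R X' X (fun i =>
  [the {linear sub_type (S i) -> X i} of @sub_val _ _ (S i)]) jd).
split=> //.
- by move=> i x y /sub_inj.
- by move=> i y; apply: sub_mem.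
- by move=> V i f hf; have [g hg] := into_sub hf; exists g.
- by move=> i x Sx; exists (tosub Sx).
Qed.

End Subcomplex.

Lemma lift_chmap V X X' (j : chmap X' X) (f : chmap V X) :
  (forall i, injective (j i)) ->
  (forall i, exists g : {linear V i -> X' i}, forall x, j i (g x) = f i x) ->
  exists g : chmap V X', f = chcomp j g.
Proof.
move=> injj /dep_choice[g hg].
have hd i x : g (i + 1) (d_[V, i] x) = d_[X', i] (g i x).
  by apply: injj; rewrite hg !chfunD hg.
by exists (Chmap hd); apply: chmapP => i x /=; rewrite hg.
Qed.

(** T has the cocycles of Y in degree n and 0 above. Injectivity reaches one degree further than
    bijectivity: a null homotopy on a complex in degrees at most n + 1 already takes cocycle values
    in degree n. *)
Lemma truncation n Y : exists (T : cpx R) (j : KHom T Y),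
  [/\ conc n T, forall V, conc (n + 1) V -> forall f : KHom V T, j ∘ f = 0 -> f = 0 &
    forall V, conc n V -> bijective (fun f : KHom V T => j ∘ f)].
Proof.
pose P i (y : Y i) := (i = n -> d_[Y, i] y = 0) /\ (n < i -> y = 0).
have P0 i : P i 0 by split=> // _; rewrite linear0.
have PD i x y : P i x -> P i y -> P i (x + y).
  move=> [h1 h2] [h3 h4]; split=> e; first by rewrite linearD /= h1 // h3 // addr0.
  by rewrite h2 // h4 // addr0.
have PZ i a x : P i x -> P i (a *: x).
  by move=> [h1 h2]; split=> e; rewrite ?linearZZ ?h1 ?h2 ?scaler0.
have [|T [j [TE injj jS lif sur]]] :=
  @subcpx_exists Y (fun i => Submodule (P0 i) (@PD i) (@PZ i)).
  move=> i x /= [h1 h2]; split=> [_|]; first exact: cdiffK.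
  rewrite ltzD1 le_eqVlt => /predU1P[/esym/h1//|/h2 ->]; exact: linear0.
have cT : conc n T.
  by move=> i ni y; apply: injj; rewrite linear0; have [_ ->] := jS i y.
have inj V : conc (n + 1) V -> forall f : KHom V T, hclass j ∘ f = 0 -> f = 0.
  move=> cV f; have [u ->] := hrep f; rewrite hcomp_class => /hclass_eq0[h hh].
  apply/hclass_eq0.
  have lift i : exists h' : {linear V (i + 1) -> T i}, forall x, j i (h' x) = h i x.
    apply: lif => x; split=> [E|ni].
      subst i; have := hh n x => /=.
      have -> : u (n + 1) x = 0 by apply: cT; rewrite ltrDl.
      have -> : d_[V, n + 1] x = 0 by apply: (cV (n + 1 + 1)); rewrite ltrDl.
      by rewrite !linear0 addr0 => <-.
    have -> : x = 0 by apply: (cV (i + 1)); rewrite ltrD2r.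
    by rewrite linear0.
  have [h' hh'] := dep_choice lift; exists h' => i x; apply: injj.
  by have := hh i x; rewrite /= => ->; rewrite linearD chfunD !hh'.
exists T, (hclass j); split=> // V cV; apply: bijective_of => [f g /= e|f].
  apply/subr0_eq/inj; last by rewrite hcompBr e subrr.
  by apply: conc_le cV; rewrite lerDl.
have [f0 ->] := hrep f.
have [i|g hg] := lift_chmap (f := f0) injj.
  apply: lif => x; split=> [E|ni].
    subst i; rewrite -chfunD; have z : d_[V, n] x = 0.
      by apply: (cV (n + 1)); rewrite ltrDl.
    by rewrite z linear0.
  by rewrite (cV i ni x) linear0.
by exists (hclass g); rewrite hcomp_class -hg.
Qed.

(** The image of e is a direct summand in each degree, hence stays in C, and e inverts its inclusion
    up to homotopy. The last clause serves to cut off degrees. *)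
Lemma split_idempotent C X (e : chmap X X) : karoubi_closed C -> Kminus C X ->
  (forall i x, e i (e i x) = e i x) -> hclass e = hid X ->
  exists X' (f : KHom X' X), [/\ Kminus C X', is_iso f &
    forall i, (forall x, e i x = 0) -> zero_module (X' i)].
Proof.
move=> karC CX ee eid.
pose E i : endo (X i) := e i.
have EE i : E i * E i = E i by apply: rHomP => x; apply: ee.
have [|T [j [TE injj jS lif sur]]] :=
  @subcpx_exists X (fun i => sm_ker (rfun (1 - E i : endo (X i)))).
  by move=> i x /= /subr0_eq h; apply/eqP; rewrite subr_eq0 /E chfunD -h.
exists T, (hclass j).
have Ej i y : e i (j i y) = j i y by have /= /subr0_eq := jS i y.
have [i|p hp] := lift_chmap (f := e) injj.
  by apply: lif => x /=; rewrite /E ee subrr.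
split.
- move=> i; rewrite TE; exact: karC (split_idem artR (EE i)) (CX i).
- exists (hclass p); rewrite !hcomp_class -hp eid; split=> //.
  congr hclass; apply: chmapP => i y /=; apply: injj.
  have := congr1 (fun g : chmap X X => g i (j i y)) hp => /= <-.
  exact: Ej.
- by move=> i e0 y; apply: injj; rewrite linear0 -Ej e0.
Qed.

End Subcomplexes.

(** * Truncations *)

(** Recursion from the top degree t downwards, with a default above t, where the complexes
    vanish. *)
Lemma int_rec_down (T : int -> Type) (t : int) (a0 : forall i, T i)
    (step : forall i, T (i + 1) -> T i) :
  exists a : forall i, T i, (forall i, t < i -> a i = a0 i) /\
    forall i, i <= t -> a i = step i (a (i + 1)).
Proof.
(* n is fuel: from i at most t exactly |t - i| + 1 steps are made, the last one reading [a0] in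
   degree t + 1. *)
pose F := fix F n i : T i := match n with
  | 0%N => a0 i
  | n'.+1 => if i <= t then step i (F n' (i + 1)) else a0 i end.
exists (fun i => F (absz (t - i)).+1 i); split=> i; first by rewrite ltNge /= => /negPf ->.
move=> it; rewrite {1}/F it -/F; congr (step i _).
move: it; rewrite le_eqVlt => /predU1P[->|lt].
  by rewrite subrr /= gerDl.
by have -> : absz (t - (i : int))%R = (absz (t - ((i : int) + 1))%R).+1 by lia.
Qed.

Lemma int_down_ind (Q : int -> Prop) (t : int) :
  (forall i, t < i -> Q i) -> (forall i, Q (i + 1) -> Q i) -> forall i, Q i.
Proof.
move=> h0 hS i; have [/h0//|le] := ltP t i.
have E : i = t + 1 - (absz (t + 1 - i)%R)%:Z by lia.
rewrite E; elim: (absz _) => [|n IH]; first by rewrite subr0; apply: h0; rewrite ltrDl.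
by apply: hS; have -> : t + 1 - n.+1%:Z + 1 = t + 1 - n%:Z by lia.
Qed.

Section Truncated.
Variables (k : comNzRingType) (R : algType k) (artR : artin_algebra R).
Variable C : fgmod R -> Prop.
Hypotheses (additiveC : additive_sub C) (karoubiC : karoubi_closed C).
Implicit Types (X Y Z W V : cpx R) (M N : fgmod R).

(** Vanishing of the cohomology of Hom(N, X) in degree i + 1 for all N in C. *)
Definition acyc X (i : int) : Prop := forall N, C N ->
  forall u : {linear N -> X (i + 1)}, (forall x, d_[X, i + 1] (u x) = 0) ->
  exists w : {linear N -> X i}, forall x, u x = d_[X, i] (w x).

(* Above degree n, X is contracted by a homotopy h built from the top down;
   then 1 - dh - hd is an idempotent chain map. *)
Lemma acyc_conc n X : Kminus C X -> (forall i, n <= i -> acyc X i) ->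
  exists X' (f : KHom X' X), [/\ Kminus C X', is_iso f & conc n X'].
Proof.
move=> CX ac; have [t ht] := cbounded X.
pose T i := {linear X (i + 1) -> X i}.
pose B i (h : T i) (h' : T (i + 1)) :=
  forall x, d_[X, i] (h x) = x - h' (d_[X, i + 1] x).
pose z i : T i := [the {linear X (i + 1) -> X i} of \0].
(* The recursion must be total, so a solution of B is chosen only if there is one; solvability is
   proved afterwards by downward induction. *)
have stepP i (h' : T (i + 1)) : exists h : T i,
    (n <= i -> (exists h1, B i h1 h') -> B i h h') /\ (i < n -> h = z i).
  have [lt|ge] := ltP i n; first by exists (z i).
  have [[h1 hh1]|nh] := pselect (exists h1, B i h1 h'); first by exists h1.
  by exists (z i).
pose step i h' := projT1 (cid (stepP i h')).
have [h [hz hS]] := @int_rec_down T t z step.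
have hB i : n <= i -> B i (h i) (h (i + 1)).
  move: i; apply: (@int_down_ind _ t) => [i ti _ x|i IH ni].
    have x0 : x = 0 by apply: ht; rewrite (lt_trans ti) // ltrDl.
    by rewrite x0 !linear0 addr0.
  have [ti|it] := ltP t i.
    move=> x; have x0 : x = 0 by apply: ht; rewrite (lt_trans ti) // ltrDl.
    by rewrite x0 !linear0 addr0.
  have ni1 : n <= i + 1 by rewrite (le_trans ni) // lerDl.
  have hx : exists h1, B i h1 (h (i + 1)).
    (* Acyclicity is tested on the term X^(i+1), which is in C: 1 - hd maps it into cocycles. *)
    have [|w hw] := ac i ni (X (i + 1)) (CX _)
      [the {linear X (i + 1) -> X (i + 1)} of idfun \- (h (i + 1) \o d_[X, i + 1])].
      move=> x /=; rewrite linearB /= (IH ni1) cdiffK linear0 subr0.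
      by rewrite subrr.
    by exists w => x; rewrite -hw.
  rewrite hS //; case: (projT2 (cid (stepP i (h (i + 1))))) => + _; exact.
have h0 i : i < n -> h i = z i.
  move=> lt; have [ti|it] := ltP t i; first by rewrite hz.
  by rewrite hS //; case: (projT2 (cid (stepP i (h (i + 1))))) => _; apply.
(* As h vanishes below degree n, 1 - dh - hd is the identity below n, 1 - hd in degree n, and 0
   above. *)
pose e i : {linear X i -> X i} := if i < n then [the {linear X i -> X i} of idfun]
  else if i == n then [the {linear X i -> X i} of idfun \- (h i \o d_[X, i])]
  else [the {linear X i -> X i} of \0].
have elo i x : i < n -> e i x = x by rewrite /e => ->.
have ehi i x : n < i -> e i x = 0.
  by move=> ni; rewrite /e ltNge ltW //= gt_eqF.
have emid x : e n x = x - h n (d_[X, n] x) by rewrite /e ltxx eqxx.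
have ed i x : e (i + 1) (d_[X, i] x) = d_[X, i] (e i x).
  have [lt|gt|E] := ltgtP i n.
  - rewrite [in RHS]elo //; have : i + 1 <= n by rewrite lezD1.
    rewrite le_eqVlt => /predU1P[E|lt']; last by rewrite elo.
    by subst n; rewrite emid cdiffK linear0 subr0.
  - rewrite !ehi ?linear0 //; apply: lt_trans gt _; exact: ltrDl.
  - subst i; rewrite emid ehi; last by rewrite ltrDl.
    by rewrite linearB /= hB // cdiffK linear0 subr0 subrr.
have ee i x : e i (e i x) = e i x.
  have [lt|gt|E] := ltgtP i n; first by rewrite !elo.
    by rewrite !ehi.
  subst i; rewrite !emid linearB /= hB // cdiffK linear0 subr0 subrr linear0.
  by rewrite subr0.
have [|X' [f [CX' isof zX']]] := @split_idempotent _ _ artR C X (Chmap ed) karoubiC CX ee.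
  apply/hclassE; exists (fun i => [the {linear X (i + 1) -> X i} of \- h i]) => i x /=.
  have [lt|ge] := ltP i n; last first.
    rewrite ehi; last by rewrite ltzD1.
    by rewrite linearN /= hB // opprB [RHS]addrAC subrr.
  rewrite (h0 i lt) /= oppr0 linear0 add0r.
  have : i + 1 <= n by rewrite lezD1.
  rewrite le_eqVlt => /predU1P[E|lt']; last by rewrite elo // h0 //= oppr0 subrr.
  by subst n; rewrite emid addrAC subrr sub0r.
exists X', f; split=> // i ni; apply: zX' => x; exact: ehi.
Qed.

Lemma acyc_shift Z i : acyc (cshift Z) i -> acyc Z (i + 1).
Proof.
move=> ac N CN u du; have [x|w hw] := ac N CN u; first by rewrite /= du oppr0.
by exists [the {linear N -> Z (i + 1)} of \- w] => x; rewrite hw /= linearN.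
Qed.

Lemma acyc_of_hom Z : (forall N, C N -> forall f : KHom (stalk N) (cshift Z), f = 0) ->
  acyc Z 0.
Proof.
move=> h N CN u du.
have dv x : d_[cshift Z, 0] ((u : {linear N -> cshift Z 0}) x) = 0.
  by rewrite /= du oppr0.
have /stalk_null[w hw] := h N CN (hclass (smap (Y := cshift Z) dv)).
exists ([the {linear N -> Z (-1 + 1)} of \- w] : {linear N -> Z 0}) => x.
have := hw x; rewrite smap0 => ->.
by rewrite [RHS](linearN d_[Z, 0]).
Qed.

Lemma acyc_nat X (n : nat) : acyc (iter n (@cshift R) X) 0 -> acyc X n.
Proof.
elim: n X => [//|n IH] X; rewrite iterSr => /IH/acyc_shift.
by have -> : n%:Z + 1 = n.+1%:Z by lia.
Qed.

(** The universal property of an approximation without the quasi-isomorphism; unlike the latter it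
    is all that the arguments on hearts use. *)
Definition clocal X Z (q : KHom X Z) : Prop :=
  forall Y, Kminus C Y -> bijective (fun f : KHom Y X => q ∘ f).

Lemma clocal_inj X Z (q : KHom X Z) Y (f : KHom Y X) :
  clocal q -> Kminus C Y -> q ∘ f = 0 -> f = 0.
Proof. by move=> /(_ Y)/[apply] /bij_inj injq e; apply: injq; rewrite hcomp0r. Qed.

Lemma clocal_lift X Z (q : KHom X Z) Y (f : KHom Y Z) :
  clocal q -> Kminus C Y -> exists g, q ∘ g = f.
Proof. by move=> /(_ Y)/[apply]; apply: bijective_inv. Qed.

Lemma clocal_shift X Z (q : KHom X Z) : clocal q -> clocal (hshift q).
Proof.
move=> cq Y CY; have [s [s' [s1 s2]]] := unshift_iso Y.
have CU := Kminus_unshift CY; apply: bijective_of => [f f' /= e|f].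
  apply/subr0_eq; set g := f - f'; have {e} e : hshift q ∘ g = 0.
    by rewrite hcompBr e subrr.
  have [g0 E] := hshift_surj (g ∘ s).
  have g00 : g0 = 0.
    apply: (clocal_inj cq) => //; apply: hshift_inj.
    by rewrite hshift_comp -E hcompA e hcomp0l.
  rewrite -[g]hcomp1r -s2 hcompA E g00.
  have -> : hshift (0 : KHom (unshift Y) X) = 0.
    by rewrite -hclass0 hshift_class; apply: hclass_zero.
  exact: hcomp0l.
have [g E] := hshift_surj (f ∘ s); have [g' Eg] := clocal_lift g cq CU.
by exists (hshift g' ∘ s'); rewrite hcompA -hshift_comp Eg -E -hcompA s2 hcomp1r.
Qed.

Lemma Kminus_shift X : Kminus C X -> Kminus C (cshift X).
Proof. by move=> h i; apply: h. Qed.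

Lemma Kminus_cone X Y (f : chmap X Y) : Kminus C X -> Kminus C Y -> Kminus C (cone f).
Proof. by case: additiveC => _ h CX CY i; apply: h. Qed.

(** For N in C and n > 0, Hom(P_N, X[n]) agrees with Hom(P_N, X1[n]) = 0, so X is acyclic in
    positive degrees as seen from C and can be truncated by [acyc_conc]. *)
Lemma clocal_le0 X X0 X1 (q : KHom X X0) (a : KHom X0 X1) : Kminus C X ->
  clocal q -> is_iso a -> conc 0 X1 -> Kminus_le0 C X.
Proof.
move=> CX cq [b [ba ab]] c1; split=> //.
have [n|X' [f [CX' [g [gf fg]] c']]] := @acyc_conc 0 X CX.
  case: n => // n _; apply/acyc_nat/acyc_of_hom => N CN f; rewrite -iterS in f *.
  have : forall m, exists (q' : KHom (iter m (@cshift R) X) (iter m (@cshift R) X0))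
      (a' : KHom (iter m (@cshift R) X0) (iter m (@cshift R) X1)), clocal q' /\ is_iso a'.
    elim=> [|m [q' [a' [h1 h2]]]]; first by exists q, a; split=> //; exists b.
    by exists (hshift q'), (hshift a'); split; [exact: clocal_shift|exact: iso_shift].
  move=> /(_ n.+1)[q' [a' [h1 h2]]].
  apply: (clocal_inj h1); first exact: Kminus_stalk.
  apply: (iso_cancel h2); rewrite hcomp0r; apply: hom_disjoint => i.
  have cn : conc (- n.+1%:Z) (iter n.+1 (@cshift R) X1).
    elim: n.+1 => [|m IH]; first by rewrite oppr0.
    rewrite iterS; apply: conc_shift.
    by have -> : - m.+1%:Z + 1 = - m%:Z by lia.
  have [->|i0] := eqVneq i 0; first by right; apply: cn; rewrite oppr_lt0.
  by left; apply: stalk_low.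
by exists X', g; split=> //; exists f.
Qed.

Lemma le0_shift X : Kminus_le0 C X -> Kminus_le0 C (cshift X).
Proof.
move=> [CX [Y [f [CY cY isof]]]]; split; first exact: Kminus_shift.
exists (cshift Y), (hshift f); split; [exact: Kminus_shift| |exact: iso_shift].
apply: (@conc_le _ _ (-1)) => //; exact: conc_shift.
Qed.

Lemma le0_conc X : Kminus C X -> conc 0 X -> Kminus_le0 C X.
Proof. by move=> CX cX; split=> //; exists X, (hid X); split=> //; apply: iso_id. Qed.

Lemma ge0_hom X Y (f : KHom Y X) : Kminus_ge0 C X -> Kminus C Y -> conc (-1) Y -> f = 0.
Proof.
move=> [_ h] CY cY; have [s iss] := unshift_iso Y.
apply: (iso_cancelr iss); rewrite hcomp0l; apply: h.
by apply: le0_conc; [exact: Kminus_unshift|exact: (@conc_unshift _ _ Y (-1))].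
Qed.

Lemma ge0_of X : Kminus C X ->
  (forall Y, Kminus C Y -> conc (-1) Y -> forall f : KHom Y X, f = 0) -> Kminus_ge0 C X.
Proof.
move=> CX h; split=> // Y [CY [Y' [a [CY' cY' [b [ba ab]]]]]] f.
rewrite -[f]hcomp1r -hshift_id -ba hshift_comp hcompA.
rewrite (h _ _ _ (f ∘ hshift b)) ?hcomp0l //; first exact: Kminus_shift.
exact: conc_shift.
Qed.

Lemma clocal_ge0 X X0 (q : KHom X X0) : Kminus C X -> clocal q ->
  Kminus_ge0 (@whole R) X0 -> Kminus_ge0 C X.
Proof.
move=> CX cq [_ g0]; split=> // Y [CY [Y' [a [_ cY' isa]]]] f.
apply: (clocal_inj cq); first exact: Kminus_shift.
by apply: g0; split=> //; exists Y', a.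
Qed.

Lemma stalk_heart M : C M -> heart C (stalk M).
Proof.
move=> CM; have CS := Kminus_stalk additiveC CM.
split; first by apply: le0_conc => //; apply: conc_stalk.
apply: ge0_of => // Y _ cY f; apply: hom_disjoint => i.
have [->|i0] := eqVneq i 0; first by left; apply: cY.
by right; apply: stalk_low.
Qed.

Lemma heart_Kminus X : heart C X -> Kminus C X.
Proof. by case=> -[]. Qed.

End Truncated.

(** * The heart *)

Section Whole.
Variables (k : comNzRingType) (R : algType k) (artR : artin_algebra R).
Implicit Types (X Y Z W V : cpx R) (M N : fgmod R).
Local Notation whole := (@whole R).

Lemma whole_additive : additive_sub whole. Proof. by []. Qed.

Lemma hom_stalk_low M Y (f : KHom (stalk M) Y) : zero_module (Y 0) -> f = 0.
Proof.
move=> z; apply: hom_disjoint => i.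
by have [->|i0] := eqVneq i 0; [right|left; apply: stalk_low].
Qed.

Lemma le0_whole C X : Kminus_le0 C X -> Kminus_le0 whole X.
Proof. by move=> [_ [Y [f [_ cY isf]]]]; split=> //; exists Y, f. Qed.

Lemma conc_cone n X Y (f : chmap X Y) : conc (n + 1) X -> conc n Y -> conc n (cone f).
Proof.
by move=> cX cY i ni [x y]; congr pair; [apply: cX; rewrite ltrD2r|apply: cY].
Qed.

(* The coaisle truncation of Y is the cone of the truncation in degrees <= -1. *)
Lemma coaisle_truncation Y : Kminus_le0 whole Y -> exists T (t : KHom Y T), [/\ heart whole T,
  forall Z, Kminus_ge0 whole Z -> bijective (fun g : KHom T Z => g ∘ t) &
  forall M, bijective (fun v : KHom (stalk M) Y => t ∘ v)].
Proof.
move=> [_ [Y' [f [_ cY' [f' [ff' f'f]]]]]].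
have [W [j [cW injW bijW]]] := truncation artR (-1) Y'.
have [j0 Ej] := hrep j; have isf : is_iso f by exists f'.
have cW1 : conc (-1 - 1) (cshift W) by apply: conc_shift; rewrite subrK.
have cT : conc 0 (cone j0).
  by apply: conc_cone => //; apply: conc_le cW.
have inj : hclass (cone_in j0) ∘ j = 0 by rewrite Ej cone_in_comp.
exists (cone j0), (hclass (cone_in j0) ∘ f); split.
- split; first exact: le0_conc.
  apply: ge0_of => // V _ cV g; have [s iss] := unshift_iso V.
  apply: (iso_cancelr iss); rewrite hcomp0l; set h := g ∘ s.
  have [w Ew] := hshift_surj (hclass (cone_out j0) ∘ h).
  have cU : conc 0 (unshift V) by apply: (@conc_unshift _ _ V (-1)).
  (* The complex [unshift V] reaches degree 0, one above W: the extra degree of injectivity in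
     [truncation] is used here. *)
  have w0 : w = 0.
    apply: (injW (unshift V)) => //; apply: hshift_inj.
    by rewrite hshift_comp -Ew hcompA Ej cone_shift_out hcomp0l.
  have /cone_factor_in[y Ey] : hclass (cone_out j0) ∘ h = 0.
    by rewrite Ew w0 -hclass0 hshift_class; apply: hclass_zero.
  have [y' Ey'] := bijective_inv y (bijW _ (@conc_shift _ _ (-1) _ cU)).
  by rewrite Ey -Ey' hcompA inj hcomp0l.
- move=> Z gZ; apply: bijective_of => [g g' /= e|g].
    apply/subr0_eq; set h := g - g'.
    have : h ∘ hclass (cone_in j0) = 0.
      by apply: (iso_cancelr isf); rewrite -hcompA hcompBl e subrr hcomp0l.
    move=> /cone_factor_out[u ->]; rewrite (ge0_hom u gZ) ?hcomp0l //.
    exact: conc_le cW1.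
  have : g ∘ f' ∘ hclass j0 = 0.
    by rewrite -Ej (ge0_hom (g ∘ f' ∘ j) gZ).
  move=> /cone_extend[g' Eg']; exists g'.
  by rewrite hcompA Eg' -hcompA ff' hcomp1r.
- move=> M; apply: bijective_of => [v v' /= e|v].
    apply/subr0_eq; set h := v - v'; apply: (iso_cancel isf); rewrite hcomp0r.
    have : hclass (cone_in j0) ∘ (f ∘ h) = 0.
      by rewrite hcompA hcompBr e subrr.
    move=> /cone_lift[w <-].
    by rewrite (hom_stalk_low w) ?hcomp0r //; apply: cW.
  have /cone_factor_in[y ->] : hclass (cone_out j0) ∘ v = 0.
    by apply: hom_stalk_low; apply: cW1.
  by exists (f' ∘ y); rewrite -hcompA (hcompA f) f'f hcomp1l.
Qed.

End Whole.

Section Heart.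
Variables (k : comNzRingType) (R : algType k) (artR : artin_algebra R).
Variable C : fgmod R -> Prop.
Hypotheses (additiveC : additive_sub C) (karoubiC : karoubi_closed C) (approxC : approximating C).
Implicit Types (X Y Z W V : cpx R) (M N : fgmod R).
Local Notation whole := (@whole R).
Local Notation HC := (heart C).

Lemma approx_exists X : exists X' (q : KHom X' X), Kminus C X' /\ clocal C q.
Proof. by have [X' [q [CX' _ h]]] := approxC X; exists X', q. Qed.

Lemma clocal_heart X X0 (q : KHom X X0) : Kminus C X -> clocal C q ->
  heart whole X0 -> HC X.
Proof.
move=> CX cq [[_ [X1 [a [_ c1 isa]]]] g0]; split; last exact: (clocal_ge0 CX cq g0).
exact: (clocal_le0 artR additiveC karoubiC CX cq isa c1).
Qed.

(** B is the approximation of the coaisle truncation of Y in mod(R); it plays the role of the zeroth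
    cohomology for the t-structure on K^-(C). *)
Lemma heart_truncation Y : Kminus_le0 C Y -> exists B (b : KHom Y B), HC B /\
  forall M, C M -> bijective (fun v : KHom (stalk M) Y => b ∘ v).
Proof.
move=> lY; have [T [t [hT _ ht]]] := coaisle_truncation artR (le0_whole lY).
have [B [q [CB cq]]] := approx_exists T.
have [b Eb] := clocal_lift t cq (let: conj x _ := lY in x).
exists B, b; split; first exact: (clocal_heart CB cq hT).
move=> M CM; have CS := Kminus_stalk additiveC CM.
apply: bijective_of => [v v' /= e|v].
  by apply: (bij_inj (ht M)); rewrite -Eb -!hcompA e.
have [v' Ev'] := bijective_inv (q ∘ v) (ht M); exists v'.
apply/subr0_eq/(clocal_inj cq) => //.
by rewrite hcompBr hcompA Eb Ev' subrr.
Qed.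

(** The heart truncation of the cone of f is its cokernel, which is 0 for an epimorphism. Hence
    Hom(P_M, cone) = 0 and every map from P_M lifts. *)
Lemma stalk_proj M : C M -> Proj HC (stalk M).
Proof.
move=> CM; split; first exact: stalk_heart.
move=> Y Z f hY hZ epf g.
have [[CY [Y' [y [CY' cY' [y' [yy' y'y]]]]]] _] := hY.
have [[CZ [Z' [z [CZ' cZ' isz]]]] _] := hZ.
have [f0 Ef] := hrep (z ∘ f ∘ y').
have cc : conc 0 (cone f0) by apply: conc_cone => //; apply: conc_le cY'.
have [B [b [hB bij]]] := heart_truncation (le0_conc (Kminus_cone additiveC f0 CY' CZ') cc).
have b0 : b = 0.
  have : b ∘ hclass (cone_in f0) = 0.
    apply: (iso_cancelr isz); rewrite hcomp0l; apply: epf => //.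
    rewrite -!hcompA; have -> : z ∘ f = hclass f0 ∘ y by rewrite -Ef -!hcompA yy' hcomp1r.
    by rewrite (hcompA _ _ y) cone_in_comp hcomp0l hcomp0r.
  move=> /cone_factor_out[b' ->]; case: hB => _ [_ h].
  by rewrite (h Y' (le0_conc CY' cY') b') hcomp0l.
have /cone_lift[h Eh] : hclass (cone_in f0) ∘ (z ∘ g) = 0.
  by apply: (bij_inj (bij M CM)); rewrite /= b0 !hcomp0l.
exists (y' ∘ h); apply: (iso_cancel isz).
by rewrite -Eh -Ef -!hcompA.
Qed.

Lemma Proj_iso (P : cpx R -> Prop) X X' (a : KHom X X') : is_iso a -> P X' ->
  Proj P X -> Proj P X'.
Proof.
move=> [b [ba ab]] PX' [PX h]; split=> // Y Z f PY PZ epf g.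
have [u Eu] := h Y Z f PY PZ epf (g ∘ a); exists (u ∘ b).
by rewrite hcompA Eu -hcompA ab hcomp1r.
Qed.

(** If X lives in degrees at most 0, the map to X from the stalk of its top term is an epimorphism.
    It splits, and the resulting idempotent of the top term splits in C. *)
Lemma proj_stalk X : Proj HC X -> exists M, C M /\ exists a : KHom X (stalk M), is_iso a.
Proof.
move=> [hX pX]; have [[CX [X' [x [CX' cX' isx]]]] _] := hX.
have [x' [xx' x'x]] := isx; have isx' : is_iso x' by exists x.
have dv y : d_[X', 0] (([the {linear _ -> _} of idfun] : {linear X' 0 -> X' 0}) y) = 0.
  by apply: cX'.
pose e0 := smap (M := X' 0) dv; pose N := X' 0.
have CN : C N := CX' 0; have CS := Kminus_stalk additiveC CN.
have Ccone := Kminus_cone additiveC e0 CS CX'.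
(* Up to isomorphism the cone of [e0] lives in degrees at most -1, so it has no maps to the heart,
   which makes [e0] an epimorphism. *)
have [i|D [d [CD isd cD]]] := @acyc_conc _ _ artR C karoubiC (-1) (cone e0) Ccone.
  rewrite le_eqVlt => /predU1P[<-|lt] P CP u du.
    have lw : linear (fun p : P => ((u p).2 : N, 0) : cone e0 (-1)).
      by move=> a p q; congr pair; rewrite /= ?linearP // scaler0 addr0.
    have [w hw] := mk_linear lw; exists w => p; rewrite hw.
    have z1 : (u p).1 = 0 by exact: (@conc_stalk _ _ N 1).
    apply: (etrans (surjective_pairing (u p))); rewrite z1; congr pair.
      exact: (esym (oppr0 _)).
    by rewrite /= linear0 addr0.
  have z : zero_module (cone e0 (i + 1)).
    apply: (@conc_cone _ _ 0); [exact: conc_le (@conc_stalk _ _ N)|exact: cX'|].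
    by rewrite -[0](@addNr int 1) ltrD2r.
  exists [the {linear P -> _} of \0] => p; rewrite (z (u p)) [RHS]linear0 //.
have epe : epi HC (x' ∘ hclass e0).
  move=> Z hZ g; rewrite hcompA => E.
  have /cone_extend : g ∘ x' ∘ hclass e0 = 0 by [].
  move=> [g' Eg']; apply: (iso_cancelr isx'); rewrite -Eg' hcomp0l.
  have g0 : g' ∘ d = 0 by have [_ gZ] := hZ; apply: (ge0_hom _ gZ CD cD).
  have -> : g' = 0 by apply: (iso_cancelr isd); rewrite g0 hcomp0l.
  exact: hcomp0l.
have hS : HC (stalk N) by apply: stalk_heart.
have [h Eh] := pX _ _ _ hS hX epe (hid X).
set p := x' ∘ hclass e0 in Eh.
have [u Eu] := sHom_surj (h ∘ p).
have uu : rcomp u u = u.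
  apply: sHom_inj; rewrite -sHom_comp -Eu.
  by rewrite -(hcompA h p) (hcompA p h p) Eh hcomp1l.
pose u1 : endo N := u; have uu1 : u1 * u1 = u1 by exact: uu.
have ux y : u (u y) = u y := congr1 (fun f : rHom N N => f y) uu.
pose S := sm_ker (rfun (1 - u1 : endo N)).
pose M : fgmod R := subfg artR S.
have [r hr] := into_sub (f := rfun u) (S := S) (fun y =>
  (etrans (f_equal (fun w => u y - w) (ux y)) (subrr _) : (1 - u1 : endo N) (u y) = 0)).
pose i : rHom M N := [the {linear sub_type S -> N} of @sub_val _ _ S].
have ir : rcomp i (r : rHom N M) = u by apply: rHomP => y; apply: hr.
have ri : rcomp (r : rHom N M) i = rid M.
  apply: rHomP => y; apply: sub_inj; rewrite /= hr.
  by have /= /subr0_eq := sub_mem y.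
exists M; split; first exact: karoubiC (split_idem artR uu1) CN.
exists (sHom (r : rHom N M) ∘ h), (p ∘ sHom i); split.
  by rewrite -hcompA (hcompA (sHom i)) sHom_comp ir -Eu -(hcompA h) Eh hcomp1r.
rewrite -hcompA (hcompA h) Eu -ir -sHom_comp !hcompA sHom_comp ri sHom_id hcomp1l.
by rewrite sHom_comp ri sHom_id.
Qed.

(** K is the approximation of the truncation of cone(f)[-1] to degrees at most 0. Monicity of i
    comes from the vanishing of Hom(W[1], Y). *)
Lemma heart_kernel X Y (f : KHom X Y) : HC X -> HC Y ->
  exists K (i : KHom K X), [/\ HC K, f ∘ i = 0, mono HC i &
    forall Z (g : KHom Z X), HC Z -> f ∘ g = 0 -> exists g', i ∘ g' = g].
Proof.
move=> hX hY; have [f0 Ef] := hrep f.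
have CX := heart_Kminus hX; have CY := heart_Kminus hY.
have [V [j [cV _ bijV]]] := truncation artR (-1) (cone f0).
have [s [s' [s1 s2]]] := unshift_iso V.
have [K [q [CK cq]]] := approx_exists (unshift V).
(* [Phi] identifies Hom(W, K) with Hom(W[1], cone f) for W in the aisle. *)
pose Phi W (g : KHom W K) := j ∘ s ∘ hshift q ∘ hshift g.
have PhiD W (g g' : KHom W K) : Phi W (g - g') = Phi W g - Phi W g'.
  rewrite /Phi -hcompBr; congr (_ ∘ _).
  have [g0 ->] := hrep g; have [h0 ->] := hrep g'.
  rewrite -hclassN -hclassD !hshift_class -hclassN -hclassD.
  by congr hclass; apply: chmapP.
have Phi_inj W (g : KHom W K) : Kminus_le0 C W -> Phi W g = 0 -> g = 0.
  move=> [CW [W' [w [CW' cW' isw]]]] e; have [w' [ww' w'w]] := isw.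
  have isw' : is_iso w' by exists w.
  apply: (iso_cancelr isw'); rewrite hcomp0l; apply: (clocal_inj cq) => //.
  apply: hshift_inj; apply: (iso_cancel (g := s)); first by exists s'.
  rewrite hcomp0r; apply: (bij_inj (bijV _ (@conc_shift _ _ (-1) _ cW'))) => /=.
  by rewrite hcomp0r !hshift_comp !hcompA -/(Phi W g) e hcomp0l.
have Phi_surj W (g : KHom (cshift W) (cone f0)) : Kminus_le0 C W ->
    exists g', Phi W g' = g.
  move=> [CW [W' [w [CW' cW' [w' [ww' w'w]]]]]].
  have [v Ev] := bijective_inv (g ∘ hshift w') (bijV _ (@conc_shift _ _ (-1) _ cW')).
  have [u Eu] := hshift_surj (s' ∘ v); have [u' Eu'] := clocal_lift u cq CW'.
  exists (u' ∘ w); rewrite /Phi hshift_comp -!hcompA (hcompA (hshift q)).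
  rewrite -hshift_comp Eu' -Eu -hcompA (hcompA s) s2 hcomp1l hcompA Ev.
  by rewrite -hcompA -hshift_comp ww' hshift_id hcomp1r.
have [i Ei] := hshift_surj (hclass (cone_out f0) ∘ (j ∘ s ∘ hshift q)).
have PhiE W (g : KHom W K) : hclass (cone_out f0) ∘ Phi W g = hshift (i ∘ g).
  by rewrite /Phi hcompA Ei hshift_comp.
have mi W (g : KHom W K) : Kminus_le0 C W -> i ∘ g = 0 -> g = 0.
  move=> lW e; apply: Phi_inj => //.
  have /cone_factor_in[y ->] : hclass (cone_out f0) ∘ Phi W g = 0.
    by rewrite PhiE e -hclass0 hshift_class; apply: hclass_zero.
  by case: hY => _ [_ h]; rewrite (h W lW y) hcomp0r.
have lK : Kminus_le0 C K.
  apply: (clocal_le0 artR additiveC karoubiC CK cq (iso_id _)).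
  by apply: (@conc_unshift _ _ V (-1)).
exists K, i; split.
- split=> //; split=> // W lW g.
  apply: mi; first exact: le0_shift.
  by case: hX => _ [_ h]; apply: h.
- by apply: hshift_inj; rewrite hshift_comp -Ei hcompA Ef cone_shift_out hcomp0l.
- by move=> W [lW _] g; apply: mi.
move=> Z g [lZ _] e.
have /cone_lift_out[h Eh] : hshift (hclass f0) ∘ hshift g = 0.
  by rewrite -hshift_comp -Ef e -hclass0 hshift_class; apply: hclass_zero.
have [g' Eg'] := Phi_surj Z h lZ; exists g'.
apply/subr0_eq/hshift_inj; have := PhiE Z g'; rewrite Eg' Eh => E.
have [u Eu] := hrep (i ∘ g'); have [v Ev] := hrep g.
rewrite Eu Ev -hclassN -hclassD hshift_class.
rewrite -(subrr (hshift g)) {1}E Eu Ev !hshift_class -hclassN -hclassD.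
by congr hclass; apply: chmapP.
Qed.

Lemma simple_mono L S (j : KHom L S) : simple_object HC L -> HC S -> j <> 0 -> mono HC j.
Proof.
move=> [hL _ sL] hS j0; have [K [i [hK ji mi lift]]] := heart_kernel j hL hS.
have [i0|[i' [_ ii']]] := sL K i hK mi; last first.
  by case: j0; rewrite -[j]hcomp1r -ii' hcompA ji hcomp0l.
by move=> Z hZ g /(lift Z g hZ)[g' <-]; rewrite i0 hcomp0l.
Qed.

End Heart.

(** * Serre duality on the heart *)

Section Serre.
Variables (k : comNzRingType) (R : algType k) (artR : artin_algebra R).
Variables (E : lmodType k) (hullE : hull_of_top E).
Variable C : fgmod R -> Prop.
Hypotheses (additiveC : additive_sub C) (karoubiC : karoubi_closed C)
  (approxC : approximating C).
Implicit Types (X Y Z W V : cpx R) (M N : fgmod R).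
Local Notation whole := (@whole R).
Local Notation HC := (heart C).

Let artk : artinian k. Proof. by case: artR. Qed.
Let injE : injective_module E. Proof. by case: hullE. Qed.

Lemma KHom_stalk_fg M N : fin_gen (KHom (stalk M) (stalk N)).
Proof.
have [n [s hs]] := rHom_fg artR M N.
have [h hh] := mk_linear (@sHom_linear k R M N).
exists n, (fun i => sHom (s i)) => f; have [u ->] := sHom_surj f.
have [c Ec] := hs u; exists c.
by rewrite -hh Ec linear_sum; apply: eq_bigr => i _; rewrite linearZZ hh.
Qed.

Lemma heart_whole_iso X X' (a : KHom X X') : is_iso a -> heart whole X -> heart whole X'.
Proof.
move=> [b [ba ab]] [[_ [Y [f [_ cY isf]]]] [_ g0]]; split; split=> //.
  by exists Y, (f ∘ b); split=> //; apply: iso_comp => //; exists a.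
move=> V lV g; rewrite -[g]hcomp1l -ab -hcompA (g0 V lV (b ∘ g)); exact: hcomp0r.
Qed.

(** Allows the results on the heart of C to be applied to mod(R) itself. *)
Lemma whole_approx : approximating whole.
Proof.
move=> X; exists X, (hid X); split=> //.
  exists (chid X); split=> // i; split=> [x _ [y e]|y dy]; first by exists y.
  by exists y, 0; rewrite linear0 addr0.
by move=> Y _; apply: (@Bijective _ _ _ id) => f; rewrite hcomp1l.
Qed.

Lemma stalk_proj_whole M : Proj (heart whole) (stalk M).
Proof. exact: (stalk_proj artR (@whole_additive k R) _ whole_approx). Qed.

Lemma proj_whole X : Proj HC X -> Proj (heart whole) X.
Proof.
move=> /(proj_stalk artR additiveC karoubiC)[M [_ [a [b [ba ab]]]]].
have isb : is_iso b by exists a.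
have hM := stalk_proj_whole M.
exact: (Proj_iso isb (heart_whole_iso isb (let: conj x _ := hM in x)) hM).
Qed.

Lemma functor_iso (P Q : cpx R -> Prop) (F : functor_data R) X Y (a : KHom X Y) :
  is_functor P Q F -> P X -> P Y -> is_iso a -> is_iso (fmap F a).
Proof.
move=> [_ _ F1 Fc] PX PY [b [ba ab]]; exists (fmap F b).
by rewrite -!Fc // ba ab !F1.
Qed.

Lemma Inj_iso (P : cpx R -> Prop) X X' (a : KHom X X') : is_iso a -> P X' ->
  Inj P X -> Inj P X'.
Proof.
move=> [b [ba ab]] PX' [PX h]; split=> // Y Z f PY PZ mf g.
have [u Eu] := h Y Z f PY PZ mf (b ∘ g); exists (a ∘ u).
by rewrite -hcompA Eu hcompA ab hcomp1l.
Qed.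

(** * Consequences of the duality: injectivity, full faithfulness, injective hulls *)

Section Duality.
Variable S : functor_data R.
Hypothesis heartS : forall M, C M -> HC (S (stalk M)).
Variable theta : forall M Y, KHom Y (S (stalk M)) -> Edual E (KHom (stalk M) Y).
Arguments theta : clear implicits.
Hypotheses
  (thetaB : forall M Y, C M -> HC Y -> bijective (theta M Y))
  (thetaL : forall M Y c f g v, C M -> HC Y ->
     theta M Y (c *: f + g) v = c *: theta M Y f v + theta M Y g v)
  (thetaN : forall M Y Y' (h : KHom Y' Y) f v, C M -> HC Y -> HC Y' ->
     theta M Y' (f ∘ h) v = theta M Y f (h ∘ v))
  (thetaS : forall M M' (u : KHom (stalk M) (stalk M')) Y f v,
     C M -> C M' -> HC Y -> theta M' Y (fmap S u ∘ f) v = theta M Y f (v ∘ u)).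

Lemma theta_inj M Y f g : C M -> HC Y -> (forall v, theta M Y f v = theta M Y g v) -> f = g.
Proof.
move=> CM hY e; apply: (bij_inj (thetaB CM hY)); exact: linear_ext.
Qed.

Lemma theta0 M Y v : C M -> HC Y -> theta M Y 0 v = 0.
Proof.
move=> CM hY; have := @thetaL M Y (-1) 0 0 v CM hY.
by rewrite scaler0 addr0 scaleN1r addNr.
Qed.

Lemma theta_neq0 M Y f : C M -> HC Y -> f <> 0 -> exists v, theta M Y f v <> 0.
Proof.
move=> CM hY nf; apply: contrapT => h; apply: nf.
apply: (theta_inj CM hY) => v; rewrite theta0 //.
by apply: contrapT => n; apply: h; exists v.
Qed.

Lemma theta_surj M Y (z : {linear KHom (stalk M) Y -> E}) : C M -> HC Y ->
  exists f, forall v, theta M Y f v = z v.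
Proof.
move=> CM hY; have [f <-] := bijective_inv z (thetaB CM hY).
by exists f.
Qed.

(** A monomorphism f is injective on Hom(P_M, -), so the form of g, defined on the image G, extends
    to Hom(P_M, Z) by injectivity of E. *)
Lemma serre_inj M : C M -> Inj HC (S (stalk M)).
Proof.
move=> CM; split; first exact: heartS.
move=> Y Z f hY hZ mf g; have hM : HC (stalk M) by apply: stalk_heart.
pose G (z : KHom (stalk M) Z * E) := exists w, z = (f ∘ w, theta M Y g w).
have G0 : G 0 by exists 0; rewrite hcomp0r linear0.
have GD x y : G x -> G y -> G (x + y).
  by move=> [w ->] [w' ->]; exists (w + w'); rewrite hcompDr linearD.
have GZ c x : G x -> G (c *: x).
  by move=> [w ->]; exists (c *: w); rewrite hcompZr linearZZ.
have [|h hh] := injective_extend injE (G := Submodule G0 GD GZ).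
  by move=> y [w [e ->]]; rewrite (mf _ hM w (esym e)) linear0.
have [h' Eh'] := theta_surj h CM hZ; exists h'.
apply: (theta_inj CM hY) => w; rewrite thetaN // Eh'.
by apply: hh; exists w.
Qed.

(* By reflexivity of Hom(P_M, P_N), as theta identifies Hom(P_N, S P_M) with its
   dual. *)
Lemma theta_eval M N (phi : {linear KHom (stalk N) (S (stalk M)) -> E}) : C M -> C N ->
  exists l, forall v, phi v = theta M (stalk N) v l.
Proof.
move=> CM CN; have hN : HC (stalk N) by apply: stalk_heart.
have [v0 Ev0] := choice (fun z : {linear KHom (stalk M) (stalk N) -> E} =>
  theta_surj z CM hN).
have [c f g h H|l hl] := reflexive artk hullE (F := fun z => phi (v0 z))
   (KHom_stalk_fg M N).
  rewrite -linearP; congr (phi _); apply: (theta_inj CM hN) => v.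
  by rewrite thetaL // !Ev0 H.
exists l => v; rewrite -hl; congr (phi _).
by apply: (theta_inj CM hN) => w; rewrite Ev0.
Qed.

Lemma serre_ff_stalk M N : C M -> C N ->
  bijective (@fmap _ _ S (stalk M) (stalk N)).
Proof.
move=> CM CN; have hN : HC (stalk N) by apply: stalk_heart.
have hSM := heartS CM.
(* Under the duality S u becomes evaluation at u: faithfulness is then separation of points, and
   fullness is reflexivity. *)
have key u v : theta N (S (stalk M)) (fmap S u) v = theta M (stalk N) v u.
  rewrite -[fmap S u]hcomp1r thetaS // -thetaN // hcomp1l //.
apply: bijective_of => [u u' e|f].
  apply: contrapT => ne; have ne0 : ~ (@sm_zero _ (KHom (stalk M) (stalk N))) (u - u').
    by move=> /= /subr0_eq.
  have [z [_ zn]] := cogenerator artk hullE ne0.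
  have [v Ev] := theta_surj z CM hN; apply: zn.
  by rewrite linearB /= -!Ev -!key e subrr.
have [l hl] := theta_eval (theta N (S (stalk M)) f) CM CN.
by exists l; apply: (theta_inj CN hSM) => v; rewrite key hl.
Qed.

Local Notation KEnd M := (KHom (stalk M) (stalk M)).

(** The annihilators of p and q are proper left ideals of the local ring End(M), so their sum misses
    1. A form that kills the sum but not 1 belongs to both submodules by the double annihilator
    property [dperp]. *)
Lemma serre_meet M (p q : KHom (stalk M) (S (stalk M))) : C M -> indecomposable M ->
  p <> 0 -> q <> 0 -> exists a b : KEnd M, p ∘ a = q ∘ b /\ p ∘ a <> 0.
Proof.
move=> CM indM x0 y0; have hM : HC (stalk M) by apply: stalk_heart.
have perp (x : KHom (stalk M) (S (stalk M))) : exists P : submodule (KHom (stalk M) (stalk M)),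
    forall l : KEnd M, smem P l <-> forall b : KEnd M, theta M (stalk M) x (b ∘ l) = 0.
  have P0 (b : KEnd M) : theta M (stalk M) x (b ∘ (0 : KEnd M)) = 0 by rewrite hcomp0r linear0.
  have PD (l l' : KEnd M) : (forall b : KEnd M, theta M (stalk M) x (b ∘ l) = 0) ->
     (forall b : KEnd M, theta M (stalk M) x (b ∘ l') = 0) ->
     forall b : KEnd M, theta M (stalk M) x (b ∘ (l + l')) = 0.
    by move=> h h' b; rewrite hcompDr linearD /= h h' addr0.
  have PZ c (l : KEnd M) : (forall b : KEnd M, theta M (stalk M) x (b ∘ l) = 0) ->
     forall b : KEnd M, theta M (stalk M) x (b ∘ (c *: l)) = 0.
    by move=> h b; rewrite hcompZr linearZZ h scaler0.
  by exists (Submodule P0 PD PZ).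
have proper (x : KHom (stalk M) (S (stalk M))) (P : submodule (KEnd M)) (a b : endo M) :
   (forall l : KEnd M, P l <-> forall b : KEnd M, theta M (stalk M) x (b ∘ l) = 0) ->
   x <> 0 -> b * a = 1 -> P (sHom a) -> False.
  move=> hP nx ba /hP h; apply: nx; apply: (theta_inj CM hM) => v.
  have := h (v ∘ sHom b); rewrite -hcompA sHom_comp.
  by rewrite -/(emul b a) (ba : emul b a = rid M) sHom_id hcomp1r theta0.
(* If z were outside the submodule generated by x, a form would separate them; by [theta_eval] it is
   evaluation at some l, which then lies in P. *)
have dperp (x : KHom (stalk M) (S (stalk M))) (P : submodule (KEnd M)) z :
   (forall l : KEnd M, P l <-> forall b : KEnd M, theta M (stalk M) x (b ∘ l) = 0) ->
   (forall l, P l -> theta M (stalk M) z l = 0) -> exists a, z = x ∘ a.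
  move=> hP hz; apply: contrapT => nz.
  pose Q (v : KHom (stalk M) (S (stalk M))) := exists a : KEnd M, v = x ∘ a.
  have Q0 : Q 0 by exists 0; rewrite hcomp0r.
  have QD u v : Q u -> Q v -> Q (u + v).
    by move=> [a ->] [b ->]; exists (a + b); rewrite hcompDr.
  have QZ c u : Q u -> Q (c *: u).
    by move=> [a ->]; exists (c *: a); rewrite hcompZr.
  have [phi [phi0 phiz]] := cogenerator artk hullE (S := Submodule Q0 QD QZ) nz.
  have [l hl] := theta_eval phi CM CM.
  apply: phiz; rewrite hl; apply: hz; apply/hP => b.
  by rewrite -thetaN // -hl phi0 //; exists b.
have [PX hPX] := perp p; have [PY hPY] := perp q.
have n1 : ~ sm_add PX PY (hid (stalk M)).
  move=> [s [t [Ps Pt e]]]; have [a0 Ea] := sHom_surj s.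
  pose a : endo M := a0; rewrite -/a in Ea.
  have Et : t = sHom (1 - a : endo M).
    have [h hh] := mk_linear (@sHom_linear k R M M).
    rewrite -hh linearB !hh -Ea (sHom_id M : sHom (1 : endo M) = _) e.
    by rewrite addrAC subrr add0r.
  have [[b ba]|[b ba]] := endo_local artR a indM.
    by apply: (proper p PX a b) => //; rewrite -Ea.
  by apply: (proper q PY (1 - a) b) => //; rewrite -Et.
have [z [z0 z1]] := cogenerator artk hullE n1.
have [w Ew] := theta_surj z CM hM.
have [a Ea] : exists a, w = p ∘ a.
  apply: (dperp p PX) => // l Pl; rewrite Ew; apply: z0.
  by exists l, 0; split=> //; [exact: smem0|rewrite addr0].
have [b Eb] : exists b, w = q ∘ b.
  apply: (dperp q PY) => // l Pl; rewrite Ew; apply: z0.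
  by exists 0, l; split=> //; [exact: smem0|rewrite add0r].
exists a, b; rewrite -Ea -Eb; split=> // w0.
by apply: z1; rewrite -Ew w0 theta0.
Qed.

(** j corresponds to a form on Hom(P_M, L) that is nonzero at the quotient map p. A nonzero kernel
    of g would meet the image of j, by [serre_meet]. *)
Lemma serre_hull M L : C M -> indecomposable M -> simple_quotient HC (stalk M) L ->
  injective_hull HC L (S (stalk M)).
Proof.
move=> CM indM [sL [p ep]]; split; first exact: serre_inj.
have hM : HC (stalk M) by apply: stalk_heart.
have [hL L0 _] := sL; have hS := heartS CM.
have p0 : ~ (@sm_zero _ (KHom (stalk M) L)) p.
  by move=> /= e; apply: L0; apply: ep => //; rewrite e hcomp0r.
have [z [_ zp]] := cogenerator artk hullE p0.
have [j Ej] := theta_surj z CM hL.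
have j0 : j <> 0 by move=> e; apply: zp; rewrite -Ej e theta0.
exists j; split; first exact: (simple_mono artR additiveC karoubiC approxC sL hS j0).
move=> X g hX mgj.
have [K [i [hK gi mi lift]]] := heart_kernel artR additiveC karoubiC approxC g hS hX.
have [i0|i0] := pselect (i = 0).
  by move=> Z hZ h /(lift Z h hZ)[h' <-]; rewrite i0 hcomp0l.
have [w ew] := theta_neq0 CM hK i0.
have x0 : j ∘ p <> 0.
  move=> e; apply: zp; rewrite -Ej -[p]hcomp1r -thetaN //.
  by rewrite e theta0.
have y0 : i ∘ w <> 0.
  move=> e; apply: ew; rewrite -[w]hcomp1r -thetaN //.
  by rewrite e theta0.
have [a [b [e ne]]] := serre_meet CM indM x0 y0.
case: ne; rewrite -hcompA (mgj _ hM (p ∘ a)) ?hcomp0r //.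
by rewrite -hcompA [j ∘ _]hcompA e !hcompA gi !hcomp0l.
Qed.

End Duality.

(** * The composite of the approximation functor with the duality on mod(R) *)

Section Composite.
Variables (piC : functor_data R) (eps : forall X, KHom (piC X) X).
Hypothesis piC_approx : approximation_functor C eps.
Variable SA : functor_data R.
Hypotheses (SA_functor : is_functor (Proj (heart whole)) (Inj (heart whole)) SA)
  (SA_serre : serre_duality whole E SA).
Local Notation SC := (functor_comp piC SA).

Lemma eps_Kminus X : Kminus C (piC X).
Proof. by case: piC_approx => /(_ X)[]. Qed.

Lemma eps_local X : clocal C (eps X).
Proof. by case: piC_approx => /(_ X)[]. Qed.

Lemma epsN X Y (f : KHom X Y) : eps Y ∘ fmap piC f = f ∘ eps X.
Proof. by case: piC_approx. Qed.

Lemma SA_heart X : Proj (heart whole) X -> heart whole (SA X).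
Proof. by case: SA_functor => h _ _ _ /h[]. Qed.

Lemma SC_heart X : Proj (heart whole) X -> HC (SC X).
Proof.
move=> /SA_heart; apply: (clocal_heart artR additiveC karoubiC (eps_Kminus _)).
exact: eps_local.
Qed.

Lemma SC_duality : exists theta : forall M Y,
    KHom Y (SC (stalk M)) -> Edual E (KHom (stalk M) Y),
  [/\ forall M Y, HC Y -> bijective (theta M Y),
    forall M Y c f g v, HC Y ->
      theta M Y (c *: f + g) v = c *: theta M Y f v + theta M Y g v,
    forall M Y Y' (h : KHom Y' Y) f v, HC Y -> HC Y' ->
      theta M Y' (f ∘ h) v = theta M Y f (h ∘ v) &
    forall M M' (u : KHom (stalk M) (stalk M')) Y f v, HC Y ->
      theta M' Y (fmap SC u ∘ f) v = theta M Y f (v ∘ u)].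
Proof.
have [thA [bA lA nA sA]] := SA_serre.
have /dep_choice[T /dep_choice[t Ht]] : forall Y, exists T (t : KHom Y T),
   Kminus_le0 whole Y -> [/\ heart whole T,
     forall Z, Kminus_ge0 whole Z -> bijective (fun g : KHom T Z => g ∘ t) &
     forall M, bijective (fun v : KHom (stalk M) Y => t ∘ v)].
  move=> Y; have [/(coaisle_truncation artR)[T [t h]]|n] := pselect (Kminus_le0 whole Y).
    by exists T, t.
  by exists Y, (hid Y).
have lY Y : HC Y -> Kminus_le0 whole Y by case=> /le0_whole.
have gS M : Kminus_ge0 whole (SA (stalk M)).
  by case: (SA_heart (stalk_proj_whole M)).
(* Composing with the approximation and factoring through the truncation T Y turns f into a map to
   S_A P_M; outside of the heart 0 is a dummy value. *)
have ex M Y (f : KHom Y (SC (stalk M))) : exists fb : KHom (T Y) (SA (stalk M)),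
    HC Y -> fb ∘ t Y = eps _ ∘ f.
  have [/lY/Ht[_ + _]|n] := pselect (HC Y); last by exists 0.
  by move=> /(_ _ (gS M))/(bijective_inv (eps _ ∘ f))[fb e]; exists fb.
pose bar M Y f := projT1 (cid (ex M Y f)).
have barE M Y f : HC Y -> bar M Y f ∘ t Y = eps _ ∘ f.
  exact: (projT2 (cid (ex M Y f))).
have barU M Y f fb : HC Y -> fb ∘ t Y = eps _ ∘ f -> fb = bar M Y f.
  move=> hY e; have [_ h _] := Ht Y (lY Y hY).
  by apply: (bij_inj (h _ (gS M))); rewrite /= e barE.
have lth M Y f : linear (fun v : KHom (stalk M) Y => thA M (T Y) (bar M Y f) (t Y ∘ v)).
  by move=> a x y; rewrite hcompDr hcompZr linearP.
pose th M Y f := projT1 (cid (mk_linear (lth M Y f))).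
have thE M Y f v : th M Y f v = thA M (T Y) (bar M Y f) (t Y ∘ v).
  exact: (projT2 (cid (mk_linear (lth M Y f)))).
have barI M Y f g : HC Y -> bar M Y f = bar M Y g -> f = g.
  move=> hY e; apply/subr0_eq/(clocal_inj (@eps_local _)); first exact: heart_Kminus hY.
  by rewrite hcompBr -!barE // e subrr.
exists th; split.
- move=> M Y hY; have [hT hZ hM] := Ht Y (lY Y hY).
  apply: bijective_of => [f g e|z].
    apply: (barI M Y) => //; apply: (bij_inj (bA M (T Y) I hT)).
    apply: linear_ext => w; have [v <-] := bijective_inv w (hM M).
    by rewrite -!thE e.
  have [v0 Ev0] := choice (fun w => bijective_inv w (hM M)).
  have lz : linear (fun w => z (v0 w)).
    move=> a x y; rewrite -linearP; congr (z _); apply: (bij_inj (hM M)).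
    by rewrite /= hcompDr hcompZr !Ev0.
  have [z' hz'] := mk_linear lz.
  have [g Eg] := bijective_inv z' (bA M (T Y) I hT).
  have [f Ef] := clocal_lift (g ∘ t Y) (@eps_local _) (heart_Kminus hY).
  exists f; apply: linear_ext => v; rewrite thE -(barU M Y f g) // Eg hz'.
  by congr (z _); apply: (bij_inj (hM M)); rewrite /= Ev0.
- move=> M Y c f g v hY; have [hT hZ hM] := Ht Y (lY Y hY).
  suff e : c *: bar M Y f + bar M Y g = bar M Y (c *: f + g) by rewrite !thE -lA // e.
  by apply: barU => //; rewrite hcompDl hcompZl !barE // hcompDr hcompZr.
- move=> M Y Y' h f v hY hY'; have [hT hZ hM] := Ht Y (lY Y hY).
  have [hT' hZ' hM'] := Ht Y' (lY Y' hY').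
  have gT : Kminus_ge0 whole (T Y) by case: hT.
  have [hb Ehb] := bijective_inv (t Y ∘ h) (hZ' _ gT).
  suff e : bar M Y f ∘ hb = bar M Y' (f ∘ h).
    by rewrite !thE -e nA // hcompA Ehb -hcompA.
  by apply: barU => //; rewrite -hcompA Ehb !hcompA barE.
- move=> M M' u Y f v hY; have [hT hZ hM] := Ht Y (lY Y hY).
  suff e : fmap SA u ∘ bar M Y f = bar M' Y (fmap SC u ∘ f).
    by rewrite !thE -e sA // hcompA.
  by apply: barU => //; rewrite -hcompA barE // !hcompA epsN.
Qed.

Lemma SC_serre : serre_duality C E SC.
Proof.
have [th [h1 h2 h3 h4]] := SC_duality; exists th; split.
- by move=> M Y _; apply: h1.
- by move=> M Y c f g v _; apply: h2.
- by move=> M Y Y' h f v _; apply: h3.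
- by move=> M M' u Y f v _ _; apply: h4.
Qed.

Lemma SC_functor : is_functor (Proj HC) (Inj HC) SC.
Proof.
have [_ Sadd S1 Sc] := SA_functor.
have inj X Y (f g : KHom (SC X) (SC Y)) : eps (SA Y) ∘ f = eps (SA Y) ∘ g -> f = g.
  move=> e; apply/subr0_eq/(clocal_inj (@eps_local _)); first exact: eps_Kminus.
  by rewrite hcompBr e subrr.
have F1 X : Proj HC X -> fmap SC (hid X) = hid (SC X).
  move=> /proj_whole pX; apply: (inj X X); rewrite /= epsN S1 //.
  by rewrite hcomp1l hcomp1r.
have Fc X Y Z (g : KHom Y Z) (f : KHom X Y) : Proj HC X -> Proj HC Y -> Proj HC Z ->
    fmap SC (g ∘ f) = fmap SC g ∘ fmap SC f.
  move=> /proj_whole pX /proj_whole pY /proj_whole pZ; apply: (inj X Z).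
  by rewrite /= epsN Sc // [RHS]hcompA epsN -!hcompA epsN.
have hX X : Proj HC X -> HC (SC X) by move=> /proj_whole/SC_heart.
split=> //.
(* Injectivity is known on stalks and is transported along an isomorphism from a stalk. *)
- move=> X pX; have [M [CM [a [b [ba ab]]]]] := proj_stalk artR additiveC karoubiC pX.
  have pM : Proj HC (stalk M) by apply: stalk_proj.
  have [th [h1 h2 h3 h4]] := SC_serre.
  have iS : Inj HC (SC (stalk M)).
    by apply: (serre_inj _ h1 h3) => // N CN; apply/hX/stalk_proj.
  have isb : is_iso (fmap SC b).
    by exists (fmap SC a); rewrite -!Fc // ba ab !F1.
  by apply: (Inj_iso isb) => //; apply: hX.
- move=> X Y f g /proj_whole pX /proj_whole pY; apply: (inj X Y).
  by rewrite /= hcompDr !epsN Sadd // hcompDl.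
Qed.

Lemma SC_fully_faithful : fully_faithful (Proj HC) SC.
Proof.
have SF := SC_functor; have [_ _ F1 Fc] := SF => X Y pX pY.
have [M [CM [a isa]]] := proj_stalk artR additiveC karoubiC pX.
have [N [CN [b isb]]] := proj_stalk artR additiveC karoubiC pY.
have pM : Proj HC (stalk M) by apply: stalk_proj.
have pN : Proj HC (stalk N) by apply: stalk_proj.
have [th [h1 h2 h3 h4]] := SC_serre.
have bij : bijective (@fmap _ _ SC (stalk M) (stalk N)).
  apply: (serre_ff_stalk _ h1 h2 h3 h4) => // P CP.
  by apply/SC_heart/proj_whole/stalk_proj.
have isFa := functor_iso SF pX pM isa; have isFb := functor_iso SF pY pN isb.
have [a' [a'a aa']] := isa; have [b' [b'b bb']] := isb.
have conj f : fmap SC (b ∘ f ∘ a') ∘ fmap SC a = fmap SC b ∘ fmap SC f.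
  by rewrite -!Fc // -!hcompA a'a hcomp1r.
apply: bijective_of => [f g e|g].
  have : b ∘ f ∘ a' = b ∘ g ∘ a'.
    by apply: (bij_inj bij); apply: (iso_cancelr isFa); rewrite !conj e.
  move=> /(congr1 (fun h => h ∘ a)); rewrite -!hcompA a'a !hcomp1r.
  exact: iso_cancel.
have [u Eu] := bijective_inv (fmap SC b ∘ g ∘ fmap SC a') bij.
exists (b' ∘ u ∘ a); apply: (iso_cancel isFb); rewrite -conj.
rewrite !hcompA bb' hcomp1l -(hcompA u) aa' hcomp1r Eu.
by rewrite -hcompA -Fc // a'a F1 // hcomp1r.
Qed.

End Composite.
End Serre.

(** * Models of the complexes of functors D Hom(X, -) *)

Section HomBilinear.
Variables (k : comNzRingType) (R : algType k).
Implicit Types M N P Q : lmodType R.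

Lemma rcompPl M N P a (g g' : rHom N P) (f : rHom M N) :
  rcomp (a *: g + g') f = a *: rcomp g f + rcomp g' f.
Proof. exact: rcomp_linearl. Qed.

Lemma rcompPr M N P a (g : rHom N P) (f f' : rHom M N) :
  rcomp g (a *: f + f') = a *: rcomp g f + rcomp g f'.
Proof. exact: rcomp_linearr. Qed.

Lemma rcompA M N P Q (h : rHom P Q) (g : rHom N P) (f : rHom M N) :
  rcomp h (rcomp g f) = rcomp (rcomp h g) f.
Proof. exact: rHomP. Qed.

Lemma rcomp0r M N P (g : rHom N P) : rcomp g (0 : rHom M N) = 0.
Proof. by apply: rHomP => x; rewrite rcompE linear0. Qed.

Lemma rHom_from0 M N (f : rHom M N) : zero_module M -> f = 0.
Proof. by move=> z; apply: rHomP => x; rewrite (z x) linear0. Qed.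

Lemma rHom_to0 M N (f : rHom M N) : zero_module N -> f = 0.
Proof. by move=> z; apply: rHomP => x; rewrite (z (f x)). Qed.

Definition rpair_fun M N P (f : rHom M N) (g : rHom M P) (x : M) : (N * P)%type :=
  (f x, g x).
Lemma rpair_linear M N P (f : rHom M N) (g : rHom M P) : linear (rpair_fun f g).
Proof. by move=> a x y; rewrite /rpair_fun !linearP. Qed.
HB.instance Definition _ M N P (f : rHom M N) (g : rHom M P) :=
  GRing.isLinear.Build R M (N * P)%type _ (rpair_fun f g) (rpair_linear f g).
Definition rpair M N P (f : rHom M N) (g : rHom M P) : rHom M (N * P)%type :=
  [the {linear M -> (N * P)%type} of rpair_fun f g].

Definition rfst M N : rHom (M * N)%type M := [the {linear (M * N)%type -> M} of fst].
Definition rsnd M N : rHom (M * N)%type N := [the {linear (M * N)%type -> N} of snd].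
Definition rinl M N : rHom M (M * N)%type := rpair (rid M) 0.
Definition rinr M N : rHom N (M * N)%type := rpair 0 (rid N).

Lemma rcopair_eta M N P (f : rHom (M * N)%type P) :
  rcomp (rcomp f (rinl M N)) (rfst M N) + rcomp (rcomp f (rinr M N)) (rsnd M N) = f.
Proof.
apply: rHomP => -[x y]; rewrite rHomDE !rcompE -linearD; congr (f _).
by congr pair; rewrite /= ?addr0 ?add0r.
Qed.

End HomBilinear.

Section Models.
Variables (k : comNzRingType) (R : algType k) (artR : artin_algebra R).
Variables (E : lmodType k) (C : fgmod R -> Prop) (additiveC : additive_sub C).
Implicit Types (X Y Z W : cpx R) (M N : fgmod R).

Notation fnl M N := {linear rHom M N -> E}.

(* A representation up to homotopy of the complex of functors D Hom(X, -) on C: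
   y |-> alpha (y o -) is a quasi-isomorphism from Hom(-, S) to D Hom(X, -),
   surjective in each degree. *)
Record model X := Model {
  mS :> cpx R;
  mA : forall i, fnl (X i) (mS i);
  mC : Kminus C mS;
  mD : forall i (u : rHom (X (i + 1)) (mS i)),
    mA (i + 1) (rcomp d_[mS, i] u) = mA i (rcomp u d_[X, i]);
  mL : forall i N, C N -> forall x : rHom N (mS (i + 1)),
    (forall y, d_[mS, i + 1] (x y) = 0) -> forall z : fnl (X i) N,
    (forall u, mA (i + 1) (rcomp x u) = z (rcomp u d_[X, i])) ->
    exists y : rHom N (mS i), x = rcomp d_[mS, i] y /\ forall v, z v = mA i (rcomp y v) }.

(** Commutativity of the square formed by composition with g and by D Hom(f, -), in terms of the
    Yoneda forms. *)
Definition over X X' (m : model X) (m' : model X') (f : chmap X X') (g : chmap m m') :=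
  forall i (v : rHom (X' i) (m i)), mA m' i (rcomp (g i) v) = mA m i (rcomp v (f i)).

(** b is the Yoneda form of a map of complexes from Hom(-, Y) to D Hom(X', -). It lifts along a
    surjective quasi-isomorphism because the terms Hom(-, Y^i) are projective. *)
Lemma model_lift X' (m : model X') Y (b : forall i, fnl (X' i) (Y i)) : Kminus C Y ->
  (forall i (u : rHom (X' (i + 1)) (Y i)),
     b (i + 1) (rcomp d_[Y, i] u) = b i (rcomp u d_[X', i])) ->
  exists g : chmap Y m, forall i v, mA m i (rcomp (g i) v) = b i v.
Proof.
move=> CY bD; have [t ht] := cbounded Y.
pose T i := rHom (Y i) (m i).
pose B i (g : T i) (g' : T (i + 1)) := (forall n, g' (d_[Y, i] n) = d_[m, i] (g n)) /\
  forall v, mA m i (rcomp g v) = b i v.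
have stepP i (g' : T (i + 1)) : exists g : T i, (exists g1, B i g1 g') -> B i g g'.
  by have [[g1 h]|n] := pselect (exists g1, B i g1 g'); [exists g1|exists 0].
have [g [gz gS]] := @int_rec_down T t (fun i => 0) (fun i g' => projT1 (cid (stepP i g'))).
have gB i : B i (g i) (g (i + 1)).
  move: i; apply: (@int_down_ind _ t) => [i ti|i [IH1 IH2]].
    split=> [n|v]; first by rewrite (ht i ti n) !linear0.
    by rewrite (rHom_to0 v (ht i ti)) rcomp0r !linear0.
  have [ti|it] := ltP t i.
    split=> [n|v]; first by rewrite (ht i ti n) !linear0.
    by rewrite (rHom_to0 v (ht i ti)) rcomp0r !linear0.
  rewrite gS //; apply: (projT2 (cid (stepP i (g (i + 1))))).
  have [||y [Ey Ay]] := mL (CY i) (x := rcomp (g (i + 1)) d_[Y, i]) _ (z := b i).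
  - by move=> y; rewrite /= -IH1 cdiffK linear0.
  - by move=> u; rewrite -rcompA IH2 bD.
  exists y; split=> [n|v]; last by rewrite Ay.
  by have := congr1 (fun h : rHom _ _ => h n) Ey.
have gd i x : g (i + 1) (d_[Y, i] x) = d_[m, i] (g i x) by case: (gB i) => ->.
by exists (@Chmap _ Y m (fun i => rfun (g i)) gd) => i v; case: (gB i) => _; apply.
Qed.

(** s encodes a null homotopy after composition with the comparison map; by the same lifting
    property it comes from a null homotopy of g. *)
Lemma model_null X' (m : model X') Y (g : chmap Y m)
    (s : forall i, fnl (X' i) (Y (i + 1))) : Kminus C Y ->
  (forall i (v : rHom (X' (i + 1)) (Y (i + 1))), mA m (i + 1) (rcomp (g (i + 1)) v) =
     s i (rcomp v d_[X', i]) + s (i + 1) (rcomp d_[Y, i + 1] v)) ->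
  hclass g = 0.
Proof.
move=> CY sD; have [t ht] := cbounded Y.
have ht1 i : t < i -> zero_module (Y (i + 1)).
  by move=> ti; apply: ht; rewrite (lt_trans ti) // ltrDl.
pose T i := rHom (Y (i + 1)) (m i).
pose B i (h : T i) (h' : T (i + 1)) :=
  (forall y, d_[m, i] (h y) = g (i + 1) y - h' (d_[Y, i + 1] y)) /\
  forall v, mA m i (rcomp h v) = s i v.
have stepP i (h' : T (i + 1)) : exists h : T i, (exists h1, B i h1 h') -> B i h h'.
  by have [[h1 p]|n] := pselect (exists h1, B i h1 h'); [exists h1|exists 0].
have [h [hz hS]] := @int_rec_down T t (fun i => 0) (fun i h' => projT1 (cid (stepP i h'))).
have triv i : t < i -> B i (h i) (h (i + 1)).
  move=> ti; split=> [y|v]; first by rewrite (ht1 i ti y) !linear0 addr0.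
  by rewrite (rHom_to0 v (ht1 i ti)) rcomp0r !linear0.
have hB i : B i (h i) (h (i + 1)).
  move: i; apply: (@int_down_ind _ t) => [//|i [IH1 IH2]].
  have [/triv//|it] := ltP t i.
  rewrite hS //; apply: (projT2 (cid (stepP i (h (i + 1))))).
  pose x : rHom (Y (i + 1)) (m (i + 1)) :=
    (g (i + 1) : rHom (Y (i + 1)) (m (i + 1))) - rcomp (h (i + 1)) d_[Y, i + 1].
  have [||y [Ey Ay]] := mL (CY (i + 1)) (x := x) _ (z := s i).
  - move=> y; rewrite /x /= linearB /= IH1 cdiffK linear0 subr0.
    by rewrite chfunD subrr.
  - move=> u; have -> : rcomp x u = - 1 *: rcomp (h (i + 1)) (rcomp d_[Y, i + 1] u)
        + rcomp (g (i + 1)) u.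
      by rewrite rcompA -rcompPl; congr (rcomp _ _); rewrite scaleN1r [RHS]addrC.
    rewrite linearP /= sD IH2.
    by rewrite scaleN1r [LHS]addrC addrK.
  exists y; split=> [n|v]; last by rewrite Ay.
  by have := congr1 (fun h : rHom _ _ => h n) Ey.
apply/hclass_eq0; exists (fun i => rfun (h i)) => i x.
by case: (hB i) => -> _; rewrite subrK.
Qed.

Lemma over_lift X X' (m : model X) (m' : model X') (f : chmap X X') :
  exists g : chmap m m', over f g.
Proof.
have l i : linear (fun v : rHom (X' i) (m i) => mA m i (rcomp v (f i))).
  by move=> a v w; rewrite rcompPl linearP.
have [b hb] := mk_linears l.
have [i u|g hg] := model_lift m' (b := b) (mC m).
  rewrite !hb -[rcomp (rcomp d_[m, i] u) _]rcompA mD; congr (mA m i _); apply: rHomP => x.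
  by rewrite !rcompE chfunD.
by exists g => i v; rewrite hg hb.
Qed.

Lemma over_null X X' (m : model X) (m' : model X') (f : chmap X X') (g : chmap m m') :
  over f g -> hclass f = 0 -> hclass g = 0.
Proof.
move=> o /hclass_eq0[h hh].
have l i : linear (fun v : rHom (X' i) (m (i + 1)) => mA m (i + 1) (rcomp v (h i))).
  by move=> a v w; rewrite rcompPl linearP.
have [s hs] := mk_linears l; apply: (model_null (s := s)); first exact: mC.
move=> i v; rewrite o !hs -!rcompA mD -linearD; congr (mA m _ _).
apply: rHomP => x; rewrite rHomDE !rcompE -linearD; congr (v _).
exact: hh.
Qed.

(** A relation with existence ([overK_lift]) and uniqueness ([overK_uniq]): the functor identities
    below say that two maps lie over the same one. *)
Definition overK X X' (m : model X) (m' : model X') (f : KHom X X') (g : KHom m m') :=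
  exists (f0 : chmap X X') (g0 : chmap m m'), [/\ f = hclass f0, g = hclass g0 & over f0 g0].

Lemma overK_lift X X' (m : model X) (m' : model X') (f : KHom X X') :
  exists g : KHom m m', overK f g.
Proof.
have [f0 ->] := hrep f; have [g0 o] := over_lift m m' f0.
by exists (hclass g0), f0, g0.
Qed.

Lemma overK_uniq X X' (m : model X) (m' : model X') (f : KHom X X') (g g' : KHom m m') :
  overK f g -> overK f g' -> g = g'.
Proof.
move=> [f0 [g0 [-> -> o]]] [f1 [g1 [e -> o']]]; apply/subr0_eq.
rewrite -hclassN -hclassD; apply: (@over_null X X' m m' (f0 - f1)).
  move=> i v; have -> : rcomp ((g0 - g1 : chmap m m') i) v =
      - 1 *: rcomp (g1 i) v + rcomp (g0 i) v.
    by rewrite scaleN1r [RHS]addrC; apply: rHomP.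
  have -> : rcomp v ((f0 - f1 : chmap X X') i) =
      - 1 *: rcomp v (f1 i) + rcomp v (f0 i).
    by rewrite scaleN1r [RHS]addrC; apply: rHomP => x; rewrite [LHS]linearB.
  by rewrite !linearP o o'.
by rewrite hclassD hclassN e subrr.
Qed.

Lemma overK_id X (m : model X) : overK (m := m) (m' := m) (hid X) (hid m).
Proof. by exists (chid X), (chid m); split=> // i v; congr (mA m i _); apply: rHomP. Qed.

Lemma overK_comp X X' X'' (m : model X) (m' : model X') (m'' : model X'')
    (f : KHom X X') (f' : KHom X' X'') (g : KHom m m') (g' : KHom m' m'') :
  overK f g -> overK f' g' -> overK (m := m) (m' := m'') (f' ∘ f) (g' ∘ g).
Proof.
move=> [f0 [g0 [-> -> o]]] [f1 [g1 [-> -> o']]].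
exists (chcomp f1 f0), (chcomp g1 g0); rewrite !hcomp_class; split=> // i v.
have -> : rcomp ((chcomp g1 g0) i) v = rcomp (g1 i) (rcomp (g0 i) v) by apply: rHomP.
by rewrite o' -rcompA o; congr (mA m i _); apply: rHomP.
Qed.

Lemma overK_add X X' (m : model X) (m' : model X') (f f' : KHom X X') (g g' : KHom m m') :
  overK f g -> overK f' g' -> overK (m := m) (m' := m') (f + f') (g + g').
Proof.
move=> [f0 [g0 [-> -> o]]] [f1 [g1 [-> -> o']]].
exists (f0 + f1), (g0 + g1); rewrite !hclassD; split=> // i v.
have -> : rcomp ((g0 + g1 : chmap m m') i) v = rcomp (g0 i) v + rcomp (g1 i) v.
  exact: rHomP.
have -> : rcomp v ((f0 + f1 : chmap X X') i) = rcomp v (f0 i) + rcomp v (f1 i).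
  by apply: rHomP => x; rewrite [LHS]linearD.
by rewrite !linearD o o'.
Qed.

Lemma overK_iso X (m m' : model X) (g : KHom m m') :
  overK (m := m) (m' := m') (hid X) g -> is_iso g.
Proof.
move=> o; have [g' o'] := overK_lift m' m (hid X); exists g'; split.
  apply: (overK_uniq (m := m) (m' := m) (f := hid X)); last exact: overK_id.
  by have := overK_comp o o'; rewrite hcomp1l.
apply: (overK_uniq (m := m') (m' := m') (f := hid X)); last exact: overK_id.
by have := overK_comp o' o; rewrite hcomp1l.
Qed.

(** * Models of shifts and cones *)

Section Shift.
Variables (X : cpx R) (m : model X).

Lemma shift_D i (u : rHom (cshift X (i + 1)) (cshift m i)) :
  mA m (i + 1 + 1) (rcomp d_[cshift m, i] u) = mA m (i + 1) (rcomp u d_[cshift X, i]).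
Proof.
have -> : rcomp d_[cshift m, i] u = - rcomp d_[m, i + 1] u by apply: rHomP.
have -> : rcomp u d_[cshift X, i] = - rcomp u d_[X, i + 1].
  by apply: rHomP => x; rewrite [LHS]linearN.
by rewrite !linearN mD.
Qed.

Lemma shift_L i N : C N -> forall x : rHom N (cshift m (i + 1)),
  (forall y, d_[cshift m, i + 1] (x y) = 0) -> forall z : fnl (cshift X i) N,
  (forall u, mA m (i + 1 + 1) (rcomp x u) = z (rcomp u d_[cshift X, i])) ->
  exists y : rHom N (cshift m i), x = rcomp d_[cshift m, i] y /\
    forall v, z v = mA m (i + 1) (rcomp y v).
Proof.
move=> CN x dx z zD.
(* The sign of the shifted differential is moved to x. *)
have [||y [Ey Ay]] := mL CN (x := (- x : rHom N (m (i + 1 + 1)))) _ (z := z).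
- by move=> y; rewrite [LHS]linearN; apply: dx.
- move=> u; have -> : rcomp (- x : rHom N (m (i + 1 + 1))) u = - rcomp x u by apply: rHomP.
  rewrite linearN /= zD -linearN; congr (z _); apply: rHomP => y.
  by rewrite /= linearN opprK.
exists y; split=> //; apply: rHomP => n.
have := congr1 (fun h : rHom _ _ => h n) Ey => /= e.
by rewrite -e opprK.
Qed.

Definition mshift : model (cshift X) :=
  @Model (cshift X) (cshift m) (fun i => mA m (i + 1)) (Kminus_shift (mC m)) shift_D shift_L.

End Shift.

Lemma overK_shift X X' (m : model X) (m' : model X') (f : KHom X X') (g : KHom m m') :
  overK f g -> overK (m := mshift m) (m' := mshift m') (hshift f) (hshift g).
Proof.
move=> [f0 [g0 [-> -> o]]]; exists (chshift f0), (chshift g0).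
by rewrite !hshift_class; split=> // i v; apply: o.
Qed.

Section ConeModel.
Variables (X Y : cpx R) (m : model X) (n : model Y) (f : chmap X Y) (g : chmap m n).
Hypothesis o : over f g.

(** The Yoneda form of the direct sum of the two comparison maps sees only the diagonal blocks of v,
    as a trace does. *)
Definition cone_A i (v : rHom (cone f i) (cone g i)) : E :=
  mA m (i + 1) (rcomp (rfst _ _) (rcomp v (rinl _ _))) +
  mA n i (rcomp (rsnd _ _) (rcomp v (rinr _ _))).

Lemma cone_A_linear i : linear (@cone_A i).
Proof.
by move=> a v w; rewrite /cone_A !rcompPl !rcompPr !linearP /= scalerDr addrACA.
Qed.

HB.instance Definition _ i :=
  GRing.isLinear.Build k (rHom (cone f i) (cone g i)) E _ (@cone_A i) (@cone_A_linear i).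

Lemma cone_D i (u : rHom (cone f (i + 1)) (cone g i)) :
  cone_A (rcomp d_[cone g, i] u) = cone_A (rcomp u d_[cone f, i]).
Proof.
pose u1 := rcomp (rfst _ _) u; pose u2 := rcomp (rsnd _ _) u.
pose u11 := rcomp u1 (rinl _ _); pose u12 := rcomp u1 (rinr _ _).
pose u21 := rcomp u2 (rinl _ _); pose u22 := rcomp u2 (rinr _ _).
rewrite /cone_A.
have -> : rcomp (rfst _ _) (rcomp (rcomp d_[cone g, i] u) (rinl _ _)) =
   - rcomp d_[m, i + 1] u11 by apply: rHomP.
have -> : rcomp (rsnd _ _) (rcomp (rcomp d_[cone g, i] u) (rinr _ _)) =
   rcomp (g (i + 1)) u12 + rcomp d_[n, i] u22 by apply: rHomP.
have -> : rcomp (rfst _ _) (rcomp (rcomp u d_[cone f, i]) (rinl _ _)) =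
   - rcomp u11 d_[X, i + 1] + rcomp u12 (f (i + 1)).
  apply: rHomP => x; have e : d_[cone f, i] (rinl _ _ x : cone f i) =
      - (rinl _ _ (d_[X, i + 1] x) : cone f (i + 1)) + rinr _ _ (f (i + 1) x).
    by congr pair; rewrite /= ?linear0 ?oppr0 ?addr0 ?add0r.
  apply: etrans (congr1 (fun w => (u w).1) e) _.
  by rewrite linearD linearN.
have -> : rcomp (rsnd _ _) (rcomp (rcomp u d_[cone f, i]) (rinr _ _)) =
   rcomp u22 d_[Y, i].
  apply: rHomP => x; have e : d_[cone f, i] (rinr _ _ x : cone f i) =
      (rinr _ _ (d_[Y, i] x) : cone f (i + 1)).
    by congr pair; rewrite /= ?linear0 ?oppr0 ?add0r.
  exact: (congr1 (fun w => (u w).2) e).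
rewrite !linearN !linearD !linearN /= o !mD.
by rewrite addrA.
Qed.

Lemma cone_L i N : C N -> forall x : rHom N (cone g (i + 1)),
  (forall y, d_[cone g, i + 1] (x y) = 0) -> forall z : fnl (cone f i) N,
  (forall u, cone_A (rcomp x u) = z (rcomp u d_[cone f, i])) ->
  exists y : rHom N (cone g i), x = rcomp d_[cone g, i] y /\
    forall v, z v = cone_A (rcomp y v).
Proof.
move=> CN x dx z zD.
pose x1 := rcomp (rfst _ _) x; pose x2 := rcomp (rsnd _ _) x.
have dx1 y : d_[m, i + 1 + 1] (x1 y) = 0.
  by apply/eqP; rewrite -oppr_eq0; apply/eqP; apply: (congr1 fst (dx y)).
have dx2 y : g (i + 1 + 1) (x1 y) + d_[n, i + 1] (x2 y) = 0.
  exact: (congr1 snd (dx y)).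
have l1 : linear (fun v : rHom (X (i + 1)) N => z (rcomp v (rfst _ _))).
  by move=> a v w; rewrite rcompPl linearP.
have l2 : linear (fun v : rHom (Y i) N => z (rcomp v (rsnd _ _))).
  by move=> a v w; rewrite rcompPl linearP.
have [z1 hz1] := mk_linear l1; have [z2 hz2] := mk_linear l2.
have zE v : z v = z1 (rcomp v (rinl _ _)) + z2 (rcomp v (rinr _ _)).
  by rewrite hz1 hz2 -linearD rcopair_eta.
have zD1 u : mA m (i + 1 + 1) (rcomp x1 u) = - z1 (rcomp u d_[X, i + 1]).
  have := zD (rcomp u (rfst _ _)); rewrite /cone_A zE.
  have -> : rcomp (rsnd _ _) (rcomp (rcomp x (rcomp u (rfst _ _))) (rinr _ _)) = 0
       :> rHom (Y (i + 1)) (n (i + 1)).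
    by apply: rHomP => y; rewrite /= !linear0.
  have -> : rcomp (rcomp (rcomp u (rfst _ _)) d_[cone f, i]) (rinr _ _) = 0
       :> rHom (Y i) N.
    by apply: rHomP => y; rewrite /= linear0 oppr0 linear0.
  rewrite !linear0 !addr0 => e; rewrite -linearN.
  apply: etrans (etrans e _); first by congr (mA m _ _); apply: rHomP.
  by congr (z1 _); apply: rHomP => y; rewrite /= linearN.
have zD2 u : mA n (i + 1) (rcomp x2 u) =
    z1 (rcomp u (f (i + 1))) + z2 (rcomp u d_[Y, i]).
  have := zD (rcomp u (rsnd _ _)); rewrite /cone_A zE.
  have -> : rcomp (rfst _ _) (rcomp (rcomp x (rcomp u (rsnd _ _))) (rinl _ _)) = 0
       :> rHom (X (i + 1 + 1)) (m (i + 1 + 1)).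
    by apply: rHomP => y; rewrite /= !linear0.
  rewrite linear0 add0r => e; apply: etrans (etrans e _).
    by congr (mA n _ _); apply: rHomP.
  congr (z1 _ + z2 _); apply: rHomP => y; rewrite /=.
    by rewrite linear0 addr0.
  by rewrite linear0 add0r.
have [||y1 [Ey1 Ay1]] := mL CN (x := - x1) _ (z := z1).
- by move=> y; rewrite [LHS]linearN [X in - X]dx1 oppr0.
- move=> u; have -> : rcomp (- x1) u = - rcomp x1 u by apply: rHomP.
  by rewrite linearN /= zD1 opprK.
(* The first component is solved before the second, which is corrected by the term that g adds to
   the differential. *)
pose x2' := x2 - rcomp (g (i + 1)) y1.
have [||y2 [Ey2 Ay2]] := mL CN (x := x2') _ (z := z2).
- move=> y; rewrite /x2' [LHS]linearB /= -chfunD.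
  have := congr1 (fun h : rHom _ _ => h y) Ey1 => /= <-.
  by rewrite linearN opprK [LHS]addrC; apply: dx2.
- move=> u; have -> : rcomp x2' u = rcomp x2 u - rcomp (g (i + 1)) (rcomp y1 u).
    exact: rHomP.
  by rewrite linearB /= zD2 o -rcompA -Ay1 addrAC subrr add0r.
exists (rpair y1 y2); split.
  apply: rHomP => y; rewrite [LHS]surjective_pairing /= /cone_diff /=.
  have := congr1 (fun h : rHom _ _ => h y) Ey1 => /= <-.
  have := congr1 (fun h : rHom _ _ => h y) Ey2 => /= <-.
  by congr pair; rewrite /= ?opprK // [RHS]addrC subrK.
move=> v; rewrite zE Ay1 Ay2 /cone_A.
by congr (mA m (i + 1) _ + mA n i _); apply: rHomP.
Qed.

Definition mcone : model (cone f) :=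
  @Model (cone f) (cone g) (fun i => [the {linear _ -> _} of @cone_A i])
    (Kminus_cone additiveC g (mC m) (mC n)) cone_D cone_L.

Lemma over_cone_in : over (m := n) (m' := mcone) (cone_in f) (cone_in g).
Proof.
move=> i v; rewrite /= /cone_A.
have -> : rcomp (rfst _ _) (rcomp (rcomp (cone_in g i) v) (rinl _ _)) = 0
     :> rHom (X (i + 1)) (m (i + 1)) by apply: rHomP.
by rewrite linear0 add0r; congr (mA n _ _); apply: rHomP.
Qed.

Lemma over_cone_out : over (m := mcone) (m' := mshift m) (cone_out f) (cone_out g).
Proof.
move=> i v; rewrite /= /cone_A.
have -> : rcomp (rsnd _ _) (rcomp (rcomp v (cone_out f i)) (rinr _ _)) = 0
     :> rHom (Y i) (n i) by apply: rHomP => y; rewrite /= !linear0.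
by rewrite linear0 addr0; congr (mA m _ _); apply: rHomP.
Qed.

End ConeModel.

End Models.

(** * The extension to complexes *)

Section Existence.
Variables (k : comNzRingType) (R : algType k) (artR : artin_algebra R).
Variables (E : lmodType k) (C : fgmod R -> Prop) (additiveC : additive_sub C).
Implicit Types (X Y Z W : cpx R) (M N : fgmod R).

Notation fnl M N := {linear rHom M N -> E}.

(* Hom(-, S1) -> Hom(-, S0) -> D Hom(M, -) -> 0 is exact on C. *)
Definition presented M : Prop := exists (S1 S0 : fgmod R) (d : rHom S1 S0) (w : fnl M S0),
  [/\ C S1 /\ C S0, forall t : rHom M S1, w (rcomp d t) = 0,
    forall N, C N -> forall z : fnl M N, exists s : rHom N S0, forall u, z u = w (rcomp s u) &
    forall N, C N -> forall s : rHom N S0, (forall u : rHom M N, w (rcomp s u) = 0) ->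
      exists c, s = rcomp d c].

Hypothesis pres : forall M, presented M.
Hypothesis cover : forall K : fgmod R, exists (B : fgmod R) (p : rHom B K), C B /\
  forall N, C N -> forall g : rHom N K, exists g', g = rcomp p g'.

(** One step down. A pair of a cocycle x in F and an s representing a form z on Hom(X0, -) must
    satisfy an equality in D Hom(X1, -). By the presentation of that functor this is solvability of
    r(x, s) = dT t. F' is a right C-approximation of the module W of such triples. *)
Lemma model_step (X0 X1 F : fgmod R) (dX : rHom X0 X1) (Z : submodule F)
    (a : fnl X1 F) : C F ->
  exists (F' : fgmod R) (d : rHom F' F) (a' : fnl X0 F'),
    [/\ C F', forall y, Z (d y),
      forall u : rHom X1 F', a (rcomp d u) = a' (rcomp u dX) &
      forall N, C N -> forall x : rHom N F, (forall y, Z (x y)) -> forall z : fnl X0 N,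
        (forall u, a (rcomp x u) = z (rcomp u dX)) ->
        exists y : rHom N F', x = rcomp d y /\ forall v, z v = a' (rcomp y v)].
Proof.
move=> CF; case: additiveC => _ prodC.
have [S1 [S0 [dS [w [[CS1 CS0] wd wsurj winj]]]]] := pres X0.
have [T1 [T0 [dT [w' [[CT1 CT0] wd' wsurj' winj']]]]] := pres X1.
pose P := modprod F S0.
(* c measures the defect of the required equality, and r represents it in T0. *)
have lc : linear (fun v : rHom X1 P =>
    a (rcomp (rfst _ _) v) - w (rcomp (rcomp (rsnd _ _) v) dX)).
  by move=> c v v'; rewrite !rcompPr rcompPl !linearP /= addrACA -scalerDr.
have [c hc] := mk_linear lc.
have [r hr] := wsurj' P (prodC _ _ CF CS0) c.
have W0 : Z (0 : modprod P T1).1.1 /\ r (0 : modprod P T1).1 = dT (0 : modprod P T1).2.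
  by rewrite !linear0; split=> //; apply: smem0.
have WD (x y : modprod P T1) : Z x.1.1 /\ r x.1 = dT x.2 -> Z y.1.1 /\ r y.1 = dT y.2 ->
    Z (x + y).1.1 /\ r (x + y).1 = dT (x + y).2.
  by move=> [h1 h2] [h3 h4]; rewrite !linearD h2 h4; split=> //; apply: smemD.
have WZ b (x : modprod P T1) : Z x.1.1 /\ r x.1 = dT x.2 ->
    Z (b *: x).1.1 /\ r (b *: x).1 = dT (b *: x).2.
  by move=> [h1 h2]; rewrite !linearZZ h2; split=> //; apply: smemZ.
pose W := Submodule W0 WD WZ.
have [F' [p [CF' hp]]] := cover (subfg artR W).
pose q : rHom F' (modprod P T1) :=
  rcomp ([the {linear sub_type W -> modprod P T1} of @sub_val _ _ W] : rHom (subfg artR W) _) p.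
have qW y : W (q y) by apply: sub_mem.
pose q1 := rcomp (rfst P T1) q.
have la : linear (fun v : rHom X0 F' => w (rcomp (rcomp (rsnd F S0) q1) v)).
  by move=> b v v'; rewrite rcompPr linearP.
have [a' ha'] := mk_linear la.
exists F', (rcomp (rfst F S0) q1), a'; split=> //.
- by move=> y; case: (qW y).
- move=> u; rewrite ha'; apply/subr0_eq.
  have := hc (rcomp q1 u); rewrite hr.
  have -> : rcomp r (rcomp q1 u) = rcomp dT (rcomp (rcomp (rsnd P T1) q) u).
    by apply: rHomP => y; case: (qW (u y)).
  rewrite wd' => ->; rewrite !rcompA //.
move=> N CN x xZ z zx.
have [s hs] := wsurj N CN z.
have [t Et] : exists t, rcomp r (rpair x s : rHom N P) = rcomp dT t.
  apply: winj' => // u; rewrite -rcompA -hr hc.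
  have -> : rcomp (rfst _ _) (rcomp (rpair x s) u) = rcomp x u by apply: rHomP.
  have -> : rcomp (rsnd _ _) (rcomp (rpair x s) u) = rcomp s u by apply: rHomP.
  by rewrite zx -rcompA -hs subrr.
pose g : rHom N (modprod P T1) := rpair (rpair x s : rHom N P) t.
have gW y : W (g y).
  by split; [exact: xZ|have := congr1 (fun h : rHom _ _ => h y) Et].
have [g' hg'] := into_sub gW.
have [y Ey] := hp N CN (g' : rHom N (subfg artR W)).
have qy : rcomp q y = g.
  apply: rHomP => n; rewrite -[RHS]hg'.
  by have := congr1 (fun h : rHom _ _ => sub_val (h n)) Ey => /= ->.
exists y; split=> [|v].
  by apply: rHomP => n; have := congr1 (fun h : rHom _ (modprod P T1) => (h n).1.1) qy.
rewrite hs ha'; congr (w _); apply: rHomP => n.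
by have := congr1 (fun h : rHom _ (modprod P T1) => (h (v n)).1.2) qy.
Qed.

(** One degree of the recursion; the cocycles are stored because the outgoing differential is not
    part of the state. *)
Record state (M : fgmod R) := State {
  sF : fgmod R; sFC : C sF; sZ : submodule sF; sA : fnl M sF }.

Lemma model_exists X t : conc t X -> exists m : model E C X, conc t m.
Proof.
move=> cX; have [C0 _] := additiveC.
pose Rel i (s : state (X i)) (s' : state (X (i + 1))) (d : rHom (sF s) (sF s')) :=
  [/\ forall y, sZ s y <-> d y = 0, forall y, sZ s' (d y),
    forall u : rHom (X (i + 1)) (sF s), sA s' (rcomp d u) = sA s (rcomp u d_[X, i]) &
    forall N, C N -> forall x : rHom N (sF s'), (forall y, sZ s' (x y)) ->
      forall z : fnl (X i) N, (forall u, sA s' (rcomp x u) = z (rcomp u d_[X, i])) ->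
      exists y : rHom N (sF s), x = rcomp d y /\ forall v, z v = sA s (rcomp y v)].
have stepP i (s' : state (X (i + 1))) : exists s : state (X i), exists d, @Rel i s s' d.
  have [F' [d [a' [CF' h1 h2 h3]]]] :=
    model_step (d_[X, i] : rHom (X i) (X (i + 1))) (sZ s') (sA s') (sFC s').
  by exists (State CF' (sm_ker (rfun d)) a'), d; split.
have z0 M : exists z : fnl M (mod0 R), forall v, z v = 0.
  by apply: mk_linear => a x y; rewrite scaler0 addr0.
pose a0 i : state (X i) := State C0 sm_full (projT1 (cid (z0 (X i)))).
have a0E i v : sA (a0 i) v = 0 by apply: (projT2 (cid (z0 (X i)))).
have m0 : zero_module (mod0 R) by move=> x; apply/matrixP => ? [].
have [a [ahi alo]] := @int_rec_down (fun i => state (X i)) t a0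
  (fun i s' => projT1 (cid (stepP i s'))).
have /dep_choice[d hd] : forall i, exists d, @Rel i (a i) (a (i + 1)) d.
  move=> i; have [ti|it] := ltP t i; last first.
    rewrite alo //; exact: (projT2 (cid (stepP i (a (i + 1))))).
  rewrite !ahi //; last by rewrite (lt_trans ti) // ltrDl.
  exists 0; split=> //.
  - by move=> u; rewrite !a0E.
  - move=> N CN x _ z _; exists 0; split=> [|v].
      by apply: rHomP => y; rewrite (m0 (x y)).
    by rewrite a0E (rHom_from0 v (cX i ti)) linear0.
have dd i x : d (i + 1) (d i x) = 0.
  by case: (hd (i + 1)) => h _ _ _; apply/h; case: (hd i).
have cF : forall i, t < i -> zero_module (sF (a i)) by move=> i ti; rewrite ahi.
pose S := @Cpx R (fun i => sF (a i)) (fun i => rfun (d i)) dd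
  (ex_intro _ t cF).
have CS : Kminus C S by move=> i; apply: sFC.
have SD i (u : rHom (X (i + 1)) (S i)) :
    sA (a (i + 1)) (rcomp d_[S, i] u) = sA (a i) (rcomp u d_[X, i]).
  by case: (hd i) => _ _ h _; apply: h.
have SL i N : C N -> forall x : rHom N (S (i + 1)), (forall y, d_[S, i + 1] (x y) = 0) ->
    forall z : fnl (X i) N, (forall u, sA (a (i + 1)) (rcomp x u) = z (rcomp u d_[X, i])) ->
    exists y : rHom N (S i), x = rcomp d_[S, i] y /\ forall v, z v = sA (a i) (rcomp y v).
  move=> CN x dx z zx; case: (hd i) => _ _ _ h; apply: h => // y.
  by case: (hd (i + 1)) => h _ _ _; apply/h; apply: dx.
by exists (@Model _ _ E C X S (fun i => sA (a i)) CS SD SL).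
Qed.

End Existence.

Section ModelFunctor.
Variables (k : comNzRingType) (R : algType k) (E : lmodType k).
Variables (C : fgmod R -> Prop) (additiveC : additive_sub C).
Variable m : forall X : cpx R, model E C X.
Implicit Types (X Y Z W : cpx R).

Definition mfun : functor_data R := FunctorData (fobj := fun X => mS (m X))
  (fun X Y f => projT1 (cid (overK_lift (m X) (m Y) f))).

Lemma mfun_over X Y (f : KHom X Y) : overK (m := m X) (m' := m Y) f (fmap mfun f).
Proof. exact: (projT2 (cid (overK_lift (m X) (m Y) f))). Qed.

Lemma over_post X Y (n : model E C X) (n1 n2 : model E C Y) (f : KHom X Y)
    (g : KHom n n1) (h : KHom n1 n2) :
  overK f g -> overK (m := n1) (m' := n2) (hid Y) h -> overK (m := n) (m' := n2) f (h ∘ g).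
Proof. by move=> o o'; have := overK_comp o o'; rewrite hcomp1l. Qed.

Lemma over_pre X Y (n1 n2 : model E C X) (n : model E C Y) (f : KHom X Y)
    (g : KHom n2 n) (h : KHom n1 n2) :
  overK (m := n1) (m' := n2) (hid X) h -> overK f g -> overK (m := n1) (m' := n) f (g ∘ h).
Proof. by move=> o o'; have := overK_comp o o'; rewrite hcomp1r. Qed.

Lemma mfun_functor : is_functor (Kminus C) (Kminus C) mfun.
Proof.
split=> [X _|X Y f g _ _|X _|X Y Z g f _ _ _].
- exact: mC.
- apply: (overK_uniq (mfun_over (f + g))); apply: overK_add; exact: mfun_over.
- apply: (overK_uniq (mfun_over (hid X))); exact: overK_id.
- apply: (overK_uniq (mfun_over (g ∘ f))); apply: overK_comp; exact: mfun_over.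
Qed.

(** The cone of a lift of f is itself a model of the cone of f, and any two models of the same
    complex are canonically isomorphic. *)
Lemma mfun_triangulated : triangulated_functor C mfun.
Proof.
split; first exact: mfun_functor.
have [phi hphi] := dep_choice (fun X =>
  overK_lift (m (cshift X)) (mshift (m X)) (hid (cshift X))).
exists phi; split.
- by move=> X _; apply: overK_iso (hphi X).
- move=> X Y f _ _.
  apply: (overK_uniq (m := m (cshift X)) (m' := mshift (m Y)) (f := hshift f)).
    exact: over_pre (hphi X) (overK_shift (mfun_over f)).
  exact: over_post (mfun_over _) (hphi Y).
move=> X Y Z u v w CX CY CZ.
move=> [X' [Y' [f [a [b [c [[CX' CY'] [isa isb isc] bu cv aw]]]]]]].
have [g o] := over_lift (m X') (m Y') f.
have FE : fmap mfun (hclass f) = hclass g.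
  by apply: (overK_uniq (mfun_over (hclass f))); exists f, g.
pose mc := mcone additiveC o.
have [c' oc'] := overK_lift (m (cone f)) mc (hid (cone f)).
have isc' : is_iso c' by apply: overK_iso oc'.
have CF := mfun_functor; have [_ _ F1 Fc] := CF.
have Ccone := Kminus_cone additiveC f CX' CY'.
exists (m X'), (m Y'), g, (fmap mfun a), (fmap mfun b), (c' ∘ fmap mfun c).
split; first by split; apply: mC.
- split; [exact: functor_iso CF CX CX' isa|exact: functor_iso CF CY CY' isb|].
  apply: iso_comp isc' _; exact: functor_iso CF CZ Ccone isc.
- by rewrite -Fc // bu Fc // FE.
- rewrite -hcompA -Fc // cv Fc // hcompA; congr (_ ∘ _).
  apply: (overK_uniq (m := m Y') (m' := mc) (f := hclass (cone_in f))).
    exact: over_post (mfun_over _) oc'.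
  by exists (cone_in f), (cone_in g); split=> //; apply: over_cone_in.
- have -> : hshift (fmap mfun a) ∘ (phi X ∘ fmap mfun w) =
      phi X' ∘ fmap mfun (hclass (cone_out f)) ∘ fmap mfun c.
    apply: (overK_uniq (m := m Z) (m' := mshift (m X')) (f := hshift a ∘ w)).
      exact: overK_comp (over_post (mfun_over w) (hphi X)) (overK_shift (mfun_over a)).
    rewrite aw; exact: overK_comp (mfun_over c) (over_post (mfun_over _) (hphi X')).
  rewrite !hcompA; congr (_ ∘ _).
  apply: (overK_uniq (m := m (cone f)) (m' := mshift (m X')) (f := hclass (cone_out f))).
    exact: over_post (mfun_over _) (hphi X').
  apply: over_pre oc' _.
  by exists (cone_out f), (cone_out g); split=> //; apply: over_cone_out.
Qed.

End ModelFunctor.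

(** * Comparison on the projective objects *)

Section StalkClasses.
Variables (k : comNzRingType) (R : algType k).
Implicit Types (X Y Z W : cpx R) (M N : fgmod R).

(** For Y in degrees at most 0, Hom(P_M, Y) is the cokernel of Hom(M, Y^-1) -> Hom(M, Y^0). *)
Lemma stalk_class M Y : conc 0 Y -> exists cl : {linear rHom M (Y 0) -> KHom (stalk M) Y},
  [/\ forall v, exists v0 : chmap (stalk M) Y, cl v = hclass v0 /\ forall x, v0 0 x = v x,
    forall f : chmap (stalk M) Y, hclass f = cl (f 0) &
    forall v, cl v = 0 <-> exists w : rHom M (Y (-1)), forall x, v x = d_[Y, -1] (w x)].
Proof.
move=> cY; have dv (v : rHom M (Y 0)) x : d_[Y, 0] (v x) = 0 by apply: cY.
have l : linear (fun v : rHom M (Y 0) => hclass (smap (dv v))).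
  by move=> a v w; rewrite -hclassZE -hclassD; congr hclass; apply: chmap_stalkP.
have [cl hcl] := mk_linear l; exists cl; split=> [v|f|v].
- by exists (smap (dv v)).
- by rewrite hcl; congr hclass; apply: chmap_stalkP.
- by rewrite hcl stalk_null.
Qed.

End StalkClasses.

Section Main.
Variables (k : comNzRingType) (R : algType k) (artR : artin_algebra R).
Variables (E : lmodType k) (hullE : hull_of_top E).
Variable C : fgmod R -> Prop.
Hypotheses (additiveC : additive_sub C) (karoubiC : karoubi_closed C)
  (approxC : approximating C).
Implicit Types (X Y Z W V : cpx R) (M N : fgmod R).
Local Notation HC := (heart C).

(** The degree 0 part of an approximation of P_K is a right C-approximation of K. *)
Lemma approx_cover (K : fgmod R) : exists (B : fgmod R) (p : rHom B K), C B /\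
  forall N, C N -> forall g : rHom N K, exists g', g = rcomp p g'.
Proof.
have [X [q [CX cq]]] := approx_exists approxC (stalk K).
have [q0 Eq] := hrep q; exists (X 0), (q0 0 : rHom (X 0) K); split=> // N CN g.
have [f Ef] := clocal_lift (sHom g) cq (Kminus_stalk additiveC CN).
have [f0 Ef0] := hrep f; exists (f0 0 : rHom N (X 0)).
have [u Eu] : exists u : rHom N K, u = rcomp (q0 0 : rHom (X 0) K) (f0 0 : rHom N (X 0)).
  by eexists.
rewrite -Eu; apply: sHom_inj; rewrite -Ef Ef0 Eq hcomp_class.
by congr hclass; apply: chmap_stalkP => x; rewrite [RHS](_ : _ = u x) // Eu.
Qed.

Variable SC : functor_data R.
Hypotheses (heartSC : forall M, HC (SC (stalk M))).
Variable theta : forall M Y, KHom Y (SC (stalk M)) -> Edual E (KHom (stalk M) Y).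
Arguments theta : clear implicits.
Hypotheses
  (thetaB : forall M Y, HC Y -> bijective (theta M Y))
  (thetaN : forall M Y Y' (h : KHom Y' Y) f v, HC Y -> HC Y' ->
     theta M Y' (f ∘ h) v = theta M Y f (h ∘ v))
  (thetaS : forall M M' (u : KHom (stalk M) (stalk M')) Y f v, HC Y ->
     theta M' Y (fmap SC u ∘ f) v = theta M Y f (v ∘ u)).

Lemma duality_ext M Y f g : HC Y -> (forall v, theta M Y f v = theta M Y g v) -> f = g.
Proof.
move=> hY e; apply: (bij_inj (thetaB M hY)); exact: linear_ext.
Qed.

Lemma duality_surj M Y (z : {linear KHom (stalk M) Y -> E}) : HC Y ->
  exists f, forall v, theta M Y f v = z v.
Proof. by move=> hY; have [f <-] := bijective_inv z (thetaB M hY); exists f. Qed.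

(** S_C P_M is isomorphic to a complex S' in degrees at most 0, and D Hom(M, N) = Hom(P_N, S') is a
    cokernel by [stalk_class]. The form w is the one that the duality assigns to the identity. *)
Lemma all_presented M : presented E C M.
Proof.
pose S := SC (stalk M); have hS : HC S by apply: heartSC.
have [[CS [S' [a [CS' cS' [a' [a'a aa']]]]]] _] := hS.
have [cl [cl1 cl2 cl3]] := stalk_class M cS'.
have lw : linear (fun v : rHom M (S' 0) => theta M S (hid S) (a' ∘ cl v)).
  by move=> c v v'; rewrite linearP hcompDr hcompZr linearP.
have [w hw] := mk_linear lw.
exists (S' (-1)), (S' 0), (d_[S', -1] : rHom (S' (-1)) (S' 0)), w.
have key N : C N -> exists clN : {linear rHom N (S' 0) -> KHom (stalk N) S'},
   [/\ forall u s, w (rcomp s u) = theta M (stalk N) (a' ∘ clN s) (sHom u),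
    forall f, exists s, f = clN s &
    forall s, clN s = 0 -> exists c, s = rcomp (d_[S', -1] : rHom (S' (-1)) (S' 0)) c].
  move=> CN; have [clN [n1 n2 n3]] := stalk_class N cS'; exists clN; split.
  - move=> u s; rewrite hw -[a' ∘ clN s]hcomp1l thetaN //; last exact: stalk_heart.
    rewrite -hcompA; congr (theta _ _ _ (a' ∘ _)).
    have [s0 [-> Es]] := n1 s; have [t0 [-> Et]] := cl1 (rcomp s u).
    rewrite hcomp_class; congr hclass; apply: chmap_stalkP => x.
    by rewrite Et /= Es.
  - by move=> f; have [f0 ->] := hrep f; exists (f0 0); rewrite n2.
  - by move=> s /n3[c hc]; exists c; apply: rHomP.
split.
- by split; apply: CS'.
- move=> t; rewrite hw; have -> : cl (rcomp d_[S', -1] t) = 0 by apply/cl3; exists t.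
  by rewrite hcomp0r linear0.
- move=> N CN z; have [clN [n1 n2 n3]] := key N CN.
  have [u0 hu0] := choice (fun f => @sHom_surj _ _ M N f).
  have lz : linear (fun f => z (u0 f)).
    move=> c f g; rewrite -linearP; congr (z _); apply: sHom_inj.
    have [h hh] := mk_linear (@sHom_linear _ _ M N).
    by rewrite -hu0 -hh linearP !hh -!hu0.
  have [z' hz'] := mk_linear lz.
  have [f Ef] := duality_surj z' (stalk_heart additiveC CN).
  have [s Es] := n2 (a ∘ f); exists s => u.
  rewrite n1 -Es hcompA a'a hcomp1l Ef hz'; congr (z _).
  by apply: sHom_inj; rewrite -hu0.
move=> N CN s s0; have [clN [n1 n2 n3]] := key N CN; apply: n3.
have : a' ∘ clN s = 0.
  apply: (duality_ext (stalk_heart additiveC CN)) => v.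
  have [u ->] := sHom_surj v; rewrite -n1 s0.
  by rewrite -[0 in RHS](hcomp0r _ (hid S)) thetaN ?hcomp0l ?linear0 //; apply: stalk_heart.
by move=> e; rewrite -[clN s]hcomp1l -aa' -hcompA e hcomp0r.
Qed.

Lemma good_model X : exists m : model E C X, conc 0 X -> conc 0 m.
Proof.
have [c|nc] := pselect (conc 0 X).
  by have [m cm] := model_exists artR additiveC all_presented approx_cover c; exists m.
have [t ct] := cbounded X.
by have [m cm] := model_exists artR additiveC all_presented approx_cover ct; exists m.
Qed.

(** * A model of a stalk represents the dual of Hom(P_M, -) on the heart *)

Section StalkModel.
Variables (M : fgmod R) (m : model E C (stalk M)).
Hypothesis cm : conc 0 m.

Lemma stalk_model_null Y (g : chmap Y m) : Kminus C Y ->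
  (forall v : rHom M (Y 0), mA m 0 (rcomp (g 0) v) = 0) -> hclass g = 0.
Proof.
move=> CY h; have [s hs] : exists s : forall i, {linear rHom (stalk M i) (Y (i + 1)) -> E},
    forall i v, s i v = 0.
  by apply: mk_linears => i a x y; rewrite scaler0 addr0.
apply: (model_null (s := s)) => // i v; rewrite !hs addr0.
have [e|ne] := eqVneq (i + 1) 0; last first.
  by rewrite (rHom_from0 v (stalk_low ne)) rcomp0r linear0.
by move: v; rewrite e.
Qed.

Lemma stalk_model_heart : HC m.
Proof.
have Cm := mC m; split; first exact: le0_conc.
apply: ge0_of => // Y CY cY f; have [f0 ->] := hrep f; apply: stalk_model_null => // v.
by rewrite (rHom_to0 v) ?rcomp0r ?linear0 //; apply: cY.
Qed.

Lemma stalk_model_form : exists om : {linear KHom (stalk M) m -> E},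
  forall f : chmap (stalk M) m, om (hclass f) = mA m 0 (f 0).
Proof.
have w0 (f f' : chmap (stalk M) m) : hclass f = hclass f' -> mA m 0 (f 0) = mA m 0 (f' 0).
  move=> /hclassE/hclass_eq0/stalk_null[w hw]; apply/subr0_eq; rewrite -linearB.
  have -> : (f 0 : rHom M (m 0)) - (f' 0 : rHom M (m 0)) = rcomp d_[m, -1] (w : rHom M (m (-1))).
    by apply: rHomP => x; apply: hw.
  have := mD (w : rHom (stalk M (-1 + 1)) (m (-1))).
  have -> : rcomp (w : rHom (stalk M (-1 + 1)) (m (-1))) d_[stalk M, -1] = 0.
    by apply: rHomP => x; apply: linear0.
  by rewrite linear0.
have l : linear (fun f : KHom (stalk M) m => mA m 0 (hrepr f 0)).
  move=> a f g; rewrite -linearP.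
  rewrite (w0 _ (a *: hrepr f + hrepr g)) ?hreprK //.
  by rewrite hclassD hclassZE !hreprK.
have [om hom] := mk_linear l; exists om => f; rewrite hom.
by apply: w0; rewrite hreprK.
Qed.

Variable om : {linear KHom (stalk M) m -> E}.
Hypothesis omE : forall f : chmap (stalk M) m, om (hclass f) = mA m 0 (f 0).

Lemma stalk_model_inj Y (g : KHom Y m) : HC Y -> (forall v, om (g ∘ v) = 0) -> g = 0.
Proof.
move=> [[CY [Y' [y [CY' cY' [y' [y'y yy']]]]]] _] h.
rewrite -[g]hcomp1r -y'y hcompA; have [g0 Eg0] := hrep (g ∘ y').
rewrite Eg0 [hclass g0]stalk_model_null ?hcomp0l // => v.
have [cl [cl1 cl2 cl3]] := stalk_class M cY'; have [v0 [Ev Ev0]] := cl1 v.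
have := h (y' ∘ hclass v0); rewrite hcompA Eg0 hcomp_class omE => <-.
by congr (mA m 0 _); apply: rHomP => x; rewrite /= Ev0.
Qed.

Lemma stalk_model_surj Y (z : {linear KHom (stalk M) Y -> E}) : HC Y ->
  exists g, forall v, om (g ∘ v) = z v.
Proof.
move=> [[CY [Y' [y [CY' cY' [y' [y'y yy']]]]]] _].
have [cl [cl1 cl2 cl3]] := stalk_class M cY'.
have lb : linear (fun v : rHom M (Y' 0) => z (y' ∘ cl v)).
  by move=> a v w; rewrite linearP hcompDr hcompZr linearP.
have [b0 hb0] := mk_linear lb.
(* Only degree 0 matters, so [b0] is extended by zero; compatibility there holds because
   coboundaries are null homotopic. *)
have [b [bE bn]] : exists b : forall i, {linear rHom (stalk M i) (Y' i) -> E},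
    (forall v, b 0 v = b0 v) /\ forall i v, i != 0 -> b i v = 0.
  have [c hc] : exists c : forall i, {linear rHom (stalk M i) (Y' i) -> E},
      forall i v, c i v = 0.
    by apply: mk_linears => i a v w; rewrite scaler0 addr0.
  exists (fun i => match i return {linear rHom (stalk M i) (Y' i) -> E} with
    | Posz 0 => b0 | j => c j end).
  by split=> // -[[|n]|n] //= v _; rewrite hc.
have [i u|g hg] := model_lift m (b := b) CY'.
  have -> : rcomp u d_[stalk M, i] = 0 by apply: rHomP => x; apply: linear0.
  rewrite linear0; have [e|/bn->//] := eqVneq (i + 1) 0.
  have ei : i = -1 by apply/eqP; rewrite -addr_eq0 e.
  subst i; have := bE (rcomp d_[Y', -1] (u : rHom M (Y' (-1)))) => E1.
  apply: etrans E1 _; rewrite hb0.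
  have -> : cl (rcomp d_[Y', -1] (u : rHom M (Y' (-1)))) = 0 by apply/cl3; exists u.
  by rewrite hcomp0r linear0.
exists (hclass g ∘ y) => v; have [v0 Ev0] := hrep (y ∘ v).
rewrite -hcompA Ev0 hcomp_class omE.
have := hg 0 (v0 0); rewrite bE hb0 -cl2 -Ev0 hcompA y'y hcomp1l => <-.
by congr (mA m 0 _); apply: rHomP.
Qed.

(** Uniqueness of representing objects: m with [om] and S_C P_M with the form of its identity
    represent the same functor on the heart. *)
Lemma stalk_model_iso (al : KHom m (SC (stalk M))) :
  (forall v, theta M m al v = om v) -> is_iso al.
Proof.
move=> hal; have hm := stalk_model_heart; have hS := heartSC M.
have [be hbe] := stalk_model_surj (theta M _ (hid (SC (stalk M)))) hS.
exists be; split.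
  apply/subr0_eq/stalk_model_inj => // v.
  rewrite hcompBl linearB /= hcomp1l -hcompA hbe -hal -thetaN // hcomp1l.
  by rewrite subrr.
by apply: (duality_ext hS) => v; rewrite thetaN // hal hbe.
Qed.

End StalkModel.

Hypothesis SCF : is_functor (Proj HC) (Inj HC) SC.
Variable m : forall X, model E C X.
Hypothesis cm : forall X, conc 0 X -> conc 0 (m X).
Local Notation F := (mfun m).

Lemma mfun_iso : naturally_isomorphic (Proj HC) F SC.
Proof.
have cs M : conc 0 (m (stalk M)) by apply/cm/conc_stalk.
have [om hom] := dep_choice (fun M => @stalk_model_form M (m (stalk M))).
have [al hal] := dep_choice (fun M => duality_surj (om M) (stalk_model_heart (cs M))).
have isal M : is_iso (al M) by apply: (stalk_model_iso (cs M) (hom M) (hal M)).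
have natal M M' (u : KHom (stalk M) (stalk M')) :
    fmap SC u ∘ al M = al M' ∘ fmap F u.
  have hm := stalk_model_heart (cs M); have hm' := stalk_model_heart (cs M').
  apply: (duality_ext hm) => v; rewrite thetaS // thetaN // !hal.
  have [u0 [g0 [Eu Eg o]]] := mfun_over m u; have [v0 ->] := hrep v.
  rewrite Eg Eu !hcomp_class !hom.
  apply: etrans (esym (o 0 (v0 0))); by congr (mA _ 0 _); apply: rHomP.
have [FF1 _ F1 Fc] := mfun_functor m; have [_ _ S1 Sc] := SCF.
have PK X : Proj HC X -> Kminus C X by case=> /heart_Kminus.
(* A projective X is moved to a stalk by a chosen isomorphism; naturality of [al] on stalks makes
   the transported maps natural. *)
have /dep_choice[alp halp] X : exists alp : KHom (F X) (SC X), Proj HC X ->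
    exists M (a : KHom X (stalk M)) (a' : KHom (stalk M) X),
    [/\ C M, a' ∘ a = hid X, a ∘ a' = hid (stalk M) & alp = fmap SC a' ∘ al M ∘ fmap F a].
  have [/(proj_stalk artR additiveC karoubiC)[M [CM [a [a' [h1 h2]]]]]|n] :=
      pselect (Proj HC X); last by exists 0.
  by exists (fmap SC a' ∘ al M ∘ fmap F a) => _; exists M, a, a'.
have pS M : C M -> Proj HC (stalk M) by apply: stalk_proj.
exists alp; split=> [X pX|X Y f pX pY].
  have [M [a [a' [CM h1 h2 ->]]]] := halp X pX.
  have isa : is_iso a by exists a'.
  have isa' : is_iso a' by exists a.
  apply: iso_comp; last exact: functor_iso (mfun_functor m) (PK _ pX) (PK _ (pS _ CM)) isa.
  by apply: iso_comp => //; apply: functor_iso SCF (pS _ CM) pX isa'.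
have [M [a [a' [CM h1 h2 ->]]]] := halp X pX.
have [N [b [b' [CN h3 h4 ->]]]] := halp Y pY.
have pM := pS M CM; have pN := pS N CN.
have -> : fmap SC f ∘ (fmap SC a' ∘ al M ∘ fmap F a) =
    fmap SC b' ∘ (fmap SC (b ∘ f ∘ a') ∘ al M) ∘ fmap F a.
  rewrite !hcompA -!Sc //; congr (_ ∘ _ ∘ _); congr (fmap SC _).
  by rewrite !hcompA h3 hcomp1l.
rewrite natal -!hcompA -!Fc //; try by apply: PK.
by rewrite -!hcompA h1 hcomp1r.
Qed.

End Main.

Theorem proposition4p1
  (k : comNzRingType) (R : algType k) (artinR : artin_algebra R)
  (E : lmodType k) (hullE : hull_of_top E)
  (C : fgmod R -> Prop)
  (additiveC : additive_sub C) (fullC : strictly_full C)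
  (karoubiC : karoubi_closed C) (approxC : approximating C)
  (piC : functor_data R) (eps : forall X : cpx R, KHom (piC X) X)
  (piC_approx : approximation_functor C eps)
  (SA : functor_data R)
  (SA_functor : is_functor (Proj (heart (@whole R))) (Inj (heart (@whole R))) SA)
  (SA_serre : serre_duality (@whole R) E SA) :
  let HC := heart C in
  let SC := functor_comp piC SA in
  [/\ serre_duality C E SC /\ is_functor (Proj HC) (Inj HC) SC,
      fully_faithful (Proj HC) SC,
      forall M : fgmod R, C M -> indecomposable M ->
        forall L : cpx R, simple_quotient HC (stalk M) L ->
          injective_hull HC L (SC (stalk M)) &
      exists F : functor_data R,
        triangulated_functor C F /\ naturally_isomorphic (Proj HC) F SC].
Proof.
move=> HC SC.
have heartSC M : HC (SC (stalk M)).
  by apply: (SC_heart artinR additiveC karoubiC piC_approx SA_functor);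
    apply: stalk_proj_whole.
have SCF := SC_functor artinR hullE additiveC karoubiC approxC piC_approx SA_functor SA_serre.
have [th [h1 h2 h3 h4]] :=
  SC_duality artinR piC_approx SA_functor SA_serre.
split.
- split; last exact: SCF.
  exact: (SC_serre artinR piC_approx SA_functor SA_serre).
- exact: (SC_fully_faithful artinR hullE additiveC karoubiC approxC piC_approx
    SA_functor SA_serre).
- move=> M CM indM L sL.
  apply: (serre_hull artinR hullE additiveC karoubiC approxC (S := SC) _ (theta := th)) => //.
  + by move=> N _; apply: heartSC.
  + by move=> N Y _; apply: h1.
  + by move=> N Y c f g v _; apply: h2.
  + by move=> N Y Y' h f v _; apply: h3.
have [m cm] := dep_choice (good_model artinR additiveC approxC heartSC h1 h3).
exists (mfun m); split; first exact: mfun_triangulated.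
exact: (mfun_iso artinR additiveC karoubiC approxC heartSC h1 h3 h4 SCF cm).
Qed.
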